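(* Let $X$ be a Banach space, $r>0$, and let $A$, $A_1$, $A_2$, $a$ be as in the context, with fundamental solution $G(\cdot)$. Assume that $a(\cdot)\in L^\infty([-r,0],\mathbb R)$ and that $$\mathscr D((-A)^\mu)\subset \mathscr D(A_1),\qquad \mathscr D((-A)^\nu)\subset\mathscr D(A_2)$$ for some $0<\mu,\nu<1$. Then: (a) for any $\gamma\in[\nu,1)$ there exist constants $C_{n,\gamma}>0$, $n\in\mathbb N=\{0,1,2,\dots\}$, depending on $n$ and $\gamma$, such that for every $n\in\mathbb N$ $$\|(-A)^\gamma G(t)\|\le \frac{C_{n,\gamma}}{(t-nr)^\gamma}\quad\text{for all } t\in(nr,(n+1)r],$$ $$\Big\|\int_s^t(-A)^\gamma G(u)\,du\Big\|\le C_{n,\gamma}\quad\text{for all } nr\le s<t\le (n+1)r;$$ (b) for any $\gamma\in[\nu,1)$ and $0<\beta<1-\gamma$ there exist constants $C_{n,\beta,\gamma}>0$, $n\in\mathbb N$, depending on $n$, $\beta$ and $\gamma$, such that for every $n\in\mathbb N$ $$\|(-A)^\gamma(G(t)-G(s))\|\le C_{n,\beta,\gamma}\frac{(t-s)^\beta}{(s-nr)^{\beta+\gamma}}\quad\text{for all } nr<s<t<(n+1)r.$$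
   Context: Setting. $A:\mathscr D(A)\subset X\to X$ is the infinitesimal generator of an analytic semigroup $e^{tA}$, $t\ge0$, on $X$ of negative type: there exist constants $M\ge1$ and $\omega>0$ such that $\|e^{tA}\|\le Me^{-\omega t}$ and $\|Ae^{tA}\|\le M/t$ for all $t>0$, and for each $\gamma\in(0,1)$ there is a constant $M_\gamma>0$ such that $\|(-A)^\gamma e^{tA}\|\le M_\gamma/t^\gamma$ for all $t>0$, where $(-A)^\gamma$ is the standard fractional power. $A_1,A_2$ are closed linear operators in $X$ with $\mathscr D(A_i)\supset\mathscr D(A)$, $i=1,2$, and $a(\cdot):[-r,0]\to\mathbb R$ is a function (in $L^2([-r,0],\mathbb R)$ in general). Fundamental solution. $G(\cdot):\mathbb R\to\mathscr L(X)$ (bounded linear operators on $X$) denotes the fundamental solution of the retarded equation $\frac{d}{dt}y(t)=Ay(t)+A_1y(t-r)+\int_{-r}^0a(\theta)A_2y(t+\theta)\,d\theta$. It is strongly continuous on $[0,\infty)$ and satisfies $G(0)=I$, $G(t)=0$ for $t<0$, and for $t\ge0$ $$G(t)=e^{tA}+\int_0^te^{(t-s)A}A_1G(s-r)\,ds+\int_0^t\int_{-r}^0a(\theta)e^{(t-s)A}A_2G(s+\theta)\,d\theta\,ds .$$ Integrals of operator-valued functions are understood in the strong sense (improper where necessary). Norms of operators are operator norms on $X$. *)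

(* Defs.v *)
From HB Require Import structures.
From mathcomp Require Import all_boot all_order all_algebra.
From mathcomp Require Import all_classical all_reals all_analysis.
Set Implicit Arguments.
Unset Strict Implicit.
Unset Printing Implicit Defensive.
Import Order.TTheory GRing.Theory Num.Theory.
Import numFieldNormedType.Exports.
Local Open Scope classical_set_scope.
Local Open Scope ring_scope.

Section Bochner.
Context {R : realType} {X : normedModType R}.
Let mu := @lebesgue_measure R.
Implicit Types (D : set R) (f : R -> X) (s : seq (set R * X)).

(* The list [:: (E_1, v_1); ...; (E_n, v_n)] encodes the simple function
   \1_(E_1) v_1 + ... + \1_(E_n) v_n; the sets E_i may overlap. *)
Definition simple_on D s := forall p, p \in s ->
  [/\ measurable p.1, p.1 `<=` D & (mu p.1 < +oo)%E].
Definition simple_eval s (t : R) : X := \sum_(p <- s) \1_(p.1) t *: p.2.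
Definition simple_integral s : X := \sum_(p <- s) fine (mu p.1) *: p.2.

(* The second condition is strong measurability: f is, almost everywhere on D,
   the pointwise limit of simple functions. In particular the values of f on a
   null set are irrelevant. *)
Definition is_bochner D f (v : X) := exists s_ : nat -> seq (set R * X),
  [/\ forall k, simple_on D (s_ k),
      {ae mu, forall t, D t -> simple_eval (s_ k) t @[k --> \oo] --> f t},
      (\int[mu]_(t in D) `|f t - simple_eval (s_ k) t|%:E)%E
        @[k --> \oo] --> 0%E
    & simple_integral (s_ k) @[k --> \oo] --> v].

Definition bochner_integrable D f := exists v, is_bochner D f v.

Definition bochner D f : X := xget 0 [set v | is_bochner D f v].

End Bochner.

Section Operators.
Context {R : realType} {X : normedModType R}.

(* A possibly unbounded operator in X. The values of opfun outside opdom are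
   meaningless, so every use has to assert membership in the domain. *)
Record operator := Operator { opdom : set X; opfun :> X -> X }.

Definition linear_operator (B : operator) :=
  opdom B 0 /\
  forall (c : R) (x y : X), opdom B x -> opdom B y ->
    opdom B (c *: x + y) /\ B (c *: x + y) = c *: B x + B y.

Definition closed_operator (B : operator) :=
  closed [set p : X * X | opdom B p.1 /\ p.2 = B p.1].

Definition bounded_linear (S : X -> X) := linear S /\ continuous S.

(* Operator norm of an everywhere defined linear map, +oo if unbounded. *)
Definition opnorm (S : X -> X) : \bar R :=
  ereal_sup [set `|S x|%:E | x in [set x : X | `|x| <= 1]].

(* S maps X into the domain of B, and the norm of B S is at most c. *)
Definition comp_norm_le (B : operator) (S : X -> X) (c : R) :=
  (forall x, opdom B (S x)) /\ (opnorm (fun x => B (S x)) <= c%:E)%E.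

End Operators.
Arguments operator {R} X.

Section Semigroups.
Context {R : realType} {X : normedModType R}.
Implicit Types (T : R -> X -> X) (A : operator X).

(* Only the values T t with 0 <= t matter. *)
Definition C0_semigroup T :=
  [/\ forall t, 0 <= t -> bounded_linear (T t),
      T 0 = id,
      forall s t, 0 <= s -> 0 <= t -> T (s + t) = T s \o T t
    & forall x, T h x @[h --> 0^'+] --> x].

Definition is_generator A T := forall x y : X,
  (opdom A x /\ A x = y) <-> (h^-1 *: (T h x - x) @[h --> 0^'+] --> y).

(* The open sector of half-angle atan delta around the positive real axis; a
   pair z stands for the complex number z.1 + i z.2. *)
Definition sector (delta : R) : set (R * R) := [set z | `|z.2| < delta * z.1].

(* T extends holomorphically to a sector. As X is a real Banach space, the
   extension takes values in the operators on the complexification X + i X: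
   P z + i Q z is its value at z, with P z and Q z acting on X.
   Holomorphy is real differentiability plus the Cauchy-Riemann equations. *)
Definition analytic_semigroup T :=
  exists (delta : R) (P Q : R * R -> X -> X),
  let F v z : X * X := (P z v, Q z v) in
  [/\ 0 < delta,
      forall z, sector delta z -> bounded_linear (P z) /\ bounded_linear (Q z),
      forall t, 0 < t -> P (t, 0) = T t /\ Q (t, 0) = cst 0,
      forall z w, sector delta z -> sector delta w -> forall v : X,
        P (z + w) v = P z (P w v) - Q z (Q w v) /\
        Q (z + w) v = P z (Q w v) + Q z (P w v)
    & forall v : X,
        (forall z, sector delta z ->
          differentiable (F v) z /\
          let dF := 'd (F v) z (1, 0) in
          'd (F v) z (0, 1) = (- dF.2, dF.1)) /\
        F v z @[z --> within (sector delta) (nbhs (0, 0))] --> (v, 0 : X)].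

Definition Gamma (g : R) : R :=
  (\int[lebesgue_measure]_(t in `]0, +oo[) (t `^ (g - 1) * expR (- t)))%R.

(* (-A)^(-g), where A generates T *)
Definition neg_frac_power T (g : R) (y : X) : X :=
  (Gamma g)^-1 *: bochner `]0, +oo[ (fun t => t `^ (g - 1) *: T t y).

(* (-A)^g, where A generates T, as the inverse of (-A)^(-g) *)
Definition frac_power T (g : R) : operator X :=
  Operator (range (neg_frac_power T g))
           (fun x => xget 0 [set y | neg_frac_power T g y = x]).

Definition negative_type A T :=
  (exists M omega : R, [/\ 1 <= M, 0 < omega
    & forall t, 0 < t ->
        (opnorm (T t) <= (M * expR (- omega * t))%:E)%E /\
        comp_norm_le A (T t) (M / t)]) /\
  (forall g : R, 0 < g < 1 -> exists2 Mg : R, 0 < Mg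
    & forall t, 0 < t -> comp_norm_le (frac_power T g) (T t) (Mg / t `^ g)).

End Semigroups.

Section FundamentalSolution.
Context {R : realType} {X : normedModType R}.
Variables (T : R -> X -> X) (r : R) (A1 A2 : operator X) (a : R -> R).

(* y' = A y + A1 y(. - r) + \int_(-r)^0 a(theta) A2 y(. + theta) dtheta, where
   A generates T. The integrals are Bochner integrals applied to each x.
   fs_dom and fs_integrable say that the terms A_i G(.) x occurring in the
   equation are meaningful: defined almost everywhere (typically not at the
   multiples of r) and locally integrable. *)
Record fundamental_solution (G : R -> X -> X) : Prop := {
  fs_bounded : forall t, bounded_linear (G t);
  fs_continuous : forall x, {within `[0, +oo[, continuous (fun t => G t x)};
  fs_0 : G 0 = id;
  fs_neg : forall t, t < 0 -> G t = cst 0;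
  fs_dom : forall x, {ae (@lebesgue_measure R), forall s, 0 <= s ->
    opdom A1 (G s x) /\ opdom A2 (G s x)};
  fs_integrable : forall x t, 0 <= t ->
    bochner_integrable `[0, t] (fun s => A1 (G s x)) /\
    bochner_integrable `[0, t] (fun s => A2 (G s x));
  fs_equation : forall x t, 0 <= t ->
    let delay s := T (t - s) (A1 (G (s - r) x)) in
    let distr s th := a th *: T (t - s) (A2 (G (s + th) x)) in
    [/\ bochner_integrable `[0, t] delay,
        {ae (@lebesgue_measure R), forall s, s \in `[0, t] ->
          bochner_integrable `[- r, 0] (distr s)},
        bochner_integrable `[0, t] (fun s => bochner `[- r, 0] (distr s))
      & G t x = T t x + bochner `[0, t] delay
                + bochner `[0, t] (fun s => bochner `[- r, 0] (distr s))]
}.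

End FundamentalSolution.

(* Main.v *)
Require Import Defs.
From HB Require Import structures.
From mathcomp Require Import all_boot all_order all_algebra.
From mathcomp Require Import all_classical all_reals all_analysis.
From mathcomp Require Import measurable_realfun ess_sup_inf.
From mathcomp Require Import ring lra.
Set Implicit Arguments.
Unset Strict Implicit.
Unset Printing Implicit Defensive.
Import Order.TTheory GRing.Theory Num.Theory.
Import numFieldNormedType.Exports.
Local Open Scope classical_set_scope.
Local Open Scope ring_scope.


(** Write [S e] for [(-A)^g e^(eA)] and [kern a u] for [u^(-a)], extended by 0 to
    [u <= 0]. The equation says that [G t x - e^(tA) x] is the convolution of the
    semigroup with a forcing, namely [A1 G(u - r) x] plus the distributed term.

    Suppose that the norm of the forcing is at most [H u]. Applying [S e] under
    the integral shows that [S e (G t x)] is bounded, uniformly in [e], by the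
    value at [t] of [kern g * |x|] plus the convolution of [kern g] with [H].
    Moreover [S e - S e'] is small, of order [(e - e')^b], at the price of a
    kernel of order [g + b], so [S e (G t x)] is Cauchy as [e] tends to 0. As
    [(-A)^(-g)] is bounded and injective, this forces [G t x] into the domain of
    [(-A)^g], with the same bound ([frac_power_regularity]). Hoelder continuity
    follows in the same way from the interpolated estimate
    [smooth_power_holder] ([frac_power_holder]). Everything is absolutely
    convergent, since only exponents below 1 occur.

    It remains to find [H]. The closed graph theorem turns the domain inclusions
    into bounds of [A1] and [A2] by [(-A)^mu] and [(-A)^nu] ([relative_bound]).
    One proceeds by induction on the stages between consecutive multiples of
    [r]. Up to time [(n + 1) r] the term [A1 G(u - r) x] involves [G] only up to
    time [n r], and the induction hypothesis bounds it by a sum of kernels of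
    order [mu] with singularities at multiples of [r]. The distributed term is
    at most a constant times the integral of [|A2 G x|] over the past. Inserting
    this into the regularity estimate with exponent [nu] gives an integral
    inequality for [|A2 G x|], so Gronwall's inequality bounds that integral by
    a multiple of [|x|] ([forcing_weighted_step]). The resulting [H] is the
    function [weight], for all exponents [g] at once, and the regularity
    estimate with exponent [mu] provides the hypothesis for the next stage.

    Convolving a kernel of order [a < 1] with [weight] again gives a sum of
    kernels of order [a] at the multiples of [r]; to the right of [n r] the last
    one dominates. This is the singularity at [n r] in the theorem. It is
    integrable, whence the bound of the integrals over the stage. *)

(** * Bochner integrals through dominated remainders *)

Section SimpleFunctions.
Context {R : realType} {X : normedModType R}.
Local Notation mu := (@lebesgue_measure R).
Implicit Types (D B : set R) (s : seq (set R * X)) (c v : X).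

Definition scale_simple (a : R) s := [seq (p.1, a *: p.2) | p <- s].

Lemma simple_eval_cat s1 s2 t :
  simple_eval (s1 ++ s2) t = simple_eval s1 t + simple_eval s2 t.
Proof. by rewrite /simple_eval big_cat. Qed.

Lemma simple_eval_scale a s t :
  simple_eval (scale_simple a s) t = a *: simple_eval s t.
Proof.
rewrite /simple_eval big_map scaler_sumr; apply: eq_bigr => p _ /=.
by rewrite !scalerA mulrC.
Qed.

Lemma simple_integral_cat s1 s2 :
  simple_integral (s1 ++ s2) = simple_integral s1 + simple_integral s2.
Proof. by rewrite /simple_integral big_cat. Qed.

Lemma simple_integral_scale a s :
  simple_integral (scale_simple a s) = a *: simple_integral s.
Proof.
rewrite /simple_integral big_map scaler_sumr; apply: eq_bigr => p _ /=.
by rewrite !scalerA mulrC.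
Qed.

Lemma simple_on_cat D s1 s2 :
  simple_on D s1 -> simple_on D s2 -> simple_on D (s1 ++ s2).
Proof. by move=> h1 h2 p; rewrite mem_cat => /orP[/h1|/h2]. Qed.

Lemma simple_on_scale D a s : simple_on D s -> simple_on D (scale_simple a s).
Proof. by move=> h _ /mapP[p /h ps ->]. Qed.

Lemma simple_on_tail D p s : simple_on D (p :: s) -> simple_on D s.
Proof. by move=> h q qs; apply: h; rewrite inE qs orbT. Qed.

Lemma simple_evalD D s1 s2 t :
  `|simple_eval s1 t - simple_eval s2 t| =
  `|simple_eval (s1 ++ scale_simple (-1) s2) t|.
Proof. by rewrite simple_eval_cat simple_eval_scale scaleN1r. Qed.

(** The constant [c] makes the induction go through: on the first set of the
    list its value is absorbed into the constant. *)
Lemma measurable_norm_simple_add D s c : simple_on D s ->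
  measurable_fun setT (fun t => `|simple_eval s t + c|).
Proof.
elim: s c => [|[E v] s IH] c hs.
  by under eq_fun do rewrite /simple_eval big_nil add0r; exact: measurable_cst.
have [mE _ _] := hs _ (mem_head _ _).
rewrite [X in measurable_fun _ X](_ : _ = fun t => if t \in E
    then `|simple_eval s t + (v + c)| else `|simple_eval s t + c|).
  apply: measurable_fun_ifT; [|apply: IH; exact: simple_on_tail hs..].
  by apply: (measurable_fun_bool true); rewrite setTI preimage_mem_true.
apply/funext => t; rewrite /simple_eval big_cons /= indicE.
case: (t \in E); rewrite ?scale1r ?scale0r ?add0r//.
by rewrite addrA [v + _]addrC.
Qed.

Lemma measurable_norm_simple D s : simple_on D s ->
  measurable_fun setT (fun t => `|simple_eval s t|).
Proof.
move=> hs; have := @measurable_norm_simple_add D s 0 hs.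
by under eq_fun do rewrite addr0.
Qed.

(** Splitting [B] along the first set of the list turns a list with a constant
    into two shorter ones, so that overlapping sets cause no trouble. *)
Lemma simple_integral_norm_le_on D s c B :
  simple_on D s -> measurable B -> (mu B < +oo)%E ->
  (`|\sum_(p <- s) fine (mu (p.1 `&` B)) *: p.2 + fine (mu B) *: c|%:E
    <= \int[mu]_(t in B) `|simple_eval s t + c|%:E)%E.
Proof.
elim: s c B => [|[E v] s IH] c B hs mB fB.
  under eq_integral do rewrite /simple_eval big_nil add0r.
  rewrite big_nil add0r integral_cst// normrZ ger0_norm ?fine_ge0//.
  rewrite mulrC EFinM fineK// ge0_fin_numE//.
have [mE _ _] := hs _ (mem_head _ _); have hs' := simple_on_tail hs.
have BE : (B `&` E) `|` (B `\` E) = B by rewrite setUIDK.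
have mBE : measurable (B `&` E) by exact: measurableI.
have mBD : measurable (B `\` E) by exact: measurableD.
have dBE : [disjoint B `&` E & B `\` E].
  by apply/disj_setPS => t [[_ ?] []].
have fBE : (mu (B `&` E) < +oo)%E.
  by apply: le_lt_trans fB; apply: le_measure; rewrite ?inE//; exact: subIsetl.
have fBD : (mu (B `\` E) < +oo)%E.
  by apply: le_lt_trans fB; apply: le_measure; rewrite ?inE//; exact: subDsetl.
have fine_split P : measurable P ->
  fine (mu (P `&` B)) = fine (mu (P `&` (B `&` E))) + fine (mu (P `&` (B `\` E))).
  move=> mP; rewrite -{1}BE setIUr measureU; last first.
  - by rewrite -subset0 => t [[_ [_ ?]] [_ []]].
  - exact: measurableI.
  - exact: measurableI.
  have fin Q : measurable Q -> (mu Q < +oo)%E -> mu (P `&` Q) \is a fin_num.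
    move=> mQ fQ; rewrite ge0_fin_numE//; apply: le_lt_trans fQ.
    by apply: le_measure; rewrite ?inE//; first exact: measurableI.
  by rewrite fineD//; exact: fin.
rewrite -[in leRHS]BE ge0_integral_setU//; last first.
  rewrite BE; apply/measurable_EFinP; apply: measurable_funTS.
  exact: measurable_norm_simple_add hs.
have -> : (\int[mu]_(t in B `&` E) `|simple_eval ((E, v) :: s) t + c|%:E =
           \int[mu]_(t in B `&` E) `|simple_eval s t + (v + c)|%:E)%E.
  apply: eq_integral => t /[!inE] -[_ Et].
  rewrite /simple_eval big_cons /= indicE mem_set//= scale1r.
  by rewrite addrA [v + _]addrC.
have -> : (\int[mu]_(t in B `\` E) `|simple_eval ((E, v) :: s) t + c|%:E =
           \int[mu]_(t in B `\` E) `|simple_eval s t + c|%:E)%E.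
  apply: eq_integral => t /[!inE] -[_ Et].
  by rewrite /simple_eval big_cons /= indicE memNset//= scale0r add0r.
apply: le_trans (leeD (IH (v + c) _ hs' mBE fBE) (IH c _ hs' mBD fBD)).
rewrite -EFinD lee_fin; apply: le_trans (ler_normD _ _).
rewrite le_eqVlt; apply/orP; left; apply/eqP; congr `|_|.
rewrite big_cons /=.
have -> : \sum_(p <- s) fine (mu (p.1 `&` B)) *: p.2 =
  \sum_(p <- s) fine (mu (p.1 `&` (B `&` E))) *: p.2 +
  \sum_(p <- s) fine (mu (p.1 `&` (B `\` E))) *: p.2.
  rewrite -big_split /= !big_seq; apply: eq_bigr => p ps.
  by have [mp _ _] := hs' p ps; rewrite fine_split// scalerDl.
have := fine_split _ (@measurableT _ R); rewrite !setTI => ->.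
rewrite setIC scalerDr scalerDl.
by rewrite [RHS](AC ((1*2)*2) ((2*(1*4))*(3*5))).
Qed.

(** The sets of the list lie in their union [B], which has finite measure, so
    the preceding estimate applies with [c = 0]. *)
Lemma simple_integral_norm_le D s : measurable D -> simple_on D s ->
  (`|simple_integral s|%:E <= \int[mu]_(t in D) `|simple_eval s t|%:E)%E.
Proof.
move=> mD hs; pose B := \big[setU/set0]_(p <- s) p.1.
have [mB BD fB pB] : [/\ measurable B, B `<=` D, (mu B < +oo)%E &
    forall p, p \in s -> p.1 `<=` B].
  rewrite /B; elim: s hs {B} => [|p s IH] hs.
    by rewrite big_nil measure0; split.
  have [mp pD fp] := hs _ (mem_head _ _).
  have [mB BD fB pB] := IH (simple_on_tail hs); rewrite big_cons; split.
  - exact: measurableU.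
  - by rewrite subUset.
  - apply: le_lt_trans (measureU2 _ _ _) _ => //; exact: lte_add_pinfty.
  - move=> q; rewrite inE => /orP[/eqP ->|qs]; first exact: subsetUl.
    by apply: subset_trans (pB _ qs) _; exact: subsetUr.
have := @simple_integral_norm_le_on D s 0 B hs mB fB.
rewrite scaler0 addr0; under eq_integral do rewrite addr0.
have -> : \sum_(p <- s) fine (mu (p.1 `&` B)) *: p.2 = simple_integral s.
  rewrite /simple_integral !big_seq; apply: eq_bigr => p ps.
  by rewrite (setIidl (pB _ ps)).
move/le_trans; apply; apply: ge0_subset_integral => //.
apply/measurable_EFinP; apply: measurable_funTS.
exact: measurable_norm_simple hs.
Qed.

Lemma simple_norm_integral_lty D s : measurable D -> simple_on D s ->
  (\int[mu]_(t in D) `|simple_eval s t|%:E < +oo)%E.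
Proof.
move=> mD; elim: s => [|[E v] s IH] hs.
  under eq_integral do rewrite /simple_eval big_nil normr0.
  by rewrite integral0 ltry.
have [mE ED fE] := hs _ (mem_head _ _); have hs' := simple_on_tail hs.
have ms := measurable_norm_simple hs'.
apply: (@le_lt_trans _ _ (\int[mu]_(t in D) ((\1_E t * `|v|)%:E +
    `|simple_eval s t|%:E))%E).
  apply: ge0_le_integral => //.
  - apply/measurable_EFinP; apply: measurable_funTS.
    exact: measurable_norm_simple hs.
  - apply: emeasurable_funD; apply/measurable_EFinP; apply: measurable_funTS => //.
    exact: measurable_funM.
  - move=> t _; rewrite -EFinD lee_fin /simple_eval big_cons /=.
    by apply: le_trans (ler_normD _ _) _; rewrite normrZ ger0_norm.
rewrite ge0_integralD//; last 2 first.
- apply/measurable_EFinP; apply: measurable_funTS; exact: measurable_funM.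
- by apply/measurable_EFinP; apply: measurable_funTS.
apply: lte_add_pinfty; last exact: IH.
under eq_integral do rewrite EFinM.
rewrite ge0_integralZr//; last by apply/measurable_EFinP/measurable_funTS.
rewrite integral_indic//; apply: lte_mul_pinfty => //; last exact: ltry.
by rewrite (setIidl ED) ge0_fin_numE.
Qed.

End SimpleFunctions.

Section BlowUp.
Import HBNNSimple.
Context {R : realType}.
Local Notation mu := (@lebesgue_measure R).
Implicit Types (D N : set R) (g : R -> \bar R).

(** Replacing a bound by [+oo] on a null set changes no integral and turns
    almost everywhere estimates into pointwise ones, which survive translations. *)
Definition blow N g t : \bar R := if t \in N then +oo%E else g t.

Lemma measurable_blow D N g : measurable D -> measurable N ->
  measurable_fun (D `\` N) g -> measurable_fun D (blow N g).
Proof.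
move=> mD mN mg; have mb : measurable_fun D (fun t => t \in N).
  apply: (measurable_fun_bool true); rewrite preimage_mem_true.
  exact: measurableI.
apply: measurable_fun_if => //.
by rewrite preimage_mem_false.
Qed.

Lemma integral_blow D N g : measurable D -> measurable N -> mu N = 0%E ->
  measurable_fun (D `\` N) g -> (forall t, (D `\` N) t -> 0 <= g t)%E ->
  (\int[mu]_(t in D) blow N g t = \int[mu]_(t in D `\` N) g t)%E.
Proof.
move=> mD mN N0 mg g0; rewrite (@ge0_negligible_integral _ _ _ mu D N)//.
- by apply: eq_integral => t /[!inE] -[_ Nt]; rewrite /blow memNset.
- exact: measurable_blow.
- by move=> t Dt; rewrite /blow; case: ifPn => // /negP; rewrite inE => Nt; exact: g0.
Qed.

Lemma blow_ge0 D N g : (forall t, D t -> 0 <= g t)%E ->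
  forall t, D t -> (0 <= blow N g t)%E.
Proof. by move=> g0 t Dt; rewrite /blow; case: ifP => // _; exact: g0. Qed.

#[export] Instance ae_lebesgue_filter : Filter (almost_everywhere mu).
Proof. exact: ae_filter_ringOfSetsType. Qed.

(** The integral of a nonnegative function is a supremum over the simple
    functions below it, hence monotone in the domain and in the function. *)
Lemma ge0_integral_le_gen D E g1 g2 : E `<=` D ->
  (forall t, E t -> 0 <= g1 t <= g2 t)%E -> (forall t, D t -> 0 <= g2 t)%E ->
  (\int[mu]_(t in E) g1 t <= \int[mu]_(t in D) g2 t)%E.
Proof.
move=> ED g12 g20; rewrite !ge0_integralE//; last by move=> t /g12 /andP[].
apply: le_ereal_sup => _ [h hle <-]; exists h => // t.
apply: le_trans (hle t) _; rewrite !patchE.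
case: ifPn => [/[!inE] Et|_].
  by rewrite mem_set; [have /andP[] := g12 _ Et|exact: ED].
by case: ifPn => // /[!inE]; exact: g20.
Qed.

Lemma ge0_integral_subset D E g : E `<=` D -> (forall t, D t -> 0 <= g t)%E ->
  (\int[mu]_(t in E) g t <= \int[mu]_(t in D) g t)%E.
Proof.
by move=> ED g0; apply: ge0_integral_le_gen => // t /ED /g0 ->; rewrite lexx.
Qed.

End BlowUp.

Section HasIntegral.
Context {R : realType} {X : normedModType R}.
Local Notation mu := (@lebesgue_measure R).
Implicit Types (D : set R) (f : R -> X) (v : X) (g : R -> \bar R).

(** The Bochner integral, tested with one simple function per precision
    instead of a sequence. Bounding the remainders by measurable functions makes
    all manipulations independent of the measurability of their norms. *)
Definition has_integral D f v := forall e : R, 0 < e -> exists s g,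
  [/\ simple_on D s, measurable_fun D g,
      forall t, D t -> (`|f t - simple_eval s t|%:E <= g t)%E,
      (\int[mu]_(t in D) g t <= e%:E)%E & `|v - simple_integral s| <= e].

(** The simple functions approximate [f] up to a measurable error of small
    integral, so the inequality passes from them to [f]. *)
Lemma has_integral_norm_le D f v g : measurable D -> has_integral D f v ->
  measurable_fun D g -> (forall t, D t -> 0 <= g t)%E ->
  {ae mu, forall t, D t -> (`|f t|%:E <= g t)%E} ->
  (`|v|%:E <= \int[mu]_(t in D) g t)%E.
Proof.
move=> mD fv mg g0 fg; apply/lee_addgt0Pr => e e0.
have e20 : 0 < e / 2 by rewrite divr_gt0.
have [s [g1 [hs mg1 fsg1 ig1 vs]]] := fv _ e20.
have g10 t : D t -> (0 <= g1 t)%E.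
  by move=> Dt; apply: le_trans (fsg1 t Dt); rewrite lee_fin.
apply: (@le_trans _ _ (`|v - simple_integral s|%:E + `|simple_integral s|%:E)%E).
  by rewrite -EFinD lee_fin; apply: le_trans (ler_normD _ _); rewrite subrK.
rewrite addeC; apply: (@le_trans _ _
  ((\int[mu]_(t in D) (g t + g1 t)) + (e / 2)%:E)%E); last first.
  rewrite ge0_integralD//; rewrite -addeA; apply: leeD => //.
  by rewrite [in leRHS](splitr e) EFinD leeD.
apply: leeD; last by rewrite lee_fin.
apply: le_trans (simple_integral_norm_le mD hs) _.
apply: ae_ge0_le_integral => //.
- by apply/measurable_EFinP; apply: measurable_funTS; exact: measurable_norm_simple hs.
- by move=> t Dt; apply: adde_ge0; [exact: g0|exact: g10].
- exact: emeasurable_funD.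
- apply: filterS fg => t fgt Dt.
  apply: le_trans (leeD (fgt Dt) (fsg1 t Dt)).
  rewrite -EFinD lee_fin -[X in `|X|](subKr (f t)).
  exact: ler_normB.
Qed.

Lemma has_integralD D f1 f2 v1 v2 : measurable D ->
  has_integral D f1 v1 -> has_integral D f2 v2 ->
  has_integral D (fun t => f1 t + f2 t) (v1 + v2).
Proof.
move=> mD h1 h2 e e0; have e20 : 0 < e / 2 by rewrite divr_gt0.
have [s1 [g1 [hs1 mg1 fsg1 ig1 vs1]]] := h1 _ e20.
have [s2 [g2 [hs2 mg2 fsg2 ig2 vs2]]] := h2 _ e20.
have g10 t : D t -> (0 <= g1 t)%E.
  by move=> Dt; apply: le_trans (fsg1 t Dt); rewrite lee_fin.
have g20 t : D t -> (0 <= g2 t)%E.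
  by move=> Dt; apply: le_trans (fsg2 t Dt); rewrite lee_fin.
exists (s1 ++ s2), (g1 \+ g2)%E; split.
- exact: simple_on_cat.
- exact: emeasurable_funD.
- move=> t Dt; apply: le_trans (leeD (fsg1 t Dt) (fsg2 t Dt)).
  rewrite -EFinD lee_fin simple_eval_cat opprD addrACA; exact: ler_normD.
- by rewrite ge0_integralD// (splitr e) EFinD leeD.
- rewrite simple_integral_cat opprD addrACA (splitr e).
  by apply: le_trans (ler_normD _ _) _; exact: lerD.
Qed.

Lemma has_integral_ae D f1 f2 v : measurable D ->
  {ae mu, forall t, D t -> f1 t = f2 t} ->
  has_integral D f1 v -> has_integral D f2 v.
Proof.
move=> mD [N [mN N0 sN]] h e e0.
have [s [g [hs mg fsg ig vs]]] := h _ e0.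
have mgN : measurable_fun (D `\` N) g by apply: measurable_funS mg.
have g0 t : D t -> (0 <= g t)%E.
  by move=> Dt; apply: le_trans (fsg t Dt); rewrite lee_fin.
exists s, (blow N g); split => //.
- exact: measurable_blow.
- move=> t Dt; rewrite /blow; case: ifPn => [_|/negP]; [exact: leey|rewrite inE => Nt].
  suff <- : f1 t = f2 t by exact: fsg.
  by apply: contrapT => f12; apply: Nt; apply: sN => /= /(_ Dt).
- rewrite integral_blow//; last by move=> t [/g0].
  by apply: le_trans ig; apply: ge0_subset_integral => //; exact: measurableD.
Qed.

Lemma eq_has_integral D f1 f2 v : measurable D ->
  (forall t, D t -> f1 t = f2 t) -> has_integral D f1 v -> has_integral D f2 v.
Proof. by move=> mD f12; apply: has_integral_ae => //; exact: aeW. Qed.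

Lemma is_bochner_has_integral D f v : measurable D ->
  is_bochner D f v -> has_integral D f v.
Proof.
move=> mD [s_ [hs [N [mN N0 sN]] cI cv]] e e0.
have cN t : D t -> ~ N t -> simple_eval (s_ k) t @[k --> \oo] --> f t.
  by move=> Dt Nt; apply: contrapT => h; apply: Nt; apply: sN => /= /(_ Dt).
have mDN : measurable (D `\` N) by exact: measurableD.
have mf k : measurable_fun (D `\` N) (fun t => `|f t - simple_eval (s_ k) t|).
  apply: (@measurable_fun_cvg _ _ _ _
      (fun j t => `|simple_eval (s_ j) t - simple_eval (s_ k) t|)).
    move=> j; apply: measurable_funTS; under eq_fun do rewrite (simple_evalD D).
    apply: (@measurable_norm_simple _ _ D); apply: simple_on_cat => //.
    exact: simple_on_scale.
  move=> t [Dt Nt]; apply: cvg_norm; apply: cvgB; [exact: cN|exact: cvg_cst].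
have [k [ck1 ck2]] : exists k,
    (\int[mu]_(t in D) `|f t - simple_eval (s_ k) t|%:E <= e%:E)%E /\
    `|v - simple_integral (s_ k)| <= e.
  have n1 : \forall k \near \oo,
      (\int[mu]_(t in D) `|f t - simple_eval (s_ k) t|%:E <= e%:E)%E.
    have /fine_cvgP[fin /cvgrPdist_le /(_ _ e0)] := cI.
    apply: filterS2 fin => k fink; rewrite sub0r normrN => h.
    by rewrite -(fineK fink) lee_fin; apply: le_trans h; exact: ler_norm.
  have n2 : \forall k \near \oo, `|v - simple_integral (s_ k)| <= e.
    by move/cvgrPdist_le : cv => /(_ _ e0).
  near \oo => k; exists k; split; near: k; [exact: n1|exact: n2].
exists (s_ k), (blow N (fun t => `|f t - simple_eval (s_ k) t|%:E)); split => //.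
- by apply: measurable_blow => //; exact/measurable_EFinP.
- by move=> t Dt; rewrite /blow; case: ifPn => // _; exact: leey.
- rewrite integral_blow//; last exact/measurable_EFinP.
  apply: le_trans ck1; apply: ge0_integral_subset => //; exact: subDsetl.
Unshelve. all: end_near. Qed.

Lemma bochner_has_integral D f : measurable D ->
  bochner_integrable D f -> has_integral D f (bochner D f).
Proof.
move=> mD [v fv]; apply: is_bochner_has_integral => //.
exact: (xgetPex 0 (P := [set v | is_bochner D f v]) (ex_intro _ v fv)).
Qed.

(** Off a null set the norm of [f] is a limit of norms of simple functions,
    hence measurable; on the null set the majorant is infinite. *)
Lemma bochner_norm_majorant D f : measurable D -> bochner_integrable D f ->
  exists g, [/\ measurable_fun D g, forall t, D t -> (`|f t|%:E <= g t)%E,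
    {ae mu, forall t, D t -> g t = `|f t|%:E}
    & (\int[mu]_(t in D) g t < +oo)%E].
Proof.
move=> mD [v fv]; have [s_ [hs [N [mN N0 sN]] cI cv]] := fv.
have cN t : D t -> ~ N t -> simple_eval (s_ k) t @[k --> \oo] --> f t.
  by move=> Dt Nt; apply: contrapT => h; apply: Nt; apply: sN => /= /(_ Dt).
have mDN : measurable (D `\` N) by exact: measurableD.
have mf : measurable_fun (D `\` N) (fun t => `|f t|).
  apply: (@measurable_fun_cvg _ _ _ _ (fun j t => `|simple_eval (s_ j) t|)).
    by move=> j; apply: measurable_funTS; apply: (@measurable_norm_simple _ _ D).
  by move=> t [Dt Nt]; apply: cvg_norm; exact: cN.
have mfE : measurable_fun (D `\` N) (fun t => `|f t|%:E) by exact/measurable_EFinP.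
exists (blow N (fun t => `|f t|%:E)); split => //.
- exact: measurable_blow.
- by move=> t Dt; rewrite /blow; case: ifPn => // _; exact: leey.
- exists N; split => // t /= h; apply: contrapT => Nt; apply: h => _.
  by rewrite /blow memNset.
- rewrite integral_blow//.
  have [s [g [hs1 mg fsg ig _]]] := is_bochner_has_integral mD fv ltr01.
  have g0 t : D t -> (0 <= g t)%E.
    by move=> Dt; apply: le_trans (fsg t Dt); rewrite lee_fin.
  have ms : measurable_fun D (fun t => `|simple_eval s t|%:E).
    apply/measurable_EFinP; apply: measurable_funTS.
    exact: measurable_norm_simple hs1.
  apply: (@le_lt_trans _ _ (\int[mu]_(t in D `\` N) (g t + `|simple_eval s t|%:E))%E).
    apply: ge0_le_integral => //.
    + apply: emeasurable_funD; [exact: measurable_funS mg|exact: measurable_funS ms].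
    + move=> t [Dt _]; apply: le_trans (leeD (fsg t Dt) (lexx _)).
      by rewrite -EFinD lee_fin; apply: le_trans (ler_normD _ _); rewrite subrK.
  apply: (@le_lt_trans _ _ (\int[mu]_(t in D) (g t + `|simple_eval s t|%:E))%E).
    apply: ge0_integral_subset; first exact: subDsetl.
    by move=> t Dt; apply: adde_ge0 => //; exact: g0.
  rewrite ge0_integralD//; apply: lte_add_pinfty.
    by apply: le_lt_trans ig _; exact: ltry.
  exact: simple_norm_integral_lty.
Qed.

Lemma has_integral_extend D E f v : measurable D -> measurable E -> D `<=` E ->
  has_integral D f v -> has_integral E (fun t => \1_D t *: f t) v.
Proof.
move=> mD mE DE h e e0; have [s [g [hs mg fsg ig vs]]] := h _ e0.
exists s, (g \_ D); split => //.
- by move=> p /hs[mp pD fp]; split => //; exact: subset_trans DE.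
- by apply/measurable_restrict => //; rewrite setIidr.
- move=> t Et; rewrite patchE indicE; case: ifPn => tD.
    by rewrite scale1r; apply: fsg; rewrite inE in tD.
  rewrite scale0r sub0r normrN /simple_eval big_seq big1 ?normr0// => p /hs[_ pD _].
  rewrite indicE memNset ?scale0r// => /pD; move: tD; rewrite notin_setE.
  by [].
- by rewrite -integral_mkcondr (setIidr DE).
Qed.

(** Bounded linear maps act on the values of the approximating simple functions
    and commute with their integrals. *)
Lemma has_integral_map D f v (S : X -> X) (c : R) : measurable D ->
  linear S -> (forall x, `|S x| <= c * `|x|) ->
  has_integral D f v -> has_integral D (fun t => S (f t)) (S v).
Proof.
move=> mD lS Sc h e e0.
pose SL : {linear X -> X} := HB.pack S (GRing.isLinear.Build R X X *:%R S lS).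
have SE x : S x = SL x by [].
have SZ a x : S (a *: x) = a *: S x by rewrite SE linearZZ.
have Sc' x : `|S x| <= (`|c| + 1) * `|x|.
  apply: le_trans (Sc x) _; apply: ler_wpM2r => //.
  by apply: le_trans (ler_norm _) _; rewrite lerDl.
have c0 : 0 < `|c| + 1 by rewrite ltr_wpDl.
have ec0 : 0 < e / (`|c| + 1) by rewrite divr_gt0.
have [s [g [hs mg fsg ig vs]]] := h _ ec0.
have evS t : simple_eval [seq (p.1, S p.2) | p <- s] t = S (simple_eval s t).
  rewrite /simple_eval big_map SE linear_sum; apply: eq_bigr => p _ /=.
  by rewrite SZ.
have intS : simple_integral [seq (p.1, S p.2) | p <- s] = S (simple_integral s).
  rewrite /simple_integral big_map SE linear_sum; apply: eq_bigr => p _ /=.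
  by rewrite SZ.
have g0 t : D t -> (0 <= g t)%E.
  by move=> Dt; apply: le_trans (fsg t Dt); rewrite lee_fin.
exists [seq (p.1, S p.2) | p <- s], (fun t => (`|c| + 1)%:E * g t)%E; split.
- by move=> _ /mapP[p /hs ps ->].
- exact: measurable_funeM.
- move=> t Dt; rewrite evS !SE -linearB -SE.
  apply: le_trans (lee_wpmul2l _ (fsg t Dt)); last by rewrite lee_fin ltW.
  by rewrite -EFinM lee_fin.
- rewrite (ge0_integralZl_EFin _ _ _ _ (ltW c0))//.
  apply: le_trans (lee_wpmul2l _ ig) _; first by rewrite lee_fin ltW.
  by rewrite -EFinM lee_fin mulrCA divff ?mulr1// gt_eqF.
- rewrite intS !SE -linearB -SE; apply: le_trans (Sc' _) _.
  apply: le_trans (ler_wpM2l (ltW c0) vs) _.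
  by rewrite mulrCA divff ?mulr1// gt_eqF.
Qed.

Lemma has_integralZ D f v a : measurable D ->
  has_integral D f v -> has_integral D (fun t => a *: f t) (a *: v).
Proof.
move=> mD; apply: (@has_integral_map _ _ _ ( *:%R a) `|a|) => //.
  by move=> k x y; rewrite scalerDr !scalerA mulrC.
by move=> x; rewrite normrZ.
Qed.

Lemma has_integralB D f1 f2 v1 v2 : measurable D ->
  has_integral D f1 v1 -> has_integral D f2 v2 ->
  has_integral D (fun t => f1 t - f2 t) (v1 - v2).
Proof.
move=> mD h1 h2; have := has_integralD mD h1 (has_integralZ (-1) mD h2).
by rewrite scaleN1r; apply: eq_has_integral => // t _; rewrite scaleN1r.
Qed.

Lemma has_integral_unique D f v1 v2 : measurable D ->
  has_integral D f v1 -> has_integral D f v2 -> v1 = v2.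
Proof.
move=> mD h1 h2; apply/eqP; rewrite -subr_eq0 -normr_le0 -lee_fin.
have := @has_integral_norm_le D _ _ (cst 0%E) mD (has_integralB mD h1 h2).
rewrite integral0; apply => //.
by apply: aeW => t _; rewrite subrr normr0.
Qed.

End HasIntegral.

Section ScalarDensity.
Context {R : realType} {X : normedModType R}.
Local Notation mu := (@lebesgue_measure R).
Import HBNNSimple.
Implicit Types (D : set R) (h : {nnsfun (measurableTypeR R) >-> R}) (l : seq R).

Lemma nnsfun_levels h : exists l, (forall y, y \in l -> 0 < y) /\
  forall t, h t = \sum_(y <- l) y * \1_(h @^-1` [set y]) t.
Proof.
have /finite_seqP[s hs] : finite_set (range h) by exact: fimfunP.
exists [seq y <- undup s | y != 0]; split.
  move=> y; rewrite mem_filter mem_undup => /andP[y0 ys].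
  have [t _ ty] : range h y by rewrite hs.
  by rewrite lt_def y0 -ty; exact: fun_ge0.
move=> t; rewrite big_filter.
have hts : h t \in undup s.
  by rewrite mem_undup; have : [set` s] (h t) by rewrite -hs; exists t.
rewrite big_mkcond (bigD1_seq (h t))//= ?undup_uniq// big1 ?addr0.
  rewrite indicE mem_set//= mulr1; case: eqP => //=.
move=> y yt; case: ifP => // _; rewrite indicE memNset ?mulr0//= => hy.
by rewrite hy eqxx in yt.
Qed.

Lemma level_measure_le h (y : R) : 0 <= y -> (forall t, 0 <= h t) ->
  (y%:E * mu (h @^-1` [set y]) <= \int[mu]_t (h t)%:E)%E.
Proof.
move=> y0 h0.
rewrite -[X in mu X]setIT -integral_indic// -ge0_integralZl_EFin//; last exact/measurable_EFinP.
apply: ge0_le_integral => //.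
- by move=> t _; rewrite -EFinM lee_fin mulr_ge0.
- by apply: measurable_funeM; apply/measurable_EFinP.
- exact/measurable_EFinP.
- move=> t _; rewrite -EFinM lee_fin indicE; case: (boolP (t \in _)) => [|_].
    by rewrite inE /= => ->; rewrite mulr1.
  by rewrite mulr0; exact: h0.
Qed.

(** The list is formed by the level sets of [h], of finite measure because [h]
    is integrable, with multiples of [v]. *)
Lemma nnsfun_simple D h (v : X) : measurable D -> (forall t, ~ D t -> h t = 0) ->
  (\int[mu]_t (h t)%:E < +oo)%E -> exists s,
  [/\ simple_on D s, forall t, simple_eval s t = h t *: v &
      simple_integral s = fine (\int[mu]_t (h t)%:E)%E *: v].
Proof.
move=> mD hD hfin; have [l [l0 hl]] := nnsfun_levels h.
have h0 t : 0 <= h t by exact: fun_ge0.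
have finl y : y \in l -> (mu (h @^-1` [set y]) < +oo)%E.
  move=> /l0 y0; have := le_lt_trans (level_measure_le (ltW y0) h0) hfin.
  by move: (mu _) => [r| |]//; rewrite ?ltry// gt0_muley ?lte_fin.
exists [seq (h @^-1` [set y], y *: v) | y <- l]; split.
- move=> _ /mapP[y yl ->] /=; split; [exact: (measurable_funPTI h (measurable_set1 y))| |exact: finl].
  move=> t /= hty; apply: contrapT => nD; have := hD _ nD; rewrite hty => y0.
  by have := l0 _ yl; rewrite y0 ltxx.
- move=> t; rewrite /simple_eval big_map hl scaler_suml; apply: eq_bigr => y _ /=.
  by rewrite scalerA mulrC.
- rewrite /simple_integral big_map.
  rewrite (eq_bigr (fun y => (fine (mu (h @^-1` [set y])) * y) *: v)); last first.
    by move=> y _; rewrite scalerA.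
  rewrite -scaler_suml; congr (_ *: _).
  have -> : (\int[mu]_t (h t)%:E =
     \int[mu]_t \sum_(y <- l | y \in l) (y * \1_(h @^-1` [set y]) t)%:E)%E.
    by apply: eq_integral => t _; rewrite hl -sumEFin big_seq.
  under eq_integral do rewrite big_mkcond.
  rewrite ge0_integral_sum//; last 2 first.
  - move=> y; case: (y \in l) => //; apply/measurable_EFinP; exact: measurable_funM.
  - by move=> y t _; case: ifP => // /l0 y0; rewrite lee_fin mulr_ge0// ltW.
  rewrite [in LHS]big_seq -[RHS]/(fine _).
  have -> : (\sum_(y <- l) \int[mu]_t (if y \in l then
      (y * \1_(h @^-1` [set y]) t)%:E else 0) =
      \sum_(y <- l | y \in l) (fine (mu (h @^-1` [set y])) * y)%:E)%E.
    rewrite [LHS]big_seq; apply: eq_bigr => y yl; rewrite yl.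
    under eq_integral do rewrite EFinM.
    rewrite ge0_integralZl_EFin//; last 2 first.
    - exact/measurable_EFinP.
    - by rewrite ltW// l0.
    rewrite integral_indic// setIT EFinM fineK 1?muleC//.
    by rewrite ge0_fin_numE// finl.
  by rewrite sumEFin.
Qed.

(** The approximations come from simple functions below [a] with almost the
    same integral. *)
Lemma has_integral_scaler D (a : R -> R) (v : X) : measurable D ->
  measurable_fun D a -> (forall t, D t -> 0 <= a t) ->
  (\int[mu]_(t in D) (a t)%:E < +oo)%E ->
  has_integral D (fun t => a t *: v) (fine (\int[mu]_(t in D) (a t)%:E)%E *: v).
Proof.
move=> mD ma a0 afin e e0.
have v0 : 0 < `|v| + 1 by rewrite ltr_wpDl.
pose d := e / (`|v| + 1); have d0 : 0 < d by rewrite divr_gt0.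
have maE : measurable_fun D (fun t => (a t)%:E) by exact/measurable_EFinP.
have a0E t : D t -> (0 <= (a t)%:E)%E by move=> Dt; rewrite lee_fin a0.
have afn : (\int[mu]_(t in D) (a t)%:E)%E \is a fin_num.
  by rewrite ge0_fin_numE//; exact: integral_ge0.
have [h [hle hint]] : exists h : {nnsfun (measurableTypeR R) >-> R},
    (forall t, ((h t)%:E <= ((EFin \o a) \_ D) t)%E) /\
    (\int[mu]_(t in D) (a t)%:E - d%:E < sintegral mu h)%E.
  move: afn; rewrite ge0_integralE// => afn.
  have [_ [h hle <-] hlt] := ub_ereal_sup_adherent d0 afn.
  by exists h.
have h0 t : 0 <= h t by exact: fun_ge0.
have hD t : ~ D t -> h t = 0.
  move=> Dt; apply/eqP; rewrite eq_le h0 andbT -lee_fin.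
  by have := hle t; rewrite patchE memNset.
have ha t : D t -> h t <= a t.
  by move=> Dt; have := hle t; rewrite patchE mem_set// lee_fin.
have mh : measurable_fun D (fun t => (h t)%:E).
  by apply/measurable_EFinP; apply: (@measurable_funTS _ _ (measurableTypeR R)).
have hDT : (\int[mu]_t (h t)%:E = \int[mu]_(t in D) (h t)%:E)%E.
  rewrite [RHS]integral_mkcond; apply: eq_integral => t _; rewrite patchE.
  by case: ifPn => // /negP; rewrite inE => /hD ->.
have hs : (\int[mu]_t (h t)%:E = sintegral mu h)%E by rewrite integralT_nnsfun.
have hfin : (\int[mu]_t (h t)%:E < +oo)%E.
  rewrite hDT; apply: le_lt_trans afin; apply: ge0_le_integral => //.
  by move=> t _; rewrite lee_fin.
have hfn : (\int[mu]_t (h t)%:E)%E \is a fin_num.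
  by rewrite ge0_fin_numE//; apply: integral_ge0 => t _; rewrite lee_fin.
have [s [ss es is_]] := nnsfun_simple v mD hD hfin.
have mah : measurable_fun D (fun t => (a t - h t)%:E).
  by apply/measurable_EFinP; apply: measurable_funB => //; apply/measurable_EFinP.
have ah0 t : D t -> (0 <= (a t - h t)%:E)%E.
  by move=> Dt; rewrite lee_fin subr_ge0 ha.
have split_a : (\int[mu]_(t in D) (a t)%:E =
    \int[mu]_t (h t)%:E + \int[mu]_(t in D) (a t - h t)%:E)%E.
  rewrite hDT -ge0_integralD//; last by move=> t _; rewrite lee_fin.
  by apply: eq_integral => t _; rewrite -EFinD addrC subrK.
have ahd : (\int[mu]_(t in D) (a t - h t)%:E <= d%:E)%E.
  move: hint; rewrite -hs lteBlDr// split_a => /ltW.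
  by rewrite leeD2lE.
exists s, (fun t => `|v|%:E * (a t - h t)%:E)%E; split => //.
- exact: measurable_funeM.
- move=> t Dt; rewrite es -scalerBl normrZ -EFinM lee_fin mulrC.
  by rewrite ger0_norm// subr_ge0 ha.
- rewrite ge0_integralZl_EFin//; apply: le_trans (lee_wpmul2l _ ahd) _ => //.
  rewrite -EFinM lee_fin /d mulrCA ler_piMr ?(ltW e0)//.
  by rewrite ler_pdivrMr// mul1r lerDl.
- rewrite is_ -scalerBl split_a fineD//; last first.
    by rewrite ge0_fin_numE ?(le_lt_trans ahd) ?ltry//; exact: integral_ge0.
  rewrite addrC addKr normrZ ger0_norm; last by apply: fine_ge0; exact: integral_ge0.
  apply: (@le_trans _ _ (d * `|v|)).
    apply: ler_wpM2r => //; rewrite -lee_fin fineK//.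
    by rewrite ge0_fin_numE ?(le_lt_trans ahd) ?ltry//; exact: integral_ge0.
  rewrite /d mulrAC ler_pdivrMr// ler_pM2l// lerDl//.
Qed.

End ScalarDensity.

Section Existence.
Context {R : realType} {X : completeNormedModType R}.
Local Notation mu := (@lebesgue_measure R).
Implicit Types (D : set R).

(** Dominated convergence makes the remainders tend to zero in the mean; then
    the integrals of the simple functions form a Cauchy sequence. *)
Lemma dominated_bochner_integrable D (f : R -> X) (s_ : nat -> seq (set R * X))
    (g : R -> \bar R) : measurable D ->
  (forall k, simple_on D (s_ k)) ->
  {ae mu, forall t, D t -> simple_eval (s_ k) t @[k --> \oo] --> f t} ->
  measurable_fun D g -> (\int[mu]_(t in D) g t < +oo)%E ->
  (forall k t, D t -> (`|simple_eval (s_ k) t|%:E <= g t)%E) ->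
  bochner_integrable D f.
Proof.
move=> mD hs ae_s mg gfin sg.
have [N [mN N0 sN]] := ae_s.
have g0 t : D t -> (0 <= g t)%E by move=> /(sg 0%N); apply: le_trans; rewrite lee_fin.
have cN t : D t -> ~ N t -> simple_eval (s_ k) t @[k --> \oo] --> f t.
  by move=> Dt Nt; apply: contrapT => h; apply: Nt; apply: sN => /= /(_ Dt).
have mDN : measurable (D `\` N) by exact: measurableD.
pose h k t := `|f t - simple_eval (s_ k) t|.
have mh k : measurable_fun (D `\` N) (h k).
  apply: (@measurable_fun_cvg _ _ _ _
      (fun j t => `|simple_eval (s_ j) t - simple_eval (s_ k) t|)).
    move=> j; apply: measurable_funTS; under eq_fun do rewrite (simple_evalD D).
    apply: (@measurable_norm_simple _ _ D); apply: simple_on_cat => //.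
    exact: simple_on_scale.
  move=> t [Dt Nt]; apply: cvg_norm; apply: cvgB; [exact: cN|exact: cvg_cst].
have mhE k : measurable_fun (D `\` N) (fun t => (h k t)%:E) by exact/measurable_EFinP.
have hk0 k t : (D `\` N) t -> (0 <= (h k t)%:E)%E by rewrite lee_fin normr_ge0.
have fg t : D t -> ~ N t -> (`|f t|%:E <= g t)%E.
  move=> Dt Nt; case gt : (g t) => [y| |]; last first.
  - by have := g0 t Dt; rewrite gt.
  - exact: leey.
  rewrite lee_fin; have c : `|simple_eval (s_ k) t| @[k --> \oo] --> `|f t|.
    by apply: cvg_norm; exact: cN.
  rewrite -(cvg_lim (@Rhausdorff R) c); apply: limr_le; first by apply/cvg_ex; exists `|f t|.
  by apply: nearW => k; have := sg k t Dt; rewrite gt lee_fin.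
have h_cvg0 : (\int[mu]_(t in D `\` N) (h k t)%:E)%E @[k --> \oo] --> 0%E.
  have ig2 : mu.-integrable (D `\` N) (fun t => g t + g t)%E.
    apply/integrableP; split; first by apply: emeasurable_funD; exact: measurable_funS mg.
    under eq_integral => t /[!inE] -[Dt _] do rewrite gee0_abs ?adde_ge0 ?g0//.
    apply: (@le_lt_trans _ _ (\int[mu]_(t in D) (g t + g t))%E).
      by apply: ge0_integral_subset; [exact: subDsetl|move=> t Dt; rewrite adde_ge0 ?g0].
    by rewrite ge0_integralD//; exact: lte_add_pinfty.
  have h0 : {ae mu, forall t, (D `\` N) t -> (h k t)%:E @[k --> \oo] --> 0%E}.
    apply: aeW => t [Dt Nt]; apply: cvg_EFin; first exact: nearW.
    rewrite -(@normr0 _ X) -(subrr (f t)).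
    by apply: cvg_norm; apply: cvgB; [exact: cvg_cst|exact: cN].
  have hg2 : {ae mu, forall t k, (D `\` N) t -> (`|(h k t)%:E| <= g t + g t)%E}.
    apply: aeW => t k [Dt Nt]; rewrite gee0_abs; last by rewrite lee_fin normr_ge0.
    apply: le_trans (leeD (fg t Dt Nt) (sg k t Dt)).
    by rewrite -EFinD lee_fin; exact: ler_normB.
  have [_ _] := @dominated_convergence _ _ _ mu _ mDN
    (fun k t => (h k t)%:E) (cst 0%E) _ mhE (measurable_cst _) h0 ig2 hg2.
  by rewrite integral0.
have int_le k : (\int[mu]_(t in D) (h k t)%:E <= \int[mu]_(t in D `\` N) (h k t)%:E)%E.
  rewrite -(integral_blow mD mN N0 (mhE k) (@hk0 k)); apply: ge0_integral_le_gen => //.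
  - by move=> t Dt; rewrite lee_fin normr_ge0 /= /blow; case: ifP => // _; exact: leey.
  - by apply: blow_ge0 => t _; rewrite lee_fin normr_ge0.
have diff_le k j : (`|simple_integral (s_ k) - simple_integral (s_ j)|%:E <=
    \int[mu]_(t in D `\` N) (h k t)%:E + \int[mu]_(t in D `\` N) (h j t)%:E)%E.
  rewrite -(ge0_integralD mu mDN (@hk0 k) (mhE k) (@hk0 j) (mhE j)).
  have hc : simple_on D (s_ k ++ scale_simple (-1) (s_ j)).
    by apply: simple_on_cat => //; exact: simple_on_scale.
  have := simple_integral_norm_le mD hc.
  rewrite simple_integral_cat simple_integral_scale scaleN1r => /le_trans; apply.
  rewrite (@ge0_negligible_integral _ _ _ mu D N)//; last first.
    apply/measurable_EFinP; apply: measurable_funTS; exact: measurable_norm_simple hc.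
  apply: ge0_le_integral => //.
  - apply/measurable_EFinP; apply: measurable_funTS; exact: measurable_norm_simple hc.
  - exact: (emeasurable_funD (mhE k) (mhE j)).
  - move=> t [Dt _]; rewrite -EFinD lee_fin -(simple_evalD D) /h.
    by apply: le_trans (ler_distD (f t) _ _) _; rewrite [`|_ - f t|]distrC.
have cvg_int : cvgn (fun k => simple_integral (s_ k)).
  apply/cauchy_cvgP/cauchy_exP => e e0.
  have e20 : 0 < e / 2 by rewrite divr_gt0.
  have /fine_cvgP[fin /cvgrPdist_lt /(_ _ e20) small] := h_cvg0.
  have : \forall k \near \oo, (\int[mu]_(t in D `\` N) (h k t)%:E < (e / 2)%:E)%E.
    apply: filterS2 fin small => k fink; rewrite sub0r normrN => hk.
    by rewrite -(fineK fink) lte_fin; apply: le_lt_trans hk; exact: ler_norm.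
  move=> [K _ hK]; exists (simple_integral (s_ K)).
  exists K => // k /= Kk; rewrite -ball_normE /= -lte_fin.
  apply: le_lt_trans (diff_le _ _) _; rewrite [in ltRHS](splitr e) EFinD.
  by apply: lteD; apply: hK => //=.
exists (lim (simple_integral (s_ k) @[k --> \oo])), s_; split => //.
apply: (@squeeze_cvge _ _ _ _ (cst 0%E) _
   (fun k => \int[mu]_(t in D `\` N) (h k t)%:E)%E); last exact: h_cvg0.
- by apply: nearW => k; rewrite int_le andbT; apply: integral_ge0 => t _; rewrite lee_fin normr_ge0.
- exact: cvg_cst.
Qed.

End Existence.

(** * Weakly singular kernels *)

Section AffineSubstitution.
Context {R : realType}.
Local Notation mu := (@lebesgue_measure R).
Implicit Types (f : R -> \bar R) (c k : R).

(** Lebesgue measure is determined by its values on intervals, so it is a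
    multiple of its image under any map that scales the lengths of preimages. *)
Lemma integral_pushforward_length f (phi : R -> R) (l : R) : 0 < l ->
  measurable_fun [set: R] phi ->
  measurable_fun [set: R] f -> (forall x, 0 <= f x)%E ->
  (forall a b, a < b -> mu (phi @^-1` `]a, b]) = (l * (b - a))%:E) ->
  (\int[mu]_x f (phi x) = l%:E * \int[mu]_x f x)%E.
Proof.
move=> l0 mphi mf f0 hphi.
pose phi' : measurableTypeR R -> measurableTypeR R := phi.
have li0 : 0 <= l^-1 by rewrite invr_ge0 ltW.
pose m := mscale (NngNum li0) (pushforward mu phi').
have mE A : measurable A -> mu A = m mphi A.
  apply: lebesgue_measure_unique => _ [[a b] _ <-].
  suff : mu `]a, b]%classic = m mphi `]a, b]%classic by [].
  have -> : m mphi `]a, b]%classic = ((l^-1)%:E * mu (phi @^-1` `]a, b]))%E by [].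
  rewrite lebesgue_measure_itv /= lte_fin; case: ltP => ab.
    by rewrite (hphi _ _ ab) -EFinM mulrA mulVf ?mul1r ?gt_eqF.
  have -> : phi @^-1` `]a, b] = set0.
    rewrite -subset0 => x /=; rewrite in_itv/= => /andP[h1 h2].
    by have := lt_le_trans h1 (le_trans h2 ab); rewrite ltxx.
  by rewrite measure0 mule0.
have -> : (\int[mu]_x f x = \int[m mphi]_x f x)%E.
  by apply: eq_measure_integral => A mA _; exact: mE.
rewrite ge0_integral_mscale//.
rewrite (@ge0_integral_pushforward _ _ (measurableTypeR R) (measurableTypeR R) R
   phi' mphi mu setT f measurableT mf (fun x _ => f0 x)).
by rewrite preimage_setT muleA -EFinM /= divff ?mul1e// gt_eqF.
Qed.

Lemma integral_shift f c : measurable_fun [set: R] f -> (forall x, 0 <= f x)%E ->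
  (\int[mu]_x f (x + c)%R = \int[mu]_x f x)%E.
Proof.
move=> mf f0; rewrite (@integral_pushforward_length _ (fun x => x + c) 1)//.
- by rewrite mul1e.
- exact: measurable_funD.
- move=> a b ab; have -> : (fun x => x + c) @^-1` `]a, b] = `]a - c, b - c]%classic.
    by apply/seteqP; split => x /=; rewrite !in_itv/= ltrBlDr lerBrDr.
  by rewrite lebesgue_measure_itv/= lte_fin ltrD2r ab mul1r -EFinB opprD addrACA subrr addr0.
Qed.

Lemma integral_reflect f c : measurable_fun [set: R] f -> (forall x, 0 <= f x)%E ->
  (\int[mu]_x f (c - x)%R = \int[mu]_x f x)%E.
Proof.
move=> mf f0; rewrite (@integral_pushforward_length _ (fun x => c - x) 1)//.
- by rewrite mul1e.
- exact: measurable_funB.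
- move=> a b ab; have -> : (fun x => c - x) @^-1` `]a, b] = `[c - b, c - a[%classic.
    apply/seteqP; split => x /=; rewrite !in_itv/=.
      by move=> /andP[h1 h2]; apply/andP; split; lra.
    by move=> /andP[h1 h2]; apply/andP; split; lra.
  rewrite lebesgue_measure_itv/= lte_fin ltrD2l ltrN2 ab mul1r -EFinB.
  by congr EFin; lra.
Qed.

Lemma integral_scale f k : 0 < k -> measurable_fun [set: R] f ->
  (forall x, 0 <= f x)%E ->
  (\int[mu]_x f (k * x)%R = k^-1%:E * \int[mu]_x f x)%E.
Proof.
move=> k0 mf f0; rewrite (@integral_pushforward_length _ (fun x => k * x) k^-1)//.
- by rewrite invr_gt0.
- exact: measurable_funM.
- move=> a b ab; have -> : (fun x => k * x) @^-1` `]a, b] = `]k^-1 * a, k^-1 * b]%classic.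
    apply/seteqP; split => x /=; rewrite !in_itv/= => /andP[h1 h2].
      by rewrite ltr_pdivrMl// ler_pdivlMl// h1 h2.
    by move: h1 h2; rewrite ltr_pdivrMl// ler_pdivlMl// => -> ->.
  by rewrite lebesgue_measure_itv/= lte_fin ltr_pM2l ?invr_gt0// ab -EFinB mulrBr.
Qed.

End AffineSubstitution.

Section SingularKernel.
Context {R : realType}.
Local Notation mu := (@lebesgue_measure R).
Implicit Types a b c t u : R.

(** Vanishing for [u <= 0] lets convolutions over bounded intervals be written
    as integrals over the line. *)
Definition kern a u : R := if 0 < u then u `^ (- a) else 0.

Lemma kern_ge0 a u : 0 <= kern a u.
Proof. by rewrite /kern; case: ifP => // _; exact: powR_ge0. Qed.

Lemma kernE a u : 0 < u -> kern a u = u `^ (- a).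
Proof. by rewrite /kern => ->. Qed.

Lemma kern_le0 a u : u <= 0 -> kern a u = 0.
Proof. by rewrite /kern ltNge => ->. Qed.

Lemma measurable_kern a : measurable_fun [set: R] (kern a).
Proof.
apply: measurable_fun_ifT => //; first exact: measurable_fun_ltr.
Qed.

Lemma kern_scale a k u : 0 < k -> kern a (k * u) = k `^ (- a) * kern a u.
Proof.
move=> k0; rewrite /kern pmulr_rgt0//; case: ltP => u0; last by rewrite mulr0.
by rewrite powRM// ltW.
Qed.

Lemma kern_le a u v : 0 <= a -> 0 < u -> u <= v -> kern a v <= kern a u.
Proof.
move=> a0 u0 uv; rewrite !kernE//; last exact: lt_le_trans uv.
rewrite !powRN lef_pV2 ?posrE ?powR_gt0//; last exact: lt_le_trans uv.
by apply: ge0_ler_powR => //; rewrite nnegrE ltW// (lt_le_trans u0).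
Qed.

Lemma kernM a b u : kern a u * kern b u = kern (a + b) u.
Proof.
rewrite /kern; case: ltP => u0; last by rewrite mul0r.
by rewrite opprD powRD// (gt_eqF u0) implybT.
Qed.

Lemma kern_half a u : 0 <= a <= 1 -> kern a (u / 2) <= 2 * kern a u.
Proof.
move=> /andP[a0 a1]; rewrite mulrC kern_scale ?invr_gt0//.
apply: ler_wpM2r; first exact: kern_ge0.
have -> : (2^-1 : R) `^ (- a) = 2 `^ a.
  by rewrite -(@powR_inv1 R 2)// -powRrM mulN1r opprK.
by rewrite -[leRHS]powRr1//; apply: ler_powR; rewrite // ler1n.
Qed.

Lemma kern_exp_le a b u v : 0 <= b -> 0 < u -> u <= v ->
  kern a u <= v `^ b * kern (a + b) u.
Proof.
move=> b0 u0 uv; rewrite !kernE// opprD powRD ?(gt_eqF u0) ?implybT//.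
rewrite mulrCA ler_peMr ?powR_ge0// powRN ler_pdivlMr ?powR_gt0// mul1r.
by apply: ge0_ler_powR => //; rewrite nnegrE ltW// (lt_le_trans u0).
Qed.

Let kern01 a u : R := if u <= 1 then kern a u else 0.

Let measurable_kern01 a : measurable_fun [set: R] (kern01 a).
Proof.
apply: measurable_fun_ifT => //; first exact: measurable_fun_ler.
exact: measurable_kern.
Qed.

Let kern01_ge0 a u : 0 <= kern01 a u.
Proof. by rewrite /kern01; case: ifP => // _; exact: kern_ge0. Qed.

Lemma integral_powR_le a (e : R) : a < 1 -> 0 < e < 1 ->
  (\int[mu]_(u in `[e, 1%R]) (u `^ (- a))%:E <= ((1 - a)^-1)%:E)%E.
Proof.
move=> a1 /andP[e0 e1]; have a10 : 0 < 1 - a by rewrite subr_gt0.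
pose F u : R := (1 - a)^-1 * u `^ (1 - a).
have dF u : 0 < u -> is_derive u 1 F (u `^ (- a)).
  move=> u0; have -> : u `^ (- a) = (1 - a)^-1 *: ((1 - a) * u `^ (1 - a - 1)).
    rewrite /GRing.scale /= mulrA mulVf ?mul1r ?gt_eqF//; congr (_ `^ _); lra.
  by apply: is_deriveZ; exact: is_derive1_powR.
have cF u : 0 < u -> {for u, continuous F}.
  by move=> u0; apply: differentiable_continuous; apply/derivable1_diffP; case: (dF u u0).
rewrite (@continuous_FTC2 _ _ F)//.
- rewrite -EFinB lee_fin /F powR1 mulr1 gerBl mulr_ge0 ?powR_ge0// invr_ge0 ltW//.
- apply: derivable_within_continuous => u; rewrite in_itv/= => /andP[eu _].
  by apply: derivable_powR; rewrite in_itv/= andbT (lt_le_trans e0).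
- split.
  + move=> u; rewrite in_itv/= => /andP[eu _].
    by case: (dF u (lt_trans e0 eu)).
  + exact/cvg_at_right_filter/cF.
  + exact/cvg_at_left_filter/cF.
- move=> u; rewrite in_itv/= => /andP[eu _]; rewrite derive1E.
  by have [_ ->] := dF u (lt_trans e0 eu).
Qed.

Let kern01_lty a : a < 1 -> (\int[mu]_u (kern01 a u)%:E < +oo)%E.
Proof.
move=> a1; pose F (n : nat) := `[n.+2%:R^-1 : R, 1]%classic.
have mF n : measurable (F n) by exact: measurable_itv.
have F01 : \bigcup_n F n = `]0, 1]%classic.
  apply/seteqP; split => u /=.
    move=> [n _]; rewrite /F /= !in_itv/= => /andP[h ->]; rewrite andbT.
    by apply: lt_le_trans h; rewrite invr_gt0.
  rewrite in_itv/= => /andP[u0 u1]; have [n hn] := ltr_add_invr u0.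
  exists n => //; rewrite /F /= in_itv/= u1 andbT ltW//.
  apply: le_lt_trans hn; rewrite add0r lef_pV2 ?posrE// ler_nat//.
have ndF : nondecreasing_seq F.
  apply/nondecreasing_seqP => n; rewrite /F subsetEset; apply: subset_itvr.
  by rewrite bnd_simp lef_pV2 ?posrE// ler_nat.
have mfF n : measurable_fun (F n) (fun u => (u `^ (- a))%:E).
  by apply/measurable_EFinP; exact: measurable_funTS.
have f0F n u : F n u -> (0 <= (u `^ (- a))%:E)%E by rewrite lee_fin powR_ge0.
have := @ge0_nondecreasing_set_cvg_integral _ (measurableTypeR R) R F _ mu
  ndF mF mfF f0F.
rewrite F01 => cvgF.
have -> : (\int[mu]_u (kern01 a u)%:E = \int[mu]_(u in `]0%R, 1%R]) (u `^ (- a))%:E)%E.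
  rewrite [RHS]integral_mkcond; apply: eq_integral => u _.
  by rewrite patchE mem_setE in_itv/= /kern01 /kern; case: (u <= 1); case: (0 < u).
apply: (@le_lt_trans _ _ ((1 - a)^-1)%:E); last exact: ltry.
rewrite -(cvg_lim _ cvgF)//; apply: lime_le; first by apply/cvg_ex; eexists; exact: cvgF.
apply: nearW => n; apply: integral_powR_le => //.
by rewrite invr_gt0 ltr0n/= invf_lt1// ltr1n.
Qed.

(** Euler's Beta integral: on either half of the unit interval one of the two
    factors is at most 2 and the other one is integrable. *)
Lemma beta_kernel_lty a b : 0 <= a < 1 -> 0 <= b < 1 ->
  (\int[mu]_u (kern a (1 - u) * kern b u)%:E < +oo)%E.
Proof.
move=> /andP[a0 a1] /andP[b0 b1].
have m1 c : measurable_fun [set: R] (fun u => (kern01 c u)%:E).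
  exact/measurable_EFinP.
have m2 c : measurable_fun [set: R] (fun u => (kern01 c (1 - u))%:E).
  apply/measurable_EFinP; apply: measurableT_comp => //; exact: measurable_funB.
have k0 c u : (0 <= (kern01 c u)%:E)%E by rewrite lee_fin.
apply: (@le_lt_trans _ _ (\int[mu]_u
    (2%:E * ((kern01 b u)%:E + (kern01 a (1 - u))%:E)))%E).
  apply: ge0_le_integral => //.
  - by move=> u _; rewrite lee_fin mulr_ge0 ?kern_ge0.
  - apply/measurable_EFinP; apply: measurable_funM; last exact: measurable_kern.
    apply: measurableT_comp => //; [exact: measurable_kern|exact: measurable_funB].
  - by apply: measurable_funeM; exact: (emeasurable_funD (m1 b) (m2 a)).
  - move=> u _; rewrite -EFinD -EFinM lee_fin.
    have [u0|u0] := leP u 0.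
      by rewrite (kern_le0 b u0) mulr0 mulr_ge0// addr_ge0.
    have [u1|u1] := leP 1 u.
      by rewrite (@kern_le0 a) ?subr_le0// mul0r mulr_ge0// addr_ge0.
    have k2 c v : 0 <= c <= 1 -> 1 / 2 <= v -> kern c v <= 2.
      move=> c01 v2; have := @kern_half c 1 c01.
      rewrite [X in _ <= 2 * X]kernE// powR1 mulr1; apply: le_trans.
      by apply: kern_le => //; case/andP: c01.
    have [uh|uh] := leP u (1 / 2).
      apply: (@le_trans _ _ (2 * kern b u)).
        by apply: ler_wpM2r; [exact: kern_ge0|apply: k2; lra].
      have E : kern01 b u = kern b u by rewrite /kern01 (ltW u1).
      by rewrite ler_pM2l// E lerDl.
    apply: (@le_trans _ _ (2 * kern a (1 - u))).
      rewrite mulrC; apply: ler_wpM2r; [exact: kern_ge0|apply: k2; lra].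
    have E : kern01 a (1 - u) = kern a (1 - u).
      by rewrite /kern01 ifT//; lra.
    by rewrite ler_pM2l// E lerDr.
rewrite ge0_integralZl_EFin//; last 2 first.
- by move=> u _; rewrite adde_ge0.
- exact: (emeasurable_funD (m1 b) (m2 a)).
rewrite (ge0_integralD mu measurableT (fun u _ => k0 b u) (m1 b)
  (fun u _ => k0 a (1 - u)) (m2 a)).
rewrite (@integral_reflect _ (fun u => (kern01 a u)%:E) 1)//.
apply: lte_mul_pinfty => //; apply: lte_add_pinfty; exact: kern01_lty.
Qed.

Definition beta_kernel a b : R :=
  fine (\int[mu]_u (kern a (1 - u) * kern b u)%:E)%E.

Lemma beta_kernel_ge0 a b : 0 <= beta_kernel a b.
Proof.
apply: fine_ge0; apply: integral_ge0 => u _.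
by rewrite lee_fin mulr_ge0 ?kern_ge0.
Qed.

Lemma measurable_kern_conv a b t c :
  measurable_fun [set: R] (fun u => (kern a (t - u) * kern b (u - c))%:E).
Proof.
apply/measurable_EFinP; apply: measurable_funM.
  apply: measurableT_comp => //; [exact: measurable_kern|exact: measurable_funB].
apply: measurableT_comp => //; [exact: measurable_kern|exact: measurable_funB].
Qed.

Lemma measurable_kern_conv0 a b t :
  measurable_fun [set: R] (fun u => (kern a (t - u) * kern b u)%:E).
Proof.
rewrite (_ : (fun u => _) = fun u => (kern a (t - u) * kern b (u - 0))%:E).
  exact: measurable_kern_conv.
by apply/funext => u; rewrite subr0.
Qed.

(** Convolving two causal powers yields a causal power, by scaling. *)
Lemma kern_conv a b t c : 0 <= a < 1 -> 0 <= b < 1 ->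
  (\int[mu]_u (kern a (t - u) * kern b (u - c))%:E =
   (beta_kernel a b * kern (a + b - 1) (t - c))%:E)%E.
Proof.
move=> a01 b01; have [tc|ct] := leP t c.
  rewrite [kern _ (t - c)]kern_le0 ?subr_le0// mulr0.
  rewrite -[RHS](integral0 mu [set: R]); apply: eq_integral => u _ /=.
  have [uc|cu] := leP u c; first by rewrite (@kern_le0 b) ?subr_le0// mulr0.
  by rewrite (@kern_le0 a) ?mul0r// subr_le0 (le_trans tc)// ltW.
have d0 : 0 < t - c by rewrite subr_gt0.
have K0 t' c' u : (0 <= (kern a (t' - u) * kern b (u - c'))%:E)%E.
  by rewrite lee_fin mulr_ge0 ?kern_ge0.
rewrite -(@integral_shift _ _ c (measurable_kern_conv a b t c) (K0 t c)).
have -> : (\int[mu]_u (kern a (t - (u + c)) * kern b (u + c - c))%:E =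
    \int[mu]_u (kern a (t - c - u) * kern b (u - 0))%:E)%E.
  apply: eq_integral => u _; rewrite addrK subr0.
  by rewrite opprD addrA addrAC.
have := integral_scale d0 (measurable_kern_conv a b (t - c) 0) (K0 (t - c) 0).
move=> /(congr1 (fun x => (t - c)%:E * x)%E).
rewrite muleA -EFinM divff ?gt_eqF// mul1e => <-.
transitivity ((t - c)%:E * \int[mu]_u (((t - c) `^ (- (a + b)))%:E *
     (kern a (1 - u) * kern b (u - 0))%:E))%E.
  congr (_ * _)%E; apply: eq_integral => u _; rewrite -EFinM; congr EFin.
  rewrite !subr0 (_ : t - c - _ = (t - c) * (1 - u)); last by ring.
  by rewrite !kern_scale// mulrACA opprD powRD// (gt_eqF d0) implybT.
rewrite ge0_integralZl_EFin//; last 2 first.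
- exact: (measurable_kern_conv a b 1 0).
- exact: powR_ge0.
under eq_integral do rewrite subr0.
rewrite muleA -EFinM -[in LHS](@fineK _ (\int[mu]_u _)%E); last first.
  rewrite ge0_fin_numE ?beta_kernel_lty//; apply: integral_ge0 => u _.
  by rewrite lee_fin mulr_ge0 ?kern_ge0.
rewrite -EFinM -/(beta_kernel a b); congr EFin; rewrite mulrC; congr (_ * _).
rewrite kernE// opprB [1 - _]addrC powRD ?(gt_eqF d0) ?implybT// powRr1 ?ltW//.
by rewrite mulrC.
Qed.

End SingularKernel.

(** * Bounded operators and the closed graph theorem *)

Section BoundedOperators.
Context {R : realType}.

Lemma bounded_linear_bound (X : normedModType R) (S : X -> X) :
  bounded_linear S -> exists2 c, 0 <= c & forall x, `|S x| <= c * `|x|.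
Proof.
move=> [lS cS].
pose SL : {linear X -> X} := HB.pack S (GRing.isLinear.Build R X X *:%R S lS).
have /linear_boundedP/pinfty_ex_gt0[c c0 hc] : bounded_near SL (nbhs 0).
  by apply/linear_bounded_continuous.
by exists c => //; exact: ltW.
Qed.

Lemma bounded_linear_intro (X : normedModType R) (S : X -> X) c :
  linear S -> (forall y, `|S y| <= c * `|y|) -> bounded_linear S.
Proof.
move=> linS Sc; split => // y; apply/cvgrPdist_le => e e0.
have SB y1 y2 : S (y1 - y2) = S y1 - S y2.
  by rewrite addrC -scaleN1r linS scaleN1r addrC.
have c0 : 0 < `|c| + 1 by rewrite ltr_wpDl.
have ec0 : 0 < e / (`|c| + 1) by rewrite divr_gt0.
have yy : z @[z --> y] --> y by [].
move/cvgrPdist_le : yy => /(_ _ ec0); apply: filterS => z; rewrite ler_pdivlMr// => h.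
rewrite -SB; apply: le_trans (Sc _) _; apply: le_trans h.
by rewrite mulrC; apply: ler_wpM2l => //; apply: le_trans (ler_norm _) _; rewrite lerDl.
Qed.

Lemma linear_operator0 (X : normedModType R) (B : operator X) :
  linear_operator B -> B 0 = 0.
Proof.
move=> [d0 h]; have [_] := h 1 0 0 d0 d0.
by rewrite !scale1r addr0 => /eqP; rewrite -[X in X == _]addr0 => /eqP/addrI.
Qed.

Lemma opnorm_bound (X : normedModType R) (S : X -> X) (c : R) :
  (forall a x, S (a *: x) = a *: S x) -> (opnorm S <= c%:E)%E ->
  forall x, `|S x| <= c * `|x|.
Proof.
move=> SZ Sc x; have [->|x0] := eqVneq x 0.
  by have := SZ 0 0; rewrite !scale0r => ->; rewrite !normr0 mulr0.
have nx0 : 0 < `|x| by rewrite normr_gt0.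
have {1}-> : x = `|x| *: (`|x|^-1 *: x).
  by rewrite scalerA divff ?scale1r// gt_eqF.
rewrite SZ normrZ normr_id mulrC; apply: ler_wpM2r => //.
rewrite -lee_fin; apply: le_trans Sc; apply: ereal_sup_ubound.
exists (`|x|^-1 *: x) => //=.
by rewrite normrZ normfV normr_id mulVf// gt_eqF.
Qed.

Lemma opnorm_le (X : normedModType R) (S : X -> X) (c : R) : 0 <= c ->
  (forall x, `|S x| <= c * `|x|) -> (opnorm S <= c%:E)%E.
Proof.
move=> c0 Sc; apply: ge_ereal_sup => _ [x /= x1 <-]; rewrite lee_fin.
by apply: le_trans (Sc x) _; rewrite ler_piMr.
Qed.

Section ClosedGraph.
Variables (X : completeNormedModType R) (L : X -> X).
Hypothesis linL : linear L.
Hypothesis closedL : forall (u : nat -> X) x y,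
  u k @[k --> \oo] --> x -> L (u k) @[k --> \oo] --> y -> y = L x.

Let LL : {linear X -> X} := HB.pack L (GRing.isLinear.Build R X X *:%R L linL).
Let LB x y : L (x - y) = L x - L y. Proof. exact: (linearB LL). Qed.
Let LZ a x : L (a *: x) = a *: L x. Proof. exact: (linearZZ LL). Qed.
Let L0 : L 0 = 0. Proof. exact: (linear0 LL). Qed.

(** Baire's theorem: the vectors with images in a fixed ball are dense in some
    ball, and by linearity in all balls. *)
Let almost_open : exists2 K, 0 <= K & forall x (e : R), 0 < e ->
  exists2 u, `|x - u| <= e & `|L u| <= K * `|x|.
Proof.
pose F n := closure [set x | `|L x| <= n%:R].
have [n nd] : exists n, ~ dense (~` F n).
  apply: contrapT => /forallNP h.
  have : dense (\bigcap_n (~` F n)).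
    apply: Baire => n; split; last exact: contrapT (h n).
    by rewrite openC; exact: closed_closure.
  move=> /(_ setT) []; [by exists 0|exact: openT|].
  move=> x [_ /(_ (Num.truncn `|L x|).+1 I)]; apply; apply: subset_closure => /=.
  by apply: ltW; have /andP[] := truncn_itv (normr_ge0 (L x)).
have [U [U0 UF]] := denseNE nd.
have [x0 x0U] := U0.
have [d d0 dU] : exists2 d : R, 0 < d & ball x0 d `<=` U.
  by have /nbhs_ballP[d d0 h] := open_nbhs_nbhs x0U; exists d.
have appr y (e : R) : `|x0 - y| < d -> 0 < e ->
    exists2 u, `|y - u| < e & `|L u| <= n%:R.
  move=> yd e0; have Fy : F n y.
    apply: contrapT => nF; suff : (U `&` ~` F n) y by rewrite UF.
    by split => //; apply: dU; rewrite -ball_normE.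
  have [u [Lu yu]] := Fy _ (nbhsx_ballx y _ e0).
  by exists u => //; move: yu; rewrite -ball_normE.
exists (4 * n%:R / d); first by rewrite divr_ge0 ?mulr_ge0// ltW.
move=> x e e0; have [->|xn0] := eqVneq x 0.
  by exists 0; rewrite ?subrr ?normr0 ?L0 ?normr0 ?mulr0// ltW.
have nx0 : 0 < `|x| by rewrite normr_gt0.
pose k := d / (2 * `|x|).
have k0 : 0 < k by rewrite divr_gt0// mulr_gt0.
have ke0 : 0 < k * e / 2 by rewrite divr_gt0// mulr_gt0.
have h1 : `|x0 - x0| < d by rewrite subrr normr0.
have h2 : `|x0 - (x0 + k *: x)| < d.
  rewrite opprD addrA subrr sub0r normrN normrZ gtr0_norm// /k.
  have -> : d / (2 * `|x|) * `|x| = d / 2 by field; rewrite gt_eqF.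
  lra.
have [u1 xu1 Lu1] := appr _ _ h1 ke0.
have [u2 xu2 Lu2] := appr _ _ h2 ke0.
exists (k^-1 *: (u2 - u1)).
  have -> : x - k^-1 *: (u2 - u1) = k^-1 *: ((x0 + k *: x - u2) - (x0 - u1)).
    have -> : x0 + k *: x - u2 - (x0 - u1) = k *: x - (u2 - u1).
      by rewrite !opprB [LHS](AC ((2*1)*2) ((1*5)*(2*(4*3)))) /= subrr add0r.
    by rewrite [RHS]scalerBr scalerA mulVf ?scale1r// gt_eqF.
  rewrite normrZ gtr0_norm ?invr_gt0// ler_pdivrMl//.
  apply: le_trans (ler_normB _ _) _.
  by rewrite (splitr (k * e)); apply: lerD; exact: ltW.
rewrite LZ LB normrZ gtr0_norm ?invr_gt0// ler_pdivrMl//.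
have -> : k * (4 * n%:R / d * `|x|) = n%:R + n%:R.
  by rewrite /k; field; rewrite !gt_eqF.
by apply: le_trans (ler_normB _ _) _; exact: lerD.
Qed.

(** Correcting the remainder repeatedly yields preimages of geometrically
    decreasing size; the closed graph identifies the limit. *)
Lemma closed_graph_bound : exists2 c, 0 <= c & forall x, `|L x| <= c * `|x|.
Proof.
have [K K0 hK] := almost_open.
have [phi hphi] : exists phi : X -> X,
    forall x, `|x - phi x| <= `|x| / 2 /\ `|L (phi x)| <= K * `|x|.
  suff /choice[phi hphi] : forall x, exists u,
    `|x - u| <= `|x| / 2 /\ `|L u| <= K * `|x| by exists phi.
  move=> x; have [->|xn0] := eqVneq x 0.
    by exists 0; rewrite subrr L0 !normr0 mul0r mulr0.
  have [|u xu Lu] := hK x (`|x| / 2); first by rewrite divr_gt0 ?normr_gt0.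
  by exists u.
exists (2 * K); first exact: mulr_ge0.
move=> x; pose r k := iter k (fun y => y - phi y) x.
pose q k : R := (2^-1) ^+ k * `|x|.
have rk k : `|r k| <= q k.
  elim: k => [|k IH]; first by rewrite /q expr0 mul1r.
  rewrite /r /= -/(r k); apply: le_trans (hphi (r k)).1 _.
  by rewrite /q exprS -mulrA mulrC; apply: ler_wpM2l.
have Lr k m : `|L (r k) - L (r (k + m)%N)| <= 2 * K * (q k - q (k + m)%N).
  elim: m => [|m IH]; first by rewrite addn0 !subrr normr0 mulr0.
  apply: le_trans (ler_distD (L (r (k + m)%N)) _ _) _.
  have -> : 2 * K * (q k - q (k + m.+1)%N) =
     2 * K * (q k - q (k + m)%N) + K * q (k + m)%N.
    by rewrite addnS /q exprS; field.
  apply: lerD => //; rewrite addnS {2}/r /= -/(r _) LB opprB addrC subrK.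
  by apply: le_trans (hphi _).2 _; exact: ler_wpM2l.
have q0 : q k @[k --> \oo] --> 0.
  rewrite -(mul0r `|x|); apply: cvgMl; apply: cvg_expr.
  by rewrite ger0_norm ?invf_lt1// ltr1n.
have qge0 k : 0 <= q k by rewrite mulr_ge0// exprn_ge0.
have r0 : r k @[k --> \oo] --> 0.
  apply/cvgr0Pnorm_le => e e0; near=> k.
  apply: le_trans (rk k) _; near: k.
  move/cvgr0Pnorm_le : q0 => /(_ e e0); apply: filterS => k.
  by rewrite ger0_norm.
have cL : cvgn (fun k => L (r k)).
  apply/cauchy_cvgP/cauchy_exP => e e0.
  have e20 : 0 < e / (2 * K + 1) by rewrite divr_gt0// ltr_wpDl// mulr_ge0.
  have [N _ hN] : \forall k \near \oo, q k < e / (2 * K + 1).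
    move/cvgr0Pnorm_lt : q0 => /(_ _ e20); apply: filterS => k.
    by rewrite ger0_norm.
  exists (L (r N)); exists N => // k /= Nk; rewrite -ball_normE /=.
  rewrite -(subnKC Nk); apply: le_lt_trans (Lr _ _) _.
  apply: (@le_lt_trans _ _ (2 * K * q N)).
    by apply: ler_wpM2l; [exact: mulr_ge0|rewrite gerBl].
  have K1 : 0 < 2 * K + 1 by rewrite ltr_wpDl// mulr_ge0.
  have := hN N (leqnn N); rewrite ltr_pdivlMr// mulrDr mulr1 [q N * _]mulrC.
  by apply: le_lt_trans; rewrite lerDl.
have {cL} L_r0 : L (r k) @[k --> \oo] --> 0.
  by have /cvg_ex[z hz] := cL; have := closedL r0 hz; rewrite L0 => <-.
have hn : `|L x - L (r k)| @[k --> \oo] --> `|L x|.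
  by rewrite -[X in `|X|](subr0 (L x)); apply: cvg_norm; exact: cvgB (cvg_cst _) L_r0.
rewrite -(cvg_lim (@Rhausdorff R) hn); apply: limr_le; first by apply/cvg_ex; eexists; exact: hn.
apply: nearW => k; have := Lr 0%N k; rewrite add0n => /le_trans; apply.
apply: ler_wpM2l; first exact: mulr_ge0.
by rewrite /q expr0 mul1r gerBl qge0.
Unshelve. all: end_near. Qed.

End ClosedGraph.
End BoundedOperators.

(** * Bochner integrability of left-continuous functions *)

Section GridIntegrability.
Context {R : realType} {X : completeNormedModType R}.
Local Notation mu := (@lebesgue_measure R).
Implicit Types (D : set R) (a d t : R).

Let grid_cell (a d : R) i : set R := `[a + i%:R * d, a + i.+1%:R * d[%classic.

Let grid_simple D (f : R -> X) (a d : R) m : seq (set R * X) :=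
  [seq (D `&` grid_cell a d i, f (a + i%:R * d)) | i <- iota 1 m].

Let grid_eval D f a d m t : 0 < d -> D t ->
  let i := Num.truncn ((t - a) / d) in
  simple_eval (grid_simple D f a d m) t =
  if (a <= t) && (0 < i <= m)%N then f (a + i%:R * d) else 0.
Proof.
move=> d0 Dt i; rewrite /simple_eval big_map.
have cellP j : t \in D `&` grid_cell a d j = (a <= t) && (j == i).
  apply/idP/andP => [|[at_ /eqP ->]].
    rewrite inE /grid_cell /= in_itv/= => -[_ /andP[h1 h2]].
    have at_ : a <= t by apply: le_trans h1; rewrite lerDl mulr_ge0// ltW.
    split => //; apply/eqP/esym/truncn_def.
    by rewrite ler_pdivlMr// ltr_pdivrMr// lerBrDl ltrBlDl h1 h2.
  rewrite inE; split => //; rewrite /grid_cell /= in_itv/=.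
  have t0 : 0 <= (t - a) / d by rewrite divr_ge0 ?subr_ge0// ltW.
  have /andP[] := truncn_itv t0.
  by rewrite ler_pdivlMr// ltr_pdivrMr// lerBrDl ltrBlDl => -> ->.
under eq_bigr do rewrite indicE cellP.
case: (leP a t) => /= at_; last by apply: big1 => j _; rewrite scale0r.
have [im|im] := boolP (i \in iota 1 m).
  rewrite (bigD1_seq i)//= ?iota_uniq// eqxx scale1r big1 ?addr0.
    by move: im; rewrite mem_iota add1n ltnS => ->.
  by move=> j ji; rewrite (negbTE ji) scale0r.
rewrite big_seq big1; last first.
  move=> j jm; have [ji|] := eqVneq j i; last by rewrite scale0r.
  by rewrite ji (negbTE im) in jm.
by move: im; rewrite mem_iota add1n ltnS => /negbTE ->.
Qed.

(** Left-continuous functions are limits of their step functions on uniform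
    grids based at [a]; a grid point to the left of [t], other than [a], lies in
    the right half of the interval from [a] to [t], which gives a majorant. *)
Lemma grid_bochner_integrable D (f : R -> X) (phi : R -> R) a : measurable D ->
  {ae mu, forall t, D t -> a < t /\ forall e, 0 < e -> exists2 d, 0 < d &
     forall u, a < u -> t - d < u -> u <= t -> `|f t - f u| <= e} ->
  (forall t u, D t -> a < u -> a + (t - a) / 2 <= u -> u <= t ->
     `|f u| <= phi t) ->
  measurable_fun D phi -> (forall t, D t -> 0 <= phi t) ->
  (\int[mu]_(t in D) (phi t)%:E < +oo)%E ->
  bochner_integrable D f.
Proof.
move=> mD cf fphi mphi phi0 phifin.
pose d k : R := k.+1%:R^-1.
have d0 k : 0 < d k by rewrite invr_gt0.
pose s_ k := grid_simple D f a (d k) (k.+1 * k.+1)%N.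
apply: (@dominated_bochner_integrable _ _ _ _ s_ (fun t => (phi t)%:E)) => //.
- move=> k _ /mapP[i _ ->] /=; have mc : measurable (grid_cell a (d k) i) by exact: measurable_itv.
  split; [exact: measurableI| exact: subIsetl |].
  apply: (@le_lt_trans _ _ (mu (grid_cell a (d k) i))).
    by apply: le_measure; rewrite ?inE//; exact: measurableI.
  by rewrite /grid_cell lebesgue_measure_itv/= lte_fin; case: ifP => _; rewrite ltry.
- apply: filterS cf => t h Dt; have [at_ {}h] := h Dt.
  apply/cvgrPdist_le => e e0; have [dl dl0 hdl] := h e e0.
  near=> k; rewrite /s_ grid_eval//.
  have t0 : 0 <= (t - a) / d k by rewrite divr_ge0 ?subr_ge0 ?ltW.
  have := truncn_itv t0; set i := Num.truncn _ => /andP[h1 h2].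
  have ka : (t - a)^-1 < k.+1%:R.
    near: k; exists (Num.truncn (t - a)^-1) => // k /= hk.
    have p0 : 0 <= (t - a)^-1 by rewrite invr_ge0 subr_ge0 ltW.
    have /andP[_ h3] := truncn_itv p0.
    by apply: lt_le_trans h3 _; rewrite ler_nat.
  have kt : t - a < k.+1%:R.
    near: k; exists (Num.truncn (t - a)) => // k /= hk.
    have p0 : 0 <= t - a by rewrite subr_ge0 ltW.
    have /andP[_ h3] := truncn_itv p0.
    by apply: lt_le_trans h3 _; rewrite ler_nat.
  have kd : d k < dl.
    near: k; exists (Num.truncn dl^-1) => // k /= hk.
    have p0 : 0 <= dl^-1 by rewrite invr_ge0 ltW.
    have /andP[_ h3] := truncn_itv p0.
    rewrite /d -(invrK dl) ltf_pV2 ?posrE ?invr_gt0//.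
    by apply: lt_le_trans h3 _; rewrite ler_nat.
  rewrite /d invrK in h1 h2.
  have i0 : (0 < i)%N.
    rewrite lt0n; apply/eqP => i0; move: h2; rewrite i0 ltNge => /negP; apply.
    rewrite mulrC -ler_pdivrMr ?subr_gt0// mul1r ltW//.
  have im : (i <= k.+1 * k.+1)%N.
    rewrite -(ler_nat R) natrM; apply: le_trans h1 _.
    by apply: ler_wpM2r => //; exact: ltW.
  rewrite (ltW at_) i0 im /=; apply: hdl.
  + by rewrite ltrDl mulr_gt0// ltr0n.
  + have : t - a < i.+1%:R * d k by rewrite /d ltr_pdivlMr.
    by rewrite -natr1 mulrDl mul1r => h3; lra.
  + by rewrite -lerBrDl /d ler_pdivrMr.
- exact/measurable_EFinP.
- move=> k t Dt; rewrite /s_ grid_eval// lee_fin.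
  case: ifP => [/andP[at_ /andP[i0 _]]|_]; last by rewrite normr0 phi0.
  have t0 : 0 <= (t - a) / d k by rewrite divr_ge0 ?subr_ge0// ltW.
  have := truncn_itv t0; move: i0; set i := Num.truncn _ => i0 /andP[].
  rewrite ler_pdivlMr// ltr_pdivrMr// => h1 h2; apply: fphi => //.
  + by rewrite ltrDl mulr_gt0// ltr0n.
  + rewrite lerD2l ler_pdivrMr//; apply: le_trans (ltW h2) _.
    rewrite -mulrA [d k * 2]mulrC mulrA; apply: ler_wpM2r; first exact: ltW.
    by rewrite -natrM ler_nat muln2 -addnn -addn1 leq_add2l.
  + by rewrite -lerBrDl.
Unshelve. all: end_near. Qed.

End GridIntegrability.

(** * Stable semigroups *)

Section Semigroup.
Context {R : realType} {X : completeNormedModType R}.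
Local Notation mu := (@lebesgue_measure R).
Variables (A : operator X) (T : R -> X -> X) (M omega : R).
Hypotheses (C0T : C0_semigroup T) (genT : is_generator A T).
Hypotheses (M1 : 1 <= M) (omega0 : 0 < omega).
Hypothesis stableT : forall t, 0 < t ->
  (opnorm (T t) <= (M * expR (- omega * t))%:E)%E /\ comp_norm_le A (T t) (M / t).

Let M0 : 0 < M. Proof. exact: lt_le_trans M1. Qed.

Lemma semigroup_linear t : 0 <= t -> linear (T t).
Proof. by case: C0T => h _ _ _ /h[]. Qed.

Lemma semigroupZ t a x : 0 <= t -> T t (a *: x) = a *: T t x.
Proof.
move=> t0.
pose Tt : {linear X -> X} :=
  HB.pack (T t) (GRing.isLinear.Build R X X *:%R (T t) (semigroup_linear t0)).
exact: (linearZZ Tt).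
Qed.

Lemma semigroupB t x y : 0 <= t -> T t (x - y) = T t x - T t y.
Proof.
move=> t0.
pose Tt : {linear X -> X} :=
  HB.pack (T t) (GRing.isLinear.Build R X X *:%R (T t) (semigroup_linear t0)).
exact: (linearB Tt).
Qed.

Lemma semigroupD s t x : 0 <= s -> 0 <= t -> T (s + t) x = T s (T t x).
Proof. by case: C0T => _ _ h _ s0 t0; rewrite h. Qed.

Lemma semigroup0 x : T 0 x = x.
Proof. by case: C0T => _ -> _ _. Qed.

Lemma semigroup_exp_bound t x : 0 < t -> `|T t x| <= M * expR (- omega * t) * `|x|.
Proof.
move=> t0; have [Tn _] := stableT t0; apply: opnorm_bound => // a y.
by apply: semigroupZ; exact: ltW.
Qed.

Lemma semigroup_bound t x : 0 <= t -> `|T t x| <= M * `|x|.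
Proof.
rewrite le_eqVlt => /predU1P[<-|t0]; first by rewrite semigroup0 ler_peMl.
apply: le_trans (semigroup_exp_bound x t0) _; apply: ler_wpM2r => //.
rewrite ler_piMr ?ltW// -expR0 ltr_expR mulNr oppr_lt0 mulr_gt0//.
Qed.

Lemma semigroup_right_continuous0 x (e : R) : 0 < e ->
  exists2 d, 0 < d & forall h, 0 <= h -> h < d -> `|T h x - x| <= e.
Proof.
move=> e0; have [_ _ _ /(_ x)] := C0T.
move=> /cvgrPdist_le/(_ e e0)[d /= d0 hd]; exists d => // h.
rewrite le_eqVlt => /predU1P[<- _|h0 hd'].
  by rewrite semigroup0 subrr normr0 ltW.
by rewrite distrC; apply: hd => //=; rewrite sub0r normrN gtr0_norm.
Qed.

Lemma semigroup_continuous x t (e : R) : 0 <= t -> 0 < e -> exists2 d, 0 < d &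
  forall s, 0 <= s -> `|t - s| < d -> `|T t x - T s x| <= e.
Proof.
move=> t0 e0; have eM0 : 0 < e / M by rewrite divr_gt0.
have [d d0 hd] := semigroup_right_continuous0 x eM0.
have key p h : 0 <= p -> 0 <= h -> h < d -> `|T (p + h) x - T p x| <= e.
  move=> p0 h0 hd'; rewrite semigroupD// -semigroupB//.
  apply: le_trans (semigroup_bound _ p0) _.
  by rewrite -ler_pdivlMl// mulrC; exact: hd.
exists d => // s s0; have [ts|st] := leP t s.
  rewrite (distrC t s) ger0_norm ?subr_ge0// => tsd; rewrite distrC.
  have := @key t (s - t) t0; rewrite [t + _]addrC subrK; apply => //.
  by rewrite subr_ge0.
rewrite gtr0_norm ?subr_gt0// => tsd.
have := @key s (t - s) s0; rewrite [s + _]addrC subrK; apply => //.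
by rewrite subr_ge0 ltW.
Qed.

(** The bound on the norm of [A T t] applies once [A T t] is known to be
    homogeneous, which follows from its description by difference quotients. *)
Lemma generator_semigroup_bound t x : 0 < t ->
  opdom A (T t x) /\ `|A (T t x)| <= M / t * `|x|.
Proof.
move=> t0; have [_ [Ad An]] := stableT t0; split; first exact: Ad.
apply: (opnorm_bound (S := fun x => A (T t x))) => // a y.
have lim y' : h^-1 *: (T h (T t y') - T t y') @[h --> 0^'+] --> A (T t y').
  by apply: (genT _ _).1.
suff /(genT _ _).2[] : h^-1 *: (T h (T t (a *: y)) - T t (a *: y)) @[h --> 0^'+]
    --> a *: A (T t y) by [].
have aux : a *: (h^-1 *: (T h (T t y) - T t y)) @[h --> 0^'+] --> a *: A (T t y).
  by apply: cvgZl_tmp; exact: lim.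
apply: cvg_trans aux; apply: near_eq_cvg; near=> h.
have h0 : 0 <= h by near: h; exact: nbhs_right_ge.
rewrite !semigroupZ ?ltW// -scalerBr !scalerA mulrC//.
Unshelve. all: end_near. Qed.

(** Telescoping [T t x - T s x] over [n] equal steps bounds it by [n] times one
    step, and one step is [(t - s) / n] times a difference quotient. *)
Lemma semigroup_diff_bound s t x : 0 < s -> s <= t ->
  `|T t x - T s x| <= M * M * ((t - s) / s) * `|x|.
Proof.
move=> s0; rewrite le_eqVlt => /predU1P[<-|st].
  by rewrite !subrr normr0 mul0r mulr0 mul0r.
have ts0 : 0 < t - s by rewrite subr_gt0.
have [domy Ay] := generator_semigroup_bound x s0.
set y := T s x in domy Ay *; pose z := A y.
have lim : h^-1 *: (T h y - y) @[h --> 0^'+] --> z by exact: (genT _ _).1.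
have -> : M * M * ((t - s) / s) * `|x| = M * (t - s) * (M / s * `|x|) by ring.
suff H e : 0 < e -> `|T t x - y| <= M * (t - s) * (`|z| + e).
  have Mt0 : 0 < M * (t - s) by exact: mulr_gt0.
  apply: (@le_trans _ _ (M * (t - s) * `|z|)); last by rewrite ler_pM2l.
  apply/ler_addgt0Pr => e e0.
  have := H (e / (M * (t - s))) (divr_gt0 e0 Mt0).
  by rewrite mulrDr [X in _ <= _ + X]mulrC mulfVK// gt_eqF.
move=> e0; move/cvgrPdist_le : lim => /(_ e e0)[d /= d0 hd].
pose n := (Num.truncn ((t - s) / d)).+1.
have n0 : 0 < n%:R :> R by rewrite ltr0n.
pose h := (t - s) / n%:R.
have h0 : 0 < h by exact: divr_gt0.
have hltd : h < d.
  have p0 : 0 <= (t - s) / d by rewrite divr_ge0// ltW.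
  have /andP[_ h3] := truncn_itv p0.
  by rewrite /h ltr_pdivrMr// mulrC -ltr_pdivrMr.
have step : `|T h y - y| <= h * (`|z| + e).
  have hz : `|z - h^-1 *: (T h y - y)| <= e.
    by apply: hd => //=; rewrite sub0r normrN gtr0_norm.
  have -> : T h y - y = h *: (h^-1 *: (T h y - y)).
    by rewrite scalerA divff ?scale1r// gt_eqF.
  rewrite normrZ gtr0_norm// ler_pM2l//.
  rewrite -[X in `|X|](subKr z); apply: le_trans (ler_normB _ _) _.
  by rewrite lerD2l.
have tele k : `|T (k%:R * h) y - y| <= k%:R * (M * `|T h y - y|).
  elim: k => [|k IH]; first by rewrite !mul0r semigroup0 subrr normr0.
  have kh0 : 0 <= k%:R * h by rewrite mulr_ge0// ltW.
  have -> : T (k.+1%:R * h) y - y = T (k%:R * h) (T h y - y) + (T (k%:R * h) y - y).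
    rewrite -natr1 mulrDl mul1r (semigroupD y kh0 (ltW h0)) (semigroupB _ _ kh0).
    by rewrite addrA subrK.
  apply: le_trans (ler_normD _ _) _.
  rewrite -natr1 mulrDl mul1r addrC; apply: lerD => //.
  exact: semigroup_bound.
have -> : T t x = T (n%:R * h) y.
  rewrite /h mulrC mulfVK ?gt_eqF// /y -semigroupD ?subrK//; exact: ltW.
apply: le_trans (tele n) _.
have -> : M * (t - s) * (`|z| + e) = n%:R * (M * (h * (`|z| + e))).
  by rewrite /h; field; rewrite gt_eqF.
by rewrite !ler_pM2l.
Qed.

End Semigroup.

(** * Negative fractional powers *)

Section GammaKernel.
Context {R : realType}.
Local Notation mu := (@lebesgue_measure R).

Lemma measurable_expR_scale (l : R) : measurable_fun [set: R] (fun t => expR (l * t)).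
Proof.
by apply: measurableT_comp => //; exact: measurable_funM.
Qed.

(** Before time 2 the power is integrable and the exponential at most 1;
    afterwards the power is at most 1 and the exponential is integrable. *)
Lemma gamma_kernel_lty (b l : R) : 0 <= b < 1 -> 0 < l ->
  (\int[mu]_t (kern b t * expR (- l * t))%:E < +oo)%E.
Proof.
move=> b01 l0.
have mk : measurable_fun [set: R] (fun t => (kern 0 (2 - t) * kern b t)%:E).
  exact: measurable_kern_conv0.
have mp : measurable_fun [set: R] (fun t => (l^-1 * exponential_pdf l t)%:E).
  by apply/measurable_EFinP; apply: measurable_funM => //; exact: measurable_exponential_pdf.
apply: (@le_lt_trans _ _ (\int[mu]_t
    ((kern 0 (2 - t) * kern b t)%:E + (l^-1 * exponential_pdf l t)%:E))%E).
  apply: ge0_le_integral => //.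
  - by move=> t _; rewrite lee_fin mulr_ge0 ?kern_ge0 ?expR_ge0.
  - apply/measurable_EFinP; apply: measurable_funM; first exact: measurable_kern.
    exact: measurable_expR_scale.
  - exact: (emeasurable_funD mk mp).
  - move=> t _; rewrite -EFinD lee_fin; have [t0|t0] := leP t 0.
      rewrite (@kern_le0 _ b)// mul0r mulr0 add0r mulr_ge0 ?invr_ge0 ?(ltW l0)//.
      by apply: exponential_pdf_ge0; exact: ltW.
    have -> : exponential_pdf l t = l * expR (- l * t).
      by rewrite (exponential_pdfE _ (ltW t0)).
    rewrite mulrA mulVf ?gt_eqF// mul1r.
    have e1 : expR (- l * t) <= 1 by rewrite -expR0 ler_expR mulNr oppr_le0 mulr_ge0// ltW.
    have [t2|t2] := ltP t 2.
      rewrite [kern 0 _]kernE ?subr_gt0// oppr0 powRr0 mul1r.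
      apply: (@le_trans _ _ (kern b t)); first by rewrite ler_piMr ?kern_ge0.
      by rewrite lerDl expR_ge0.
    rewrite [kern 0 _]kern_le0 ?subr_le0// mul0r add0r.
    apply: ler_piMl; first exact: expR_ge0.
    have : kern b t <= kern b 1.
      by apply: kern_le => //; [case/andP: b01|apply: le_trans t2; rewrite ler1n].
    by rewrite (@kernE _ b 1)// powR1.
rewrite ge0_integralD//; last 2 first.
- by move=> t _; rewrite lee_fin mulr_ge0 ?kern_ge0.
- move=> t _; rewrite lee_fin mulr_ge0 ?invr_ge0 ?(ltW l0)//.
  by apply: exponential_pdf_ge0; exact: ltW.
apply: lte_add_pinfty.
  have -> : (\int[mu]_t (kern 0 (2 - t) * kern b t)%:E =
      \int[mu]_t (kern 0 (2 - t) * kern b (t - 0))%:E)%E.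
    by apply: eq_integral => t _; rewrite subr0.
  by rewrite kern_conv ?ltry// lexx ltr01.
under eq_integral do rewrite EFinM.
rewrite ge0_integralZl_EFin//; last 3 first.
- by move=> t _; rewrite lee_fin; apply: exponential_pdf_ge0; exact: ltW.
- by apply/measurable_EFinP; exact: measurable_exponential_pdf.
- by rewrite invr_ge0 ltW.
by rewrite integral_exponential_pdf// mule1 ltry.
Qed.

End GammaKernel.

Section NegativePower.
Context {R : realType} {X : completeNormedModType R}.
Local Notation mu := (@lebesgue_measure R).
Variables (A : operator X) (T : R -> X -> X) (M omega : R).
Hypotheses (C0T : C0_semigroup T) (M1 : 1 <= M) (omega0 : 0 < omega).
Hypothesis stableT : forall t, 0 < t ->
  (opnorm (T t) <= (M * expR (- omega * t))%:E)%E /\ comp_norm_le A (T t) (M / t).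

Let M0 : 0 < M. Proof. exact: lt_le_trans M1. Qed.
Let D : set R := `]0, +oo[%classic.
Let mD : measurable D. Proof. exact: measurable_itv. Qed.
Let DE t : D t = (0 < t) :> Prop. Proof. by rewrite /D /= in_itv/= andbT. Qed.

Definition power_integrand (g : R) y t : X := t `^ (g - 1) *: T t y.

Let majorant g t : R := 2 * M * (kern (1 - g) t * expR (- (omega / 2) * t)).

Let majorant_ge0 g t : 0 <= majorant g t.
Proof. by rewrite /majorant !mulr_ge0 ?kern_ge0 ?expR_ge0// ltW. Qed.

Let measurable_majorant g : measurable_fun [set: R] (majorant g).
Proof.
apply: measurable_funM => //; apply: measurable_funM; first exact: measurable_kern.
exact: measurable_expR_scale.
Qed.

Let majorant_lty g : 0 < g <= 1 -> (\int[mu]_(t in D) (majorant g t)%:E < +oo)%E.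
Proof.
move=> /andP[g0 g1]; apply: (@le_lt_trans _ _ (\int[mu]_t (majorant g t)%:E)%E).
  by apply: ge0_integral_subset => // t _; rewrite lee_fin majorant_ge0.
under eq_integral do rewrite EFinM.
rewrite ge0_integralZl_EFin//; last 3 first.
- by move=> t _; rewrite lee_fin mulr_ge0 ?kern_ge0 ?expR_ge0.
- apply/measurable_EFinP; apply: measurable_funM; first exact: measurable_kern.
  exact: measurable_expR_scale.
- by rewrite mulr_ge0// ltW.
apply: lte_mul_pinfty => //; first by rewrite lee_fin mulr_ge0// ltW.
apply: gamma_kernel_lty; last by rewrite divr_gt0.
by rewrite subr_ge0 g1 /= gtrBl.
Qed.

Let integrand_bound g y t u : 0 < g <= 1 -> 0 < u -> t / 2 <= u -> u <= t ->
  `|power_integrand g y u| <= majorant g t * `|y|.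
Proof.
move=> /andP[g0 g1] u0 tu ut; have t0 : 0 < t by exact: lt_le_trans ut.
rewrite /power_integrand normrZ ger0_norm ?powR_ge0//.
have -> : u `^ (g - 1) = kern (1 - g) u by rewrite kernE// opprB.
have k1 : kern (1 - g) u <= 2 * kern (1 - g) t.
  apply: (@le_trans _ _ (kern (1 - g) (t / 2))).
    by apply: kern_le => //; [rewrite subr_ge0|rewrite divr_gt0].
  by apply: kern_half; apply/andP; split; lra.
have e1 : expR (- omega * u) <= expR (- (omega / 2) * t).
  rewrite ler_expR !mulNr lerN2 mulrAC -mulrA; apply: ler_wpM2l => //; exact: ltW.
have h := semigroup_exp_bound C0T stableT y u0.
apply: le_trans (ler_pM _ _ k1 h) _ => //; first exact: kern_ge0.
rewrite /majorant [leRHS](_ : _ = 2 * kern (1 - g) t *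
  (M * expR (- (omega / 2) * t) * `|y|)); last by ring.
apply: ler_wpM2l; first by rewrite mulr_ge0// kern_ge0.
by apply: ler_wpM2r => //; rewrite ler_pM2l.
Qed.

Let integrand_continuous g y t : 0 < t -> {for t, continuous (power_integrand g y)}.
Proof.
move=> t0; have c1 : {for t, continuous (fun u : R => u `^ (g - 1))}.
  apply: differentiable_continuous; apply/derivable1_diffP.
  by apply: derivable_powR; rewrite in_itv/= andbT.
suff c2 : {for t, continuous (T ^~ y)} by exact: (cvgZ c1 c2).
apply/cvgrPdist_le => e e0.
have [d d0 hd] := semigroup_continuous C0T M1 omega0 stableT y (ltW t0) e0.
near=> s; apply: hd.
  by near: s; apply: filterS (lt_nbhsr t0) => s /ltW.
by near: s; apply: (@cvgr_dist_lt _ _ _ (nbhs t)) => //; exact: cvg_id.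
Unshelve. all: end_near. Qed.

(** Integrable by domination on grids: the majorant at [t] has to absorb the
    values on the whole right half of the interval from 0 to [t], hence its
    factor 2 and its halved decay rate. *)
Lemma power_integrand_integrable g y : 0 < g <= 1 ->
  bochner_integrable D (power_integrand g y).
Proof.
move=> g01; apply: (@grid_bochner_integrable _ _ _ _
    (fun t => majorant g t * `|y|) 0) => //.
- apply: aeW => t; rewrite DE => t0; split => // e e0.
  move/cvgrPdist_le : (@integrand_continuous g y t t0) => /(_ e e0)[d /= d0 hd].
  exists d => // u u0 tu ut; apply: hd => /=.
  by rewrite ger0_norm ?subr_ge0// ltrBlDl -ltrBlDr.
- move=> t u _ u0; rewrite subr0 add0r => tu ut; exact: integrand_bound.
- apply: measurable_funTS; apply: measurable_funM => //; exact: measurable_majorant.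
- by move=> t _; rewrite mulr_ge0 ?majorant_ge0.
- under eq_integral do rewrite EFinM.
  rewrite ge0_integralZr//; last first.
  + by move=> t _; rewrite lee_fin majorant_ge0.
  + by apply/measurable_EFinP; apply: measurable_funTS; exact: measurable_majorant.
  rewrite muleC; apply: lte_mul_pinfty => //; exact: majorant_lty.
Qed.

Lemma power_integral_has g y : 0 < g <= 1 ->
  has_integral D (power_integrand g y) (bochner D (power_integrand g y)).
Proof. by move=> g01; apply: bochner_has_integral => //; exact: power_integrand_integrable. Qed.

Lemma neg_frac_powerE g y :
  neg_frac_power T g y = (Gamma g)^-1 *: bochner D (power_integrand g y).
Proof. by []. Qed.

Lemma neg_frac_power_linear g : 0 < g <= 1 -> linear (neg_frac_power T g).
Proof.
move=> g01 a x y; rewrite !neg_frac_powerE scalerA mulrC -scalerA -scalerDr.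
congr (_ *: _); apply: (@has_integral_unique _ _ D (power_integrand g (a *: x + y))) => //.
  exact: power_integral_has.
have := has_integralD mD (has_integralZ a mD (power_integral_has x g01))
  (power_integral_has y g01).
apply: eq_has_integral => // t; rewrite DE => t0.
rewrite /power_integrand (semigroup_linear C0T (ltW t0)) scalerDr !scalerA.
by rewrite mulrC.
Qed.

Lemma neg_frac_power_bound g : 0 < g <= 1 -> exists2 c, 0 <= c &
  forall y, `|neg_frac_power T g y| <= c * `|y|.
Proof.
move=> g01; pose I := fine (\int[mu]_(t in D) (majorant g t)%:E)%E.
have Ifin : (\int[mu]_(t in D) (majorant g t)%:E)%E = I%:E.
  rewrite fineK// ge0_fin_numE ?majorant_lty//.
  by apply: integral_ge0 => t _; rewrite lee_fin majorant_ge0.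
have I0 : 0 <= I.
  by apply: fine_ge0; apply: integral_ge0 => t _; rewrite lee_fin majorant_ge0.
exists (`|(Gamma g)^-1| * I); first by rewrite mulr_ge0.
move=> y; rewrite neg_frac_powerE normrZ -mulrA; apply: ler_wpM2l => //.
have mm : measurable_fun D (fun t => (majorant g t)%:E).
  by apply/measurable_EFinP; apply: measurable_funTS; exact: measurable_majorant.
rewrite -lee_fin EFinM -Ifin -ge0_integralZr//; last first.
  by move=> t _; rewrite lee_fin majorant_ge0.
apply: (has_integral_norm_le mD (power_integral_has y g01)).
- apply: emeasurable_funM => //.
- by move=> t _; rewrite -EFinM lee_fin mulr_ge0 ?majorant_ge0.
- apply: aeW => t; rewrite DE => t0; rewrite -EFinM lee_fin.
  by apply: integrand_bound => //; rewrite ler_pdivrMr// ler_peMr ?ler1n// ltW.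
Qed.

Lemma neg_frac_power_comm g s y : 0 < g <= 1 -> 0 <= s ->
  neg_frac_power T g (T s y) = T s (neg_frac_power T g y).
Proof.
move=> g01 s0; rewrite !neg_frac_powerE (semigroupZ C0T)//; congr (_ *: _).
apply: (@has_integral_unique _ _ D (power_integrand g (T s y))) => //.
  exact: power_integral_has.
have := has_integral_map mD (semigroup_linear C0T s0)
  (fun x => semigroup_bound C0T M1 omega0 stableT x s0) (power_integral_has y g01).
apply: eq_has_integral => // t; rewrite DE => t0.
rewrite /power_integrand (semigroupZ C0T)//; congr (_ *: _).
by rewrite -!(semigroupD C0T) ?(ltW t0)// addrC.
Qed.

End NegativePower.

Section Injectivity.
Context {R : realType} {X : completeNormedModType R}.
Local Notation mu := (@lebesgue_measure R).

Lemma has_integral_lincomb (D : set R) (s : seq (set R * X)) (a : set R -> R -> R) :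
  measurable D ->
  (forall p, p \in s -> [/\ measurable_fun D (a p.1), forall t, D t -> 0 <= a p.1 t
    & (\int[mu]_(t in D) (a p.1 t)%:E < +oo)%E]) ->
  has_integral D (fun t => \sum_(p <- s) a p.1 t *: p.2)
    (\sum_(p <- s) fine (\int[mu]_(t in D) (a p.1 t)%:E)%E *: p.2).
Proof.
move=> mD; elim: s => [|p s IH] hs.
  move=> e e0; exists [::], (cst 0%E); split => //.
  - by move=> t _; rewrite /simple_eval !big_nil subrr normr0.
  - by rewrite integral0 lee_fin ltW.
  - by rewrite /simple_integral !big_nil subrr normr0 ltW.
have [mp p0 pfin] := hs p (mem_head _ _).
rewrite big_cons; apply: (@eq_has_integral _ _ _
  (fun t => a p.1 t *: p.2 + \sum_(p <- s) a p.1 t *: p.2)) => //.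
  by move=> t _; rewrite big_cons.
apply: has_integralD => //; first exact: has_integral_scaler.
by apply: IH => q qs; apply: hs; rewrite inE qs orbT.
Qed.

(** Tonelli: the inverse power kernel of order [1 - g] followed by the one of
    order [g] is a plain integration. *)
Lemma double_kernel (g h : R) (G : R -> \bar R) : 0 < g < 1 ->
  measurable_fun [set: R] G -> (forall t, 0 <= G t)%E ->
  (\int[mu]_u ((kern g (u - h))%:E * \int[mu]_t ((kern (1 - g) t)%:E * G (t + u)%R)) =
   (beta_kernel (1 - g) g)%:E * \int[mu]_w ((kern 0 (w - h))%:E * G w))%E.
Proof.
move=> /andP[g0 g1] mG G0.
have mk b : measurable_fun [set: R] (fun u => (kern b u)%:E).
  by apply/measurable_EFinP; exact: measurable_kern.
have k0 b u : (0 <= (kern b u)%:E)%E by rewrite lee_fin kern_ge0.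
pose F (z : R * R) := ((kern g (z.1 - h))%:E * ((kern (1 - g) (z.2 - z.1))%:E * G z.2))%E.
have F0 z : (0 <= F z)%E by rewrite /F !mule_ge0.
have mF : measurable_fun [set: R * R] F.
  apply: emeasurable_funM.
    apply: (measurableT_comp (mk g)).
    exact: measurable_funB.
  apply: emeasurable_funM.
    apply: (measurableT_comp (mk (1 - g))).
    exact: measurable_funB.
  by apply: (measurableT_comp mG); exact: measurable_snd.
have -> : (\int[mu]_u ((kern g (u - h))%:E *
     \int[mu]_t ((kern (1 - g) t)%:E * G (t + u)%R)) =
     \int[mu]_u \int[mu]_w F (u, w))%E.
  apply: eq_integral => u _; rewrite /F /=.
  have mw : measurable_fun [set: R] (fun w => (kern (1 - g) (w - u))%:E * G w)%E.
    apply: emeasurable_funM => //; apply: (measurableT_comp (mk (1 - g))).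
    exact: measurable_funB.
  have w0 w : (0 <= (kern (1 - g) (w - u))%:E * G w)%E by rewrite mule_ge0.
  rewrite (ge0_integralZl_EFin mu measurableT (fun w _ => w0 w) mw (kern_ge0 _ _)).
  congr (_ * _)%E; rewrite -(integral_shift u mw w0).
  by apply: eq_integral => w _; rewrite addrK.
rewrite (@fubini_tonelli _ _ (measurableTypeR R) (measurableTypeR R) R mu mu F)//.
rewrite -ge0_integralZl_EFin//; last 3 first.
- by move=> w _; rewrite mule_ge0.
- apply: emeasurable_funM => //; apply: (measurableT_comp (mk 0)).
  exact: measurable_funB.
- exact: beta_kernel_ge0.
apply: eq_integral => w _; rewrite /F /=.
under eq_integral do rewrite muleA -EFinM mulrC.
rewrite ge0_integralZr//; last 2 first.
- exact: (measurable_kern_conv (1 - g) g w h).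
- by move=> u _; rewrite lee_fin mulr_ge0 ?kern_ge0.
rewrite kern_conv; last 2 first.
- by apply/andP; split; lra.
- by apply/andP; split; lra.
by rewrite (_ : 1 - g + g - 1 = 0) ?EFinM -?muleA//; ring.
Qed.

Lemma beta_kernel_gt0 (g : R) : 0 < g < 1 -> 0 < beta_kernel (1 - g) g.
Proof.
move=> /andP[g0 g1]; apply: (@lt_le_trans _ _ 1) => //.
have ge1 b v : 0 <= b -> 0 < v -> v <= 1 -> 1 <= kern b v.
  by move=> b0 v0 v1; have := kern_le b0 v0 v1; rewrite (@kernE _ b 1)// powR1.
rewrite -lee_fin /beta_kernel fineK; last first.
  rewrite ge0_fin_numE; last first.
    by apply: integral_ge0 => u _; rewrite lee_fin mulr_ge0 ?kern_ge0.
  by apply: beta_kernel_lty; apply/andP; split; lra.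
have -> : 1%:E = mu `]0, 1[%classic.
  by rewrite lebesgue_measure_itv/= lte_fin ltr01 oppr0 adde0.
rewrite -[X in mu X]setIT -integral_indic//.
apply: ge0_le_integral => //.
- by apply/measurable_EFinP; apply: measurable_indic; exact: measurable_itv.
- exact: measurable_kern_conv0.
- move=> u _; rewrite lee_fin indicE; have [|_] := boolP (u \in _); last first.
    by rewrite mulr_ge0 ?kern_ge0.
  rewrite inE /= in_itv/= => /andP[u0 u1].
  by rewrite -[1%:R]mulr1; apply: ler_pM => //; apply: ge1; lra.
Qed.

Variables (A : operator X) (T : R -> X -> X) (M omega : R).
Hypotheses (C0T : C0_semigroup T) (M1 : 1 <= M) (omega0 : 0 < omega).
Hypothesis stableT : forall t, 0 < t ->
  (opnorm (T t) <= (M * expR (- omega * t))%:E)%E /\ comp_norm_le A (T t) (M / t).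

Let D : set R := `]0, +oo[%classic.
Let mD : measurable D. Proof. exact: measurable_itv. Qed.
Let DE t : D t = (0 < t) :> Prop. Proof. by rewrite /D /= in_itv/= andbT. Qed.

Let mk b : measurable_fun [set: R] (fun u => (kern b u)%:E).
Proof. by apply/measurable_EFinP; exact: measurable_kern. Qed.

Let mind (E : set R) : measurable E -> measurable_fun [set: R] (fun u => (\1_E u)%:E : \bar R).
Proof. by move=> mE; apply/measurable_EFinP; exact: measurable_indic. Qed.

Let kernel_indic_integrable b (E : set R) u : 0 <= b < 1 -> measurable E ->
  (mu E < +oo)%E -> (\int[mu]_t ((kern b t)%:E * (\1_E (t + u))%:E) < +oo)%E.
Proof.
move=> b01 mE fE.
have m1 : measurable_fun [set: R] (fun t => (kern 0 (2 - t) * kern b (t - 0))%:E).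
  exact: measurable_kern_conv.
have m2 : measurable_fun [set: R] (fun t => (\1_E (t + u))%:E : \bar R).
  apply: (measurableT_comp (mind mE)); exact: measurable_funD.
apply: (@le_lt_trans _ _ (\int[mu]_t ((kern 0 (2 - t) * kern b (t - 0))%:E +
    (\1_E (t + u))%:E))%E).
  apply: ge0_le_integral => //.
  - by move=> t _; rewrite mule_ge0// lee_fin kern_ge0.
  - exact: (emeasurable_funM (mk b) m2).
  - exact: (emeasurable_funD m1 m2).
  - move=> t _; rewrite -EFinM -EFinD lee_fin subr0; have [t2|t2] := ltP t 2.
      rewrite [kern 0 _]kernE ?subr_gt0// oppr0 powRr0 mul1r.
      apply: (@le_trans _ _ (kern b t)); last by rewrite lerDl.
      by rewrite ler_piMr ?kern_ge0// indicE; case: (_ \in _).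
    rewrite [kern 0 _]kern_le0 ?subr_le0// mul0r add0r ler_piMl//.
    have : kern b t <= kern b 1.
      by apply: kern_le => //; [case/andP: b01|apply: le_trans t2; rewrite ler1n].
    by rewrite (@kernE _ b 1)// powR1.
rewrite (ge0_integralD mu measurableT _ m1 _ m2)//; last first.
  by move=> t _; rewrite lee_fin mulr_ge0 ?kern_ge0.
rewrite kern_conv ?lexx ?ltr01//; apply: lte_add_pinfty; first exact: ltry.
rewrite (@integral_shift _ (fun t => (\1_E t)%:E))//; last exact: mind.
by rewrite integral_indic// setIT.
Qed.

(** Approximate the orbit of [y] by a simple function [s] in [L^1]. If the power
    integral of [y] vanishes, so do those of all [T u y], and the power integral
    of [s (. + u)] is small; integrating these against the complementary kernel
    gives, by Tonelli, the tail integrals of [s]. *)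
Lemma simple_tail_le g y s (gg : R -> \bar R) (e h : R) : 0 < g < 1 -> 0 <= e -> 0 <= h ->
  bochner D (power_integrand T g y) = 0 ->
  simple_on D s -> measurable_fun D gg ->
  (forall t, D t -> (`|T t y - simple_eval s t|%:E <= gg t)%E) ->
  (\int[mu]_(t in D) gg t <= e%:E)%E ->
  `|\sum_(p <- s) fine (mu (p.1 `&` `]h, +oo[)) *: p.2| <= e.
Proof.
move=> g01 e0 h0 y0 hs mgg sgg ige.
have g01' : 0 < g <= 1 by case/andP: g01 => -> /ltW.
have gc01 : 0 <= 1 - g < 1 by case/andP: g01 => ? ?; apply/andP; split; lra.
have gg0 t : D t -> (0 <= gg t)%E.
  by move=> Dt; apply: le_trans (sgg t Dt); rewrite lee_fin.
pose G := gg \_ D.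
have mG : measurable_fun [set: R] G.
  by apply/(measurable_restrictT gg mD).
have G0 t : (0 <= G t)%E.
  by rewrite /G patchE; case: ifPn => // /[!inE]; exact: gg0.
have iG : (\int[mu]_t G t <= e%:E)%E by rewrite /G -integral_mkcond.
pose K b u t := ((kern b t)%:E * G (t + u)%R)%E.
have mGu u : measurable_fun [set: R] (fun t => G (t + u)).
  apply: (measurableT_comp mG); exact: measurable_funD.
have mK b u : measurable_fun [set: R] (K b u).
  exact: (emeasurable_funM (mk b) (mGu u)).
have K0 b u t : (0 <= K b u t)%E by rewrite mule_ge0// lee_fin kern_ge0.
pose al u (E : set R) t := kern (1 - g) t * \1_E (t + u).
pose a u (E : set R) := fine (\int[mu]_t (al u E t)%:E)%E.
have mindu u E : measurable E ->
    measurable_fun [set: R] (fun t => (\1_E (t + u))%:E : \bar R).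
  by move=> mE; apply: (measurableT_comp (mind mE)); exact: measurable_funD.
have alE u E : (\int[mu]_t (al u E t)%:E =
    \int[mu]_t ((kern (1 - g) t)%:E * (\1_E (t + u))%:E))%E.
  by apply: eq_integral => t _; rewrite -EFinM.
have alfin u p : p \in s -> (\int[mu]_t (al u p.1 t)%:E < +oo)%E.
  by move=> /hs[mp _ fp]; rewrite alE; exact: kernel_indic_integrable.
have al0 u E t : 0 <= al u E t by rewrite mulr_ge0 ?kern_ge0.
have mal u E : measurable E -> measurable_fun [set: R] (al u E).
  move=> mE; apply: measurable_funM; first exact: measurable_kern.
  by apply/measurable_EFinP; exact: mindu.
(* the power integral of s at the point u *)
have claim1 u : 0 <= u ->
    (`|\sum_(p <- s) a u p.1 *: p.2|%:E <= \int[mu]_t K (1 - g)%R u t)%E.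
  move=> u0.
  have I1 : has_integral setT (fun t => \sum_(p <- s) al u p.1 t *: p.2)
      (\sum_(p <- s) a u p.1 *: p.2).
    apply: has_integral_lincomb => // p ps; split => //; last exact: alfin.
    by apply: mal; have [] := hs p ps.
  have I2 : has_integral setT (fun t => \1_D t *: T u (power_integrand T g y t)) 0.
    have := power_integral_has C0T M1 omega0 stableT y g01'.
    rewrite y0 => /(has_integral_map mD (semigroup_linear C0T u0)
      (fun x => semigroup_bound C0T M1 omega0 stableT x u0)).
    have -> : T u 0 = 0.
      by have := semigroupZ C0T 0 0 u0; rewrite !scale0r.
    exact: has_integral_extend.
  have := has_integralB measurableT I1 I2; rewrite subr0 => I3.
  apply: (has_integral_norm_le measurableT I3) => //.
  apply: aeW => t _; rewrite /K.
  have [t0|t0] := leP t 0.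
    rewrite indicE memNset ?scale0r ?subr0; last by rewrite DE; apply/negP; rewrite -leNgt.
    rewrite big1 ?normr0 ?mule_ge0 ?lee_fin ?kern_ge0//.
    by move=> p _; rewrite /al kern_le0// mul0r scale0r.
  rewrite indicE mem_set ?DE// scale1r /power_integrand (semigroupZ C0T)//.
  rewrite -(semigroupD C0T) ?(ltW t0)//.
  have -> : t `^ (g - 1) = kern (1 - g) t by rewrite kernE// opprB.
  have -> : \sum_(p <- s) al u p.1 t *: p.2 = kern (1 - g) t *: simple_eval s (t + u).
    rewrite /simple_eval scaler_sumr; apply: eq_bigr => p _.
    by rewrite /al scalerA.
  have Dtu : D (t + u) by rewrite DE ltr_wpDr.
  rewrite [u + t]addrC -scalerBr normrZ ger0_norm ?kern_ge0// EFinM.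
  apply: lee_wpmul2l; first by rewrite lee_fin kern_ge0.
  by rewrite distrC /G patchE mem_set//; exact: sgg.
have Bg0 := beta_kernel_gt0 g01; set B := beta_kernel (1 - g) g in Bg0.
have ma E : measurable E -> measurable_fun [set: R] (fun u => a u E).
  move=> mE; pose F (z : R * R) := (al z.1 E z.2)%:E.
  have mF : measurable_fun [set: R * R] F.
    apply/measurable_EFinP; apply: measurable_funM.
      by apply: (measurableT_comp (measurable_kern (1 - g))); exact: measurable_snd.
    apply: (measurableT_comp (measurable_indic mE)).
    exact: measurable_funD.
  have F0 z : (0 <= F z)%E by rewrite lee_fin.
  have := @measurable_fun_fubini_tonelli_F _ _ (measurableTypeR R)
    (measurableTypeR R) R mu F mF F0.
  exact: measurableT_comp.
have a0 u E : 0 <= a u E.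
  by apply: fine_ge0; apply: integral_ge0 => t _; rewrite lee_fin.
have aK u p : p \in s -> (a u p.1)%:E =
    (\int[mu]_t ((kern (1 - g) t)%:E * (\1_(p.1) (t + u))%:E))%E.
  move=> ps; rewrite -alE /a fineK// ge0_fin_numE ?alfin//.
  by apply: integral_ge0 => t _; rewrite lee_fin.
(* the second integration recovers the tail measures *)
have tailE p : p \in s -> (\int[mu]_u (kern g (u - h) * a u p.1)%:E =
    B%:E * mu (p.1 `&` `]h, +oo[))%E.
  move=> ps; have [mp _ _] := hs p ps.
  have := double_kernel h g01 (mind mp) (fun t => _ : (0 <= (\1_(p.1) t)%:E)%E).
  have -> : (\int[mu]_u (kern g (u - h) * a u p.1)%:E = \int[mu]_u ((kern g (u - h))%:E *
      \int[mu]_t ((kern (1 - g) t)%:E * (\1_(p.1) (t + u))%:E)))%E.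
    by apply: eq_integral => u _; rewrite EFinM aK.
  move=> ->; last by move=> t; rewrite lee_fin.
  congr (_ * _)%E.
  have -> : (\int[mu]_w ((kern 0 (w - h))%:E * (\1_(p.1) w)%:E) =
     \int[mu]_w (\1_(p.1 `&` `]h, +oo[) w)%:E)%E.
    apply: eq_integral => w _; rewrite -EFinM indicI /=; congr EFin.
    rewrite mulrC; congr (_ * _); rewrite indicE mem_setE in_itv/= andbT /kern subr_gt0.
    by case: ifP; rewrite // oppr0 powRr0.
  by rewrite integral_indic ?setIT//; apply: measurableI => //; exact: measurable_itv.
have tailfin p : p \in s -> (mu (p.1 `&` `]h, +oo[) < +oo)%E.
  move=> ps; have [mp _ fp] := hs p ps; apply: le_lt_trans fp.
  have mi : measurable (p.1 `&` `]h, +oo[) by apply: measurableI => //; exact: measurable_itv.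
  by apply: le_measure; rewrite ?inE//; exact: subIsetl.
have mkh : measurable_fun [set: R] (fun u => kern g (u - h)).
  apply: (measurableT_comp (measurable_kern g)); exact: measurable_funB.
have I4 : has_integral setT (fun u => \sum_(p <- s) (kern g (u - h) * a u p.1) *: p.2)
    (\sum_(p <- s) fine (\int[mu]_u (kern g (u - h) * a u p.1)%:E)%E *: p.2).
  apply: (@has_integral_lincomb _ _ (fun E u => kern g (u - h) * a u E)) => // p ps.
  have [mp _ _] := hs p ps; split.
  - by apply: measurable_funM => //; exact: ma.
  - by move=> u _; rewrite mulr_ge0 ?kern_ge0.
  - by rewrite tailE//; apply: lte_mul_pinfty => //; [rewrite lee_fin ltW|exact: tailfin].
pose H u := ((kern g (u - h))%:E * \int[mu]_t K (1 - g)%R u t)%E.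
have mH : measurable_fun [set: R] H.
  apply: emeasurable_funM; first by apply/measurable_EFinP.
  pose F (z : R * R) := K (1 - g)%R z.1 z.2.
  have mF : measurable_fun [set: R * R] F.
    apply: emeasurable_funM.
      by apply: (measurableT_comp (mk (1 - g))); exact: measurable_snd.
    apply: (measurableT_comp mG); exact: measurable_funD.
  exact: (@measurable_fun_fubini_tonelli_F _ _ (measurableTypeR R)
    (measurableTypeR R) R mu F mF (fun z => K0 _ _ _)).
have iK0 u : (0 <= \int[mu]_t K (1 - g)%R u t)%E by exact: integral_ge0.
have H0 u : (0 <= H u)%E by rewrite mule_ge0// lee_fin kern_ge0.
have : (`|\sum_(p <- s) fine (\int[mu]_u (kern g (u - h) * a u p.1)%:E)%E *: p.2|%:E
    <= \int[mu]_u H u)%E.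
  apply: (has_integral_norm_le measurableT I4) => //.
  apply: aeW => u _; have [uh|uh] := leP (u - h) 0.
    rewrite big1 ?normr0// => p _; by rewrite kern_le0// mul0r scale0r.
  have -> : \sum_(p <- s) (kern g (u - h) * a u p.1) *: p.2 =
      kern g (u - h) *: \sum_(p <- s) a u p.1 *: p.2.
    by rewrite scaler_sumr; apply: eq_bigr => p _; rewrite scalerA.
  rewrite normrZ ger0_norm ?kern_ge0// EFinM; apply: lee_wpmul2l.
    by rewrite lee_fin kern_ge0.
  by apply: claim1; lra.
have -> : \sum_(p <- s) fine (\int[mu]_u (kern g (u - h) * a u p.1)%:E)%E *: p.2 =
    B *: \sum_(p <- s) fine (mu (p.1 `&` `]h, +oo[)) *: p.2.
  rewrite scaler_sumr !big_seq; apply: eq_bigr => p ps.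
  rewrite tailE// scalerA; congr (_ *: _).
  by rewrite fineM// ge0_fin_numE// tailfin.
rewrite normrZ gtr0_norm// double_kernel// EFinM -/B.
have : (\int[mu]_w ((kern 0 (w - h))%:E * G w) <= e%:E)%E.
  apply: le_trans iG; apply: ge0_le_integral => //.
  - by move=> w _; rewrite mule_ge0// lee_fin kern_ge0.
  - apply: emeasurable_funM => //; apply: (measurableT_comp (mk 0)).
    exact: measurable_funB.
  - move=> w _; rewrite -[leRHS]mul1e; apply: lee_wpmul2r => //.
    by rewrite lee_fin /kern; case: ifP; rewrite // oppr0 powRr0.
move=> le_e le_B; rewrite -lee_fin; apply: le_trans le_e.
by rewrite -(@lee_pmul2l _ B%:E)// lte_fin.
Qed.

(** If the power integral vanishes, so do all tail integrals of the orbit of [y]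
    up to the error [e], hence also its integral over a short interval starting
    at 0; but there the orbit is close to [y]. *)
Lemma power_integral_eq0 g y : 0 < g < 1 ->
  bochner D (power_integrand T g y) = 0 -> y = 0.
Proof.
move=> g01 Iy0; apply/eqP/negPn/negP => yn0.
have ny0 : 0 < `|y| by rewrite normr_gt0.
have ny20 : 0 < `|y| / 2 by exact: divr_gt0.
have [d d0 hd] := semigroup_right_continuous0 C0T y ny20.
pose h := d / 2; have h0 : 0 < h by rewrite divr_gt0.
have hh t : 0 < t -> t <= h -> `|T t y - y| <= `|y| / 2.
  move=> t0 th; apply: hd; first exact: ltW.
  by apply: le_lt_trans th _; rewrite /h ltr_pdivrMr// ltr_pMr// ltr1n.
pose e := h * `|y| / 8; have e0 : 0 < e by rewrite divr_gt0// mulr_gt0.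
have o01 : 0 < (1 : R) <= 1 by rewrite ltr01 lexx.
have hI := power_integral_has C0T M1 omega0 stableT y o01.
have [s [gg [hs mgg sgg ige _]]] := hI e e0.
have {}sgg t : D t -> (`|T t y - simple_eval s t|%:E <= gg t)%E.
  by move=> Dt; have := sgg t Dt; rewrite /power_integrand subrr powRr0 scale1r.
have gg0 t : D t -> (0 <= gg t)%E.
  by move=> Dt; apply: le_trans (sgg t Dt); rewrite lee_fin.
have tail0 := simple_tail_le g01 (ltW e0) (lexx 0) Iy0 hs mgg sgg ige.
have tailh := simple_tail_le g01 (ltW e0) (ltW h0) Iy0 hs mgg sgg ige.
pose E : set R := `]0, h]%classic.
have mE : measurable E by exact: measurable_itv.
have muE : mu E = h%:E.
  by rewrite lebesgue_measure_itv/= lte_fin h0 oppr0 adde0.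
have ED : E `<=` D by move=> t; rewrite DE /E /= in_itv/= => /andP[].
pose sE := [seq (p.1 `&` E, p.2) | p <- s].
have split_tail : simple_integral sE =
    \sum_(p <- s) fine (mu (p.1 `&` `]0%R, +oo[)) *: p.2 -
    \sum_(p <- s) fine (mu (p.1 `&` `]h, +oo[)) *: p.2.
  rewrite -sumrB /simple_integral big_map !big_seq; apply: eq_bigr => p ps /=.
  have [mp _ fp] := hs p ps; rewrite -scalerBl; congr (_ *: _).
  have mh : measurable (`]h, +oo[ : set R) by exact: measurable_itv.
  have fin F : measurable F -> mu (p.1 `&` F) \is a fin_num.
    move=> mF; rewrite ge0_fin_numE//; apply: le_lt_trans fp.
    have mi : measurable (p.1 `&` F) by exact: measurableI.
    by apply: le_measure; rewrite ?inE//; exact: subIsetl.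
  have -> : `]0, +oo[%classic = E `|` `]h, +oo[%classic.
    apply/seteqP; split => t; rewrite /E /= !in_itv/= ?andbT.
      by move=> t0; case: (leP t h) => th; [left; rewrite t0|right].
    by case=> [/andP[]//|]; exact: lt_trans.
  rewrite setIUr measureU; [|exact: measurableI|exact: measurableI|]; last first.
    rewrite -subset0 => t [[_ Et] [_ /=]]; move: Et; rewrite /E /= !in_itv/=.
    by move=> /andP[_ th]; rewrite andbT ltNge th.
  by rewrite fineD ?fin// addrK.
have sE_small : `|simple_integral sE| <= 2 * e.
  rewrite split_tail mulr2n mulrDl mul1r; apply: le_trans (ler_normB _ _) _.
  exact: lerD.
pose l := (E, y) :: scale_simple (-1) sE.
have hl : simple_on E l.
  move=> p; rewrite inE => /orP[/eqP ->|]; first by rewrite /= muE ltry; split.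
  move=> /mapP[_ /mapP[q qs ->] ->] /=; have [mq _ fq] := hs q qs.
  have mi : measurable (q.1 `&` E) by exact: measurableI.
  split => //; apply: le_lt_trans fq.
  by apply: le_measure; rewrite ?inE//; exact: subIsetl.
have := simple_integral_norm_le mE hl.
have -> : simple_integral l = h *: y - simple_integral sE.
  rewrite {1}/simple_integral big_cons -/(simple_integral _) /= muE /=.
  by rewrite [X in _ + X = _]simple_integral_scale scaleN1r.
have bound : (\int[mu]_(t in E) `|simple_eval l t|%:E <= (h * (`|y| / 2) + e)%:E)%E.
  apply: (@le_trans _ _ (\int[mu]_(t in E) ((`|y| / 2)%:E + gg t))%E).
    apply: ge0_le_integral => //.
    - apply/measurable_EFinP; apply: measurable_funTS.
      exact: measurable_norm_simple hl.
    - by apply: emeasurable_funD => //; exact: measurable_funS mgg.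
    - move=> t Et; have t0 : D t by exact: ED.
      have -> : simple_eval l t = y - simple_eval s t.
        rewrite {1}/simple_eval big_cons -/(simple_eval _ t) /= indicE mem_set// scale1r.
        rewrite [X in _ + X = _]simple_eval_scale scaleN1r; congr (_ - _).
        rewrite /simple_eval big_map; apply: eq_bigr => p _ /=.
        by rewrite !indicE in_setI (mem_set Et) andbT.
      apply: (@le_trans _ _ (`|y - T t y|%:E + `|T t y - simple_eval s t|%:E)%E).
        by rewrite -EFinD lee_fin; exact: ler_distD.
      apply: leeD; last exact: sgg.
      rewrite lee_fin distrC; move: Et; rewrite /E /= in_itv/= => /andP[? ?].
      exact: hh.
  have mggE : measurable_fun E gg by exact: measurable_funS mgg.
  have ggE0 t : E t -> (0 <= gg t)%E by move=> /ED; exact: gg0.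
  have c0 : (0 <= (`|y| / 2)%:E)%E by rewrite lee_fin divr_ge0.
  rewrite (ge0_integralD mu mE (fun t _ => c0) (measurable_cst _) ggE0 mggE).
  rewrite EFinD; apply: leeD.
    have -> : (\int[mu]_(t in E) (`|y| / 2)%:E = (`|y| / 2)%:E * mu E)%E.
      exact: integral_cst.
    by rewrite muE -EFinM mulrC.
  by apply: le_trans ige; exact: ge0_integral_subset.
move=> /le_trans/(_ bound); rewrite lee_fin => hy.
have : h * `|y| <= h * (`|y| / 2) + e + 2 * e.
  rewrite -[X in X * _](gtr0_norm h0) -normrZ -[h *: y](subrK (simple_integral sE)).
  by apply: le_trans (ler_normD _ _) _; exact: lerD.
have hy0 : 0 < h * `|y| by exact: mulr_gt0.
rewrite /e; lra.
Qed.

End Injectivity.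

(** * Fractional powers of the generator *)

Section FractionalPower.
Context {R : realType} {X : completeNormedModType R}.
Variables (A : operator X) (T : R -> X -> X) (M omega : R).
Hypotheses (C0T : C0_semigroup T) (genT : is_generator A T).
Hypotheses (M1 : 1 <= M) (omega0 : 0 < omega).
Hypothesis stableT : forall t, 0 < t ->
  (opnorm (T t) <= (M * expR (- omega * t))%:E)%E /\ comp_norm_le A (T t) (M / t).
Variables (g Mg : R).
Hypotheses (g01 : 0 < g < 1) (Mg0 : 0 < Mg).
Hypothesis fracT : forall t, 0 < t -> comp_norm_le (frac_power T g) (T t) (Mg / t `^ g).

Let N := neg_frac_power T g.
Let P := frac_power T g.
Let g01' : 0 < g <= 1. Proof. by case/andP: g01 => -> /ltW. Qed.
Let g0 : 0 < g. Proof. by case/andP: g01. Qed.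
Let M0 : 0 < M. Proof. exact: lt_le_trans M1. Qed.

Let linN : linear N.
Proof. exact (neg_frac_power_linear C0T M1 omega0 stableT g01'). Qed.

Let NL : {linear X -> X} := HB.pack N (GRing.isLinear.Build R X X *:%R N linN).
Let NB x y : N (x - y) = N x - N y. Proof. exact: (linearB NL). Qed.
Let NZ a x : N (a *: x) = a *: N x. Proof. exact: (linearZZ NL). Qed.

(** The unnormalized power integral is injective. If the normalizing constant
    were to vanish, the range would be trivial, whereas it contains the dense
    range of the semigroup. *)
Lemma neg_frac_power_inj x y : N x = N y -> x = y.
Proof.
move=> Nxy; apply/eqP; rewrite -subr_eq0; apply/eqP.
have : N (x - y) = 0 by rewrite NB Nxy subrr.
set z := x - y; rewrite /N neg_frac_powerE => /eqP; rewrite scaler_eq0.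
case/orP => [/eqP G0|/eqP]; last exact: power_integral_eq0 C0T M1 omega0 stableT _ _ g01.
have T0 t : 0 < t -> T t z = 0.
  move=> t0; have [/(_ z)[w _ <-] _] := fracT t0.
  by rewrite neg_frac_powerE G0 scale0r.
apply/eqP; rewrite -normr_le0; apply/ler_addgt0Pr => e e0; rewrite add0r.
have [d d0 hd] := semigroup_right_continuous0 C0T z e0.
have d20 : 0 < d / 2 by rewrite divr_gt0.
have := hd _ (ltW d20); rewrite T0// sub0r normrN; apply.
by rewrite ltr_pdivrMr// ltr_pMr// ltr1n.
Qed.

Lemma frac_powerK y : P (N y) = y.
Proof.
by apply: neg_frac_power_inj; apply: (@xgetPex _ 0 [set w | N w = N y]); exists y.
Qed.

Lemma frac_power_dom y : opdom P (N y). Proof. by exists y. Qed.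

Lemma neg_frac_powerK x : opdom P x -> N (P x) = x.
Proof. by move=> [y _ <-]; congr N; exact: frac_powerK. Qed.

Lemma frac_powerB x y : opdom P x -> opdom P y ->
  opdom P (x - y) /\ P (x - y) = P x - P y.
Proof.
move=> [x' _ <-] [y' _ <-]; rewrite -/N -NB.
by split; [exact: frac_power_dom|rewrite !frac_powerK].
Qed.

(** The regularized power [(-A)^g e^(tA)], everywhere defined for [t > 0]. *)
Definition smooth_power t x : X := P (T t x).
Local Notation S := smooth_power.

Lemma neg_smooth_power t x : 0 < t -> N (S t x) = T t x.
Proof. by move=> t0; apply: neg_frac_powerK; case: (fracT t0). Qed.

Lemma smooth_power_linear t : 0 < t -> linear (S t).
Proof.
move=> t0 a x y; apply: neg_frac_power_inj.
by rewrite linN !neg_smooth_power// (semigroup_linear C0T (ltW t0)).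
Qed.

Lemma smooth_power_bound t x : 0 < t -> `|S t x| <= Mg * kern g t * `|x|.
Proof.
move=> t0; rewrite kernE// powRN; apply: opnorm_bound; last by case: (fracT t0).
move=> a y; apply: neg_frac_power_inj.
by rewrite NZ !neg_smooth_power// (semigroupZ C0T)// ltW.
Qed.

Lemma smooth_powerD s t x : 0 < s -> 0 <= t -> S (s + t) x = S s (T t x).
Proof.
move=> s0 t0; apply: neg_frac_power_inj.
have st0 : 0 < s + t by rewrite ltr_wpDr.
by rewrite !neg_smooth_power// (semigroupD C0T)// ltW.
Qed.

Lemma smooth_powerE t x : 0 < t -> opdom P x -> S t x = T t (P x).
Proof.
move=> t0 Px; apply: neg_frac_power_inj.
have comm : N (T t (P x)) = T t (N (P x)).
  by apply: (neg_frac_power_comm C0T M1 omega0 stableT) => //; exact: ltW.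
by rewrite neg_smooth_power// comm neg_frac_powerK.
Qed.

Lemma smooth_powerB t x y : 0 < t -> S t (x - y) = S t x - S t y.
Proof.
move=> t0; apply: neg_frac_power_inj.
by rewrite NB !neg_smooth_power// (semigroupB C0T)// ltW.
Qed.

(** Interpolation between the bound of order [t^(-g)] and the Lipschitz bound
    of order [(t - s) s^(-g-1)]. *)
Lemma smooth_power_holder b : 0 <= b <= 1 -> exists2 C, 0 <= C &
  forall s t x, 0 < s -> s <= t ->
    `|S t x - S s x| <= C * ((t - s) `^ b * kern (g + b) s) * `|x|.
Proof.
move=> /andP[b0 b1]; exists (4 * Mg * (M * M + 1)).
  by rewrite !mulr_ge0// ?ltW// ltr_wpDl// mulr_ge0// ltW.
move=> s t x s0 st.
have t0 : 0 < t by exact: lt_le_trans st.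
have s20 : 0 < s / 2 by rewrite divr_gt0.
have kg0 := @kern_ge0 R g s.
have gk : 0 <= g <= 1 by case/andP: g01 => /ltW -> /ltW ->.
have MM : 0 <= M * M by rewrite mulr_ge0// ltW.
have -> : 4 * Mg * (M * M + 1) * ((t - s) `^ b * kern (g + b) s) * `|x| =
    4 * Mg * (M * M + 1) * (kern g s * `|x|) * ((t - s) / s) `^ b.
  rewrite powRM ?subr_ge0 ?invr_ge0 ?(ltW s0)//.
  rewrite -kernM (_ : s^-1 `^ b = kern b s); first by ring.
  by rewrite kernE// -powR_inv1 ?(ltW s0)// -powRrM mulN1r.
have [ts|ts] := leP (t - s) s; last first.
  apply: (@le_trans _ _ (4 * Mg * (M * M + 1) * (kern g s * `|x|))).
    apply: le_trans (ler_normB _ _) _.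
    apply: (@le_trans _ _ (2 * (Mg * kern g s * `|x|))).
      rewrite mulr2n mulrDl mul1r; apply: lerD; last exact: smooth_power_bound.
      apply: le_trans (smooth_power_bound _ t0) _; apply: ler_wpM2r => //.
      by rewrite ler_pM2l//; apply: kern_le => //; exact: ltW.
    rewrite (_ : 2 * _ = 2 * (Mg * (kern g s * `|x|))); last by ring.
    rewrite (_ : 4 * _ * _ * _ = 4 * (M * M + 1) * (Mg * (kern g s * `|x|))); last by ring.
    apply: ler_wpM2r; first by rewrite !mulr_ge0// ltW.
    by nra.
  rewrite ler_peMr//; first by rewrite !mulr_ge0// ?ltW// ltr_wpDl.
  apply: (@le_trans _ _ (1 `^ b)); first by rewrite powR1.
  by apply: ge0_ler_powR => //;
    rewrite ?nnegrE ?divr_ge0 ?subr_ge0 ?(ltW s0)// ler_pdivlMr// mul1r ltW.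
have -> : S t x - S s x = S (s / 2) (T (t - s / 2) x - T (s / 2) x).
  rewrite smooth_powerB// -!smooth_powerD ?(ltW s20)//; last by lra.
  by congr (S _ _ - S _ _); lra.
apply: le_trans (smooth_power_bound _ s20) _.
have hd : `|T (t - s / 2) x - T (s / 2) x| <= M * M * ((t - s) / (s / 2)) * `|x|.
  have := semigroup_diff_bound C0T genT M1 omega0 stableT x s20 (_ : s / 2 <= t - s / 2).
  by rewrite (_ : t - s / 2 - s / 2 = t - s); [apply; lra|lra].
apply: (@le_trans _ _ (Mg * (2 * kern g s) * (M * M * ((t - s) / (s / 2)) * `|x|))).
  apply: ler_pM => //; first by rewrite mulr_ge0 ?kern_ge0// ltW.
  by rewrite ler_pM2l//; exact: kern_half.
have q0 : 0 <= (t - s) / s by rewrite divr_ge0 ?subr_ge0// ltW.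
have q1 : (t - s) / s <= 1 by rewrite ler_pdivrMr// mul1r.
have qb : (t - s) / s <= ((t - s) / s) `^ b.
  have [->|qn0] := eqVneq ((t - s) / s) 0; first exact: powR_ge0.
  by rewrite -[leLHS]powRr1//; apply: ger_powR; rewrite // lt_def qn0 q0.
rewrite (_ : _ / (s / 2) = 2 * ((t - s) / s)); last by field; rewrite gt_eqF.
rewrite (_ : Mg * _ * _ = 4 * Mg * (M * M) * (kern g s * `|x|) * ((t - s) / s)); last by ring.
apply: ler_pM => //; first by rewrite !mulr_ge0// ltW.
by apply: ler_wpM2r; [rewrite mulr_ge0|rewrite ler_pM2l ?mulr_gt0// lerDl].
Qed.

(** [S e x] is [T e] applied to [P x], which tends to [P x] as [e] tends to 0. *)
Lemma frac_power_norm_le x rho : opdom P x ->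
  (forall e, 0 < e -> `|S e x| <= rho) -> `|P x| <= rho.
Proof.
move=> Px Srho; apply/ler_addgt0Pr => e e0.
have [d d0 hd] := semigroup_right_continuous0 C0T (P x) e0.
have d20 : 0 < d / 2 by rewrite divr_gt0.
have := hd _ (ltW d20); rewrite -smooth_powerE// => /(_ _) hd'.
rewrite -[P x](subrK (S (d / 2) x)) addrC; apply: le_trans (ler_normD _ _) _.
apply: lerD; first exact: Srho.
by rewrite distrC; apply: hd'; rewrite ltr_pdivrMr// ltr_pMr// ltr1n.
Qed.

(** Closedness of the fractional power, in the form of a regularization
    criterion: it suffices that [(-A)^g e^(eA) x] is bounded and Cauchy. *)
Lemma frac_power_regularized x rho :
  (forall e, 0 < e -> `|S e x| <= rho) ->
  (forall eta, 0 < eta -> exists2 d, 0 < d &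
    forall e e', 0 < e -> e < d -> 0 < e' -> e' < d -> `|S e x - S e' x| <= eta) ->
  opdom P x /\ `|P x| <= rho.
Proof.
move=> Srho cauchyS.
suff Px : opdom P x by split => //; exact: frac_power_norm_le.
pose u k : X := S k.+1%:R^-1 x.
have k0 k : 0 < k.+1%:R^-1 :> R by rewrite invr_gt0.
have small (d : R) : 0 < d -> \forall k \near \oo, k.+1%:R^-1 < d.
  move=> d0; exists (Num.truncn d^-1) => // k /= hk.
  have d1 : 0 <= d^-1 by rewrite invr_ge0 ltW.
  have /andP[_ h3] := truncn_itv d1.
  rewrite -(invrK d) ltf_pV2 ?posrE ?invr_gt0//.
  by apply: lt_le_trans h3 _; rewrite ler_nat.
have /cvg_ex[z uz] : cvgn u.
  apply/cauchy_cvgP/cauchy_exP => eta eta0.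
  have eta20 : 0 < eta / 2 by rewrite divr_gt0.
  have [d d0 hd] := cauchyS _ eta20.
  have [K _ hK] := small d d0.
  exists (u K); exists K => // k /= Kk; rewrite -ball_normE /=.
  apply: (@le_lt_trans _ _ (eta / 2)); last by rewrite ltr_pdivrMr// ltr_pMr// ltr1n.
  by apply: hd => //; apply: hK => /=.
suff -> : x = N z by exact: frac_power_dom.
have [c c0 Nc] := neg_frac_power_bound C0T M1 omega0 stableT g01'.
have h1 : T k.+1%:R^-1 x @[k --> \oo] --> x.
  apply/cvgrPdist_le => e e0.
  have [d d0 hd] := semigroup_right_continuous0 C0T x e0.
  by near=> k; rewrite distrC; apply: hd; [exact: ltW|near: k; exact: small].
have h2 : T k.+1%:R^-1 x @[k --> \oo] --> N z.
  apply/cvgrPdist_le => e e0.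
  have ec0 : 0 < e / (c + 1) by rewrite divr_gt0// ltr_wpDl.
  near=> k; rewrite -(neg_smooth_power x (k0 k)) -/(u k) -NB.
  apply: le_trans (Nc _) _.
  have : `|z - u k| <= e / (c + 1).
    by near: k; move/cvgrPdist_le : uz; apply.
  rewrite ler_pdivlMr ?ltr_wpDl// mulrDr mulr1 [_ * c]mulrC => h.
  by apply: le_trans h; rewrite lerDl.
apply: (@cvg_unique X (@norm_hausdorff R X) (T k.+1%:R^-1 x @[k --> \oo])); [exact: h1|exact: h2].
Unshelve. all: end_near. Qed.

(** The operator [B (-A)^(-g)] is everywhere defined and closed, hence bounded by
    the closed graph theorem. *)
Lemma relative_bound (B : operator X) : linear_operator B -> closed_operator B ->
  opdom P `<=` opdom B ->
  exists2 c, 0 <= c & forall x, opdom P x -> `|B x| <= c * `|P x|.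
Proof.
move=> [B0 Blin] Bclosed PB.
have domN y : opdom B (N y) by apply: PB; exact: frac_power_dom.
have [c c0 Nc] := neg_frac_power_bound C0T M1 omega0 stableT g01'.
have cN (u : nat -> X) y : u k @[k --> \oo] --> y -> N (u k) @[k --> \oo] --> N y.
  move=> /cvgrPdist_le uy; apply/cvgrPdist_le => e e0.
  have ec0 : 0 < e / (c + 1) by rewrite divr_gt0// ltr_wpDl.
  apply: filterS (uy _ ec0) => k; rewrite ler_pdivlMr ?ltr_wpDl// mulrDr mulr1 => h.
  by rewrite -NB; apply: le_trans (Nc _) _; apply: le_trans h; rewrite mulrC lerDl.
have linL : linear (fun y => B (N y)).
  by move=> a x y /=; rewrite linN; case: (Blin a (N x) (N y)).
have closedL (u : nat -> X) x y : u k @[k --> \oo] --> x ->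
    B (N (u k)) @[k --> \oo] --> y -> y = B (N x).
  move=> ux Bu.
  have near_graph : \forall k \near \oo,
      [set p : X * X | opdom B p.1 /\ p.2 = B p.1] (N (u k), B (N (u k))).
    by apply: nearW => k /=.
  have lim : (N (u k), B (N (u k))) @[k --> \oo] --> (N x, y).
    by apply: cvg_pair => //; exact: cN.
  by have [] := closed_cvg _ Bclosed near_graph _ lim.
have [c' c'0 hc'] := closed_graph_bound linL closedL.
by exists c' => // x Px; rewrite -{1}(neg_frac_powerK Px); exact: hc'.
Qed.

End FractionalPower.

(** * Sums of shifted kernels and a Gronwall inequality *)

Section ShiftedKernels.
Context {R : realType}.
Local Notation mu := (@lebesgue_measure R).
Implicit Types (a m r t u : R) (n : nat).

(** The singularities produced by the delay sit at the multiples of [r]. *)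
Definition kern_sum r a n t : R := \sum_(k < n) kern a (t - k%:R * r).

Lemma kern_sum_ge0 r a n t : 0 <= kern_sum r a n t.
Proof. by apply: sumr_ge0 => k _; exact: kern_ge0. Qed.

Lemma measurable_kern_shift a c : measurable_fun [set: R] (fun u => kern a (u - c)).
Proof. by apply: (measurableT_comp (measurable_kern a)); exact: measurable_funB. Qed.

Lemma measurable_kern_reflect a c : measurable_fun [set: R] (fun u => kern a (c - u)).
Proof. by apply: (measurableT_comp (measurable_kern a)); exact: measurable_funB. Qed.

Lemma measurable_kern_sum r a n : measurable_fun [set: R] (kern_sum r a n).
Proof. by apply: measurable_sum => k; exact: measurable_kern_shift. Qed.

(** The singularity next to [t] on its left dominates all the earlier ones. *)
Lemma kern_sum_le r a n t : 0 < r -> 0 <= a -> n%:R * r < t ->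
  kern_sum r a n.+1 t <= n.+1%:R * kern a (t - n%:R * r).
Proof.
move=> r0 a0 nt; rewrite /kern_sum.
apply: (@le_trans _ _ (\sum_(k < n.+1) kern a (t - n%:R * r))).
  apply: ler_sum => k _; apply: kern_le => //; first by rewrite subr_gt0.
  by rewrite lerD2l lerN2 ler_pM2r// ler_nat -ltnS.
by rewrite sumr_const card_ord -[X in X <= _]mulr_natl.
Qed.

(** The singularities of [A1 G (u - r)] together with the bounded contribution
    of the distributed delay, restricted to positive times. *)
Definition weight r m n u : R := kern_sum r m n (u - r) + kern 0 u.

Lemma weight_ge0 r m n u : 0 <= weight r m n u.
Proof. by rewrite addr_ge0 ?kern_sum_ge0 ?kern_ge0. Qed.

Lemma measurable_weight r m n : measurable_fun [set: R] (weight r m n).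
Proof.
apply: measurable_funD; last exact: measurable_kern.
apply: (measurableT_comp (measurable_kern_sum r m n)); exact: measurable_funB.
Qed.

Let kern_conv_le a m t c v : 0 <= a < 1 -> 0 <= m < 1 -> t - c <= v ->
  (\int[mu]_u (kern a (t - u) * kern m (u - c))%:E <=
   (beta_kernel a m * v `^ (1 - m) * kern a (t - c))%:E)%E.
Proof.
move=> a01 m01 tv; rewrite kern_conv// lee_fin -mulrA.
apply: ler_wpM2l; first exact: beta_kernel_ge0.
have [tc|tc] := leP (t - c) 0; first by rewrite !kern_le0// mulr0.
have m1 : 0 <= 1 - m by case/andP: m01 => _ /ltW; rewrite subr_ge0.
have := kern_exp_le (a + m - 1) m1 tc tv.
by rewrite (_ : a + m - 1 + (1 - m) = a); last by ring.
Qed.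

(** Convolution with [kern a] turns a singularity of order [m] into one of order
    [a + m - 1], which is at most [a] as [m <= 1]. *)
Lemma kern_weight_conv r a m n : 0 < r -> 0 <= a < 1 -> 0 <= m < 1 ->
  exists2 C, 0 <= C & forall t, t <= n.+1%:R * r ->
    (\int[mu]_u (kern a (t - u) * weight r m n u)%:E <=
     (C * kern_sum r a n.+1 t)%:E)%E.
Proof.
move=> r0 a01 m01; pose v : R := n.+1%:R * r.
have v0 : 0 < v by rewrite mulr_gt0// ltr0n.
have o01 : 0 <= (0 : R) < 1 by rewrite lexx ltr01.
pose C1 := beta_kernel a m * v `^ (1 - m).
pose C2 := beta_kernel a 0 * v `^ (1 - 0).
have C10 : 0 <= C1 by rewrite mulr_ge0 ?beta_kernel_ge0 ?powR_ge0.
have C20 : 0 <= C2 by rewrite mulr_ge0 ?beta_kernel_ge0 ?powR_ge0.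
exists (C1 + C2); first exact: addr_ge0.
move=> t tv.
have mconv m' c : measurable_fun [set: R] (fun u => (kern a (t - u) * kern m' (u - c))%:E).
  exact: measurable_kern_conv.
have conv0 m' c u : (0 <= (kern a (t - u) * kern m' (u - c))%:E)%E.
  by rewrite lee_fin mulr_ge0 ?kern_ge0.
have -> : (\int[mu]_u (kern a (t - u) * weight r m n u)%:E =
   \int[mu]_u (\sum_(k < n) (kern a (t - u) * kern m (u - k.+1%:R * r))%:E +
      (kern a (t - u) * kern 0 (u - 0))%:E))%E.
  apply: eq_integral => u _; rewrite /weight subr0 mulrDr EFinD sumEFin; congr (_%:E + _)%E.
  rewrite /kern_sum mulr_sumr; apply: eq_bigr => k _; congr (_ * kern m _).
  by rewrite -natr1 mulrDl mul1r opprD addrA addrAC.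
pose Sm u : \bar R := (\sum_(k < n) (kern a (t - u) * kern m (u - k.+1%:R * r))%:E)%E.
have Sm0 u : (0 <= Sm u)%E by apply: sume_ge0 => k _; exact: conv0.
have mSm : measurable_fun [set: R] Sm by apply: emeasurable_sum => k; exact: mconv.
rewrite (ge0_integralD mu measurableT (fun u _ => Sm0 u) mSm
  (fun u _ => conv0 0 0 u) (mconv 0 0)).
rewrite /Sm (ge0_integral_sum mu measurableT (fun k : 'I_n => mconv m (k.+1%:R * r))
  (fun k u _ => conv0 m (k.+1%:R * r) u)).
have step1 : (\sum_(k < n) \int[mu]_u (kern a (t - u) * kern m (u - k.+1%:R * r))%:E <=
   (C1 * \sum_(k < n) kern a (t - k.+1%:R * r))%:E)%E.
  rewrite mulr_sumr -sumEFin; apply: lee_sum => k _.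
  apply: kern_conv_le => //; apply: le_trans tv.
  by rewrite gerBl mulr_ge0// ltW.
have step2 : (\int[mu]_u (kern a (t - u) * kern 0 (u - 0))%:E <= (C2 * kern a t)%:E)%E.
  by rewrite -[in kern a t](subr0 t); apply: kern_conv_le; rewrite // subr0.
apply: le_trans (leeD step1 step2) _; rewrite -EFinD lee_fin.
rewrite /kern_sum big_ord_recl /= mul0r subr0 mulrDl !mulrDr.
rewrite [X in _ <= X](_ : _ = (C1 * \sum_(k < n) kern a (t - k.+1%:R * r) + C2 * kern a t) +
  (C1 * kern a t + C2 * \sum_(k < n) kern a (t - k.+1%:R * r))); last by rewrite /bump /=; ring.
by rewrite lerDl addr_ge0// mulr_ge0 ?kern_ge0// sumr_ge0// => k _; exact: kern_ge0.
Qed.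

Lemma kern_sum_integral_lty r a n t : 0 < r -> 0 <= a < 1 ->
  (\int[mu]_(u in `[0%R, t]) (kern_sum r a n u)%:E < +oo)%E.
Proof.
move=> r0 a01.
have o01 : 0 <= (0 : R) < 1 by rewrite lexx ltr01.
pose w := `|t| + 1.
have mconv c : measurable_fun [set: R] (fun u => (kern 0 (w - u) * kern a (u - c))%:E).
  exact: measurable_kern_conv.
apply: (@le_lt_trans _ _ (\int[mu]_u
    \sum_(k < n) (kern 0 (w - u) * kern a (u - k%:R * r))%:E)%E); last first.
  have conv0 c u : (0 <= (kern 0 (w - u) * kern a (u - c))%:E)%E.
    by rewrite lee_fin mulr_ge0 ?kern_ge0.
  rewrite (ge0_integral_sum mu measurableT (fun k : 'I_n => mconv (k%:R * r))
    (fun k u _ => conv0 (k%:R * r) u)).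
  by apply: lte_sum_pinfty => k _; rewrite kern_conv// ltry.
apply: ge0_integral_le_gen => //.
- move=> u; rewrite /= in_itv/= => /andP[u0 ut]; rewrite lee_fin kern_sum_ge0 /=.
  rewrite sumEFin lee_fin le_eqVlt; apply/orP; left; apply/eqP.
  apply: eq_bigr => k _; rewrite [kern 0 _]kernE ?oppr0 ?powRr0 ?mul1r//.
  rewrite subr_gt0; apply: le_lt_trans ut _; apply: le_lt_trans (ler_norm _) _.
  by rewrite ltrDl.
- by move=> u _; apply: sume_ge0 => k _; rewrite lee_fin mulr_ge0 ?kern_ge0.
Qed.

End ShiftedKernels.

Section Gronwall.
Context {R : realType}.
Local Notation mu := (@lebesgue_measure R).

(** Cutting [0, tau] into pieces so short that the self-interaction on each
    piece is absorbed; only the monotonicity of the primitive of [f] is used. *)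
Lemma gronwall_integral (tau beta : R) (alpha : R -> R) : 0 < tau -> 0 <= beta ->
  measurable_fun [set: R] alpha -> (forall t, 0 <= alpha t) ->
  (\int[mu]_(t in `[0%R, tau]) (alpha t)%:E < +oo)%E ->
  exists2 C, 0 <= C & forall (f : R -> \bar R) (c : R), 0 <= c ->
    measurable_fun `[0, tau] f -> (forall t, `[0%R, tau]%classic t -> 0 <= f t)%E ->
    (\int[mu]_(t in `[0%R, tau]) f t < +oo)%E ->
    {ae mu, forall t, `[0, tau]%classic t ->
      (f t <= (alpha t * c)%:E + beta%:E * \int[mu]_(u in `[0%R, t]) f u)%E} ->
    (\int[mu]_(t in `[0%R, tau]) f t <= (C * c)%:E)%E.
Proof.
move=> tau0 beta0 malpha alpha0 alphafin.
pose I := fine (\int[mu]_(t in `[0%R, tau]) (alpha t)%:E)%E.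
have I0 : 0 <= I.
  by apply: fine_ge0; apply: integral_ge0 => t _; rewrite lee_fin.
have IE : (\int[mu]_(t in `[0%R, tau]) (alpha t)%:E)%E = I%:E.
  by rewrite fineK// ge0_fin_numE//; apply: integral_ge0 => t _; rewrite lee_fin.
pose n := (Num.truncn (2 * beta * tau)).+1.
have n0 : 0 < n%:R :> R by rewrite ltr0n.
pose d := tau / n%:R.
have d0 : 0 < d by exact: divr_gt0.
have bd : beta * d <= 2^-1.
  have b0 : 0 <= 2 * beta * tau by rewrite !mulr_ge0// ltW.
  have /andP[_ h] := truncn_itv b0; rewrite /d mulrA ler_pdivrMr//.
  by rewrite -/n in h; lra.
pose C := fix C j := if j is j'.+1 then 2 * (C j' + I) else 0.
have C0 j : 0 <= C j by elim: j => //= j IH; rewrite mulr_ge0// addr_ge0.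
exists (C n) => // f c c0 mf f0 ffin fle.
have sub s : s <= tau -> `[0, s]%classic `<=` `[0, tau]%classic.
  by move=> st u /=; rewrite !in_itv/= => /andP[-> us]; exact: le_trans st.
pose F s := (\int[mu]_(u in `[0%R, s]) f u)%E.
have F0 s : s <= tau -> (0 <= F s)%E.
  by move=> st; apply: integral_ge0 => u /(sub _ st); exact: f0.
have Fmono s s' : s <= s' -> s' <= tau -> (F s <= F s')%E.
  move=> ss' s't; apply: ge0_integral_subset => [u /=|u /(sub _ s't)]; last exact: f0.
  by rewrite !in_itv/= => /andP[-> us]; exact: le_trans ss'.
have Ffin s : s <= tau -> F s \is a fin_num.
  move=> st; rewrite ge0_fin_numE ?F0//; apply: le_lt_trans ffin; exact: Fmono.
suff claim j : (j <= n)%N -> (F (j%:R * d)%R <= (C j * c)%:E)%E.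
  have := claim n (leqnn n); rewrite /F (_ : n%:R * d = tau)//.
  by rewrite /d mulrC divfK// gt_eqF.
elim: j => [_|j IH jn].
  by rewrite mul0r /F set_itv1 integral_set1 mul0r.
have jt : j.+1%:R * d <= tau.
  by rewrite /d mulrA ler_pdivrMr// mulrC ler_pM2l// ler_nat.
have jj : j%:R * d <= j.+1%:R * d by rewrite ler_pM2r// ler_nat.
have jd0 : 0 <= j%:R * d by rewrite mulr_ge0// ltW.
set s := j%:R * d in jj jd0 *; set s' := j.+1%:R * d in jt jj *.
have {}IH : (F s <= (C j * c)%:E)%E by apply: IH; exact: ltnW.
have Es' : `[0, s']%classic = `[0, s]%classic `|` `]s, s']%classic :> set R.
  apply/seteqP; split => u /=; rewrite !in_itv/=.
    by move=> /andP[-> us]; case: (leP u s) => h; [left|right].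
  move=> [/andP[-> us]|/andP[su ->]]; first by rewrite (le_trans us).
  by rewrite andbT (le_trans jd0)// ltW.
pose J : set R := `]s, s']%classic.
have JT : J `<=` `[0, tau]%classic.
  move=> u; rewrite /J /= !in_itv/= => /andP[su us'].
  by rewrite (le_trans jd0 (ltW su)) (le_trans us' jt).
have mJ : measurable J by exact: measurable_itv.
have mfJ : measurable_fun J f by apply: measurable_funS mf => //; exact: measurable_itv.
have muJ : mu J = d%:E.
  rewrite lebesgue_measure_itv/= lte_fin ltr_pM2r// ltr_nat ltnSn.
  by rewrite -EFinB /s /s' -mulrBl -natrB// subSnn mul1r.
have FE : (F s' = F s + \int[mu]_(u in J) f u)%E.
  rewrite /F Es' ge0_integral_setU//.
  - by rewrite -Es'; apply: measurable_funS mf => //; exact: sub.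
  - by rewrite -Es' => u /(sub _ jt); exact: f0.
  - by apply/disj_setPS => u [] /=; rewrite !in_itv/= => /andP[_ us] /andP[]; rewrite ltNge us.
have maJ : measurable_fun J (fun t => (alpha t)%:E).
  by apply/measurable_EFinP; exact: measurable_funTS.
have F'f := Ffin _ jt.
have intJ : (\int[mu]_(u in J) f u <= (I * c)%:E + (beta * d)%:E * F s')%E.
  apply: (@le_trans _ _ (\int[mu]_(u in J) ((alpha u)%:E * c%:E + beta%:E * F s'))%E).
    apply: ae_ge0_le_integral => //.
    - by move=> u /JT; exact: f0.
    - move=> u _; rewrite adde_ge0 ?mule_ge0 ?lee_fin ?F0//.
    - by apply: emeasurable_funD => //; exact: emeasurable_funM.
    - apply: filterS fle => u h Ju; apply: le_trans (h (JT _ Ju)) _.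
      rewrite EFinM; apply: leeD => //; apply: lee_wpmul2l; first by rewrite lee_fin.
      by apply: Fmono => //; move: Ju; rewrite /J /= in_itv/= => /andP[].
  rewrite ge0_integralD//; last 3 first.
  - by move=> u _; rewrite mule_ge0 ?lee_fin.
  - exact: emeasurable_funM.
  - by move=> u _; rewrite mule_ge0 ?lee_fin ?F0.
  apply: leeD.
    rewrite ge0_integralZr//; last by move=> u _; rewrite lee_fin.
    rewrite EFinM; apply: lee_wpmul2r; first by rewrite lee_fin.
    rewrite -IE; apply: ge0_integral_subset => // u _; by rewrite lee_fin.
  have -> : (\int[mu]_(u in J) (beta%:E * F s') = beta%:E * F s' * mu J)%E.
    by rewrite -integral_cst.
  by rewrite muJ muleAC -EFinM.
move: FE intJ IH; rewrite -(fineK F'f) -(fineK (Ffin s (le_trans jj jt))).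
set y := fine (F s'); set z := fine (F s); move=> FE.
have y0 : 0 <= y by apply: fine_ge0; exact: F0.
have Jfin : (\int[mu]_(u in J) f u)%E \is a fin_num.
  rewrite ge0_fin_numE; last by apply: integral_ge0 => u /JT; exact: f0.
  apply: le_lt_trans ffin; exact: ge0_integral_subset.
move: FE; rewrite -(fineK Jfin); set w := fine _.
rewrite -EFinD => -[yzw]; rewrite -EFinM -EFinD !lee_fin => hw hz.
have : beta * d * y <= 2^-1 * y by apply: ler_wpM2r.
rewrite [C _]/=; move: yzw hw hz; rewrite mulrDr !mulrDl; lra.
Qed.

End Gronwall.

(** * Forcing bounds for the fundamental solution *)

Section VariationOfConstants.
Context {R : realType} {X : completeNormedModType R}.
Local Notation mu := (@lebesgue_measure R).
Variables (T : R -> X -> X) (r : R) (A1 A2 : operator X) (a : R -> R) (G : R -> X -> X).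
Hypotheses (r0 : 0 < r) (C0T : C0_semigroup T) (fsG : fundamental_solution T r A1 A2 a G).
Hypothesis linA2 : linear_operator A2.

(** The only trace of the equation in the regularity estimates: [H] stands for a
    majorant of the forcing, whose convolution with [T] is [G t x - T t x]. Two
    times and two operators serve the Hoelder estimates; [Q = 0] and [s = 0] give
    the pointwise ones. *)
Definition forcing_bound x (tau : R) (H : R -> R) :=
  forall s t (P Q : X -> X) (k : R -> R), 0 <= s -> s <= t -> t <= tau ->
  bounded_linear P -> bounded_linear Q ->
  measurable_fun [set: R] k -> (forall u, 0 <= k u) ->
  (forall u y, 0 <= u -> u < s -> `|P (T (t - u) y) - Q (T (s - u) y)| <= k u * `|y|) ->
  (forall u y, s < u -> u < t -> `|P (T (t - u) y)| <= k u * `|y|) ->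
  (`|P (G t x - T t x) - Q (G s x - T s x)|%:E <=
     \int[mu]_(u in `[0%R, t]) (k u * H u)%:E)%E.

Let G_neg u x : u < 0 -> G u x = 0.
Proof. by move=> u0; rewrite (fs_neg fsG u0). Qed.

Lemma ae_neq (c : R) : {ae mu, forall u, u <> c}.
Proof.
exists [set c]; split; first exact: measurable_set1.
  exact: lebesgue_measure_set1.
by move=> u /= /contrapT.
Qed.

(** Bounded operators pass under the integral signs of the equation, so that the
    left-hand side becomes one integral with the operator kernel [L] below. The
    inner integral over the delay is at most the bound of [a] times the integral
    of [g2], by translation, because [G] vanishes at negative times. *)
Lemma forcing_bound_split x tau (h1 : R -> R) (g2 : R -> \bar R) (M K : R) :
  measurable_fun [set: R] h1 -> (forall u, 0 <= h1 u) ->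
  {ae mu, forall u, 0 <= u -> u <= tau -> `|A1 (G (u - r) x)| <= h1 u} ->
  measurable_fun `[0, tau] g2 ->
  (forall u, 0 <= u -> u <= tau -> (`|A2 (G u x)|%:E <= g2 u)%E) ->
  (\int[mu]_(u in `[0%R, tau]) g2 u <= K%:E)%E -> 0 <= K ->
  0 <= M -> {ae mu, forall th, - r <= th -> th <= 0 -> `|a th| <= M} ->
  forcing_bound x tau (fun u => h1 u + M * K * kern 0 u).
Proof.
move=> mh1 h10 A1h1 mg2 A2g2 g2K K0 M0 aM s t P Q k s0 st ttau bP bQ mk k0 hst ht.
have t0 : 0 <= t by exact: le_trans st.
have stau : s <= tau by exact: le_trans ttau.
pose Dt : set R := `[0, t]%classic; pose Ds : set R := `[0, s]%classic.
have mDt : measurable Dt by exact: measurable_itv.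
have mDs : measurable Ds by exact: measurable_itv.
have DtE u : Dt u = (0 <= u <= t) :> Prop by rewrite /Dt /= in_itv.
have DsE u : Ds u = (0 <= u <= s) :> Prop by rewrite /Ds /= in_itv.
have Dst : Ds `<=` Dt.
  by move=> u; rewrite DtE DsE => /andP[-> us]; exact: le_trans st.
have [cP _ Pc] := bounded_linear_bound bP.
have [cQ _ Qc] := bounded_linear_bound bQ.
have lP := bP.1; have lQ := bQ.1.
have PD y z : P (y + z) = P y + P z by have := lP 1 y z; rewrite !scale1r.
have QD y z : Q (y + z) = Q y + Q z by have := lQ 1 y z; rewrite !scale1r.
have P0 : P 0 = 0 by have := Pc 0; rewrite normr0 mulr0 normr_le0 => /eqP.
have Q0 : Q 0 = 0 by have := Qc 0; rewrite normr0 mulr0 normr_le0 => /eqP.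
have PZ b y : P (b *: y) = b *: P y by have := lP b y 0; rewrite !addr0 P0 addr0.
have QZ b y : Q (b *: y) = b *: Q y by have := lQ b y 0; rewrite !addr0 Q0 addr0.
pose I : set R := `[- r, 0]%classic.
have mI : measurable I by exact: measurable_itv.
pose dly t u := T (t - u) (A1 (G (u - r) x)).
pose dst t u th := a th *: T (t - u) (A2 (G (u + th) x)).
pose W t u := bochner I (dst t u).
have eqn t' : 0 <= t' -> [/\ bochner_integrable `[0, t'] (dly t'),
    {ae mu, forall u, u \in `[0, t'] -> bochner_integrable I (dst t' u)},
    bochner_integrable `[0, t'] (W t')
    & G t' x = T t' x + bochner `[0, t'] (dly t') + bochner `[0, t'] (W t')].
  by move=> t'0; exact: fs_equation fsG x t' t'0.
have [i1t aet i2t Gt] := eqn t t0.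
have [i1s aes i2s Gs] := eqn s s0.
pose L u y := P (T (t - u) y) - \1_Ds u *: Q (T (s - u) y).
have Lbound : {ae mu, forall u, Dt u -> forall y, `|L u y| <= k u * `|y|}.
  apply: filterS2 (ae_neq s) (ae_neq t) => u us ut; rewrite DtE => /andP[u0 ut'] y.
  rewrite /L indicE; have [su|su] := ltP u s.
    have Du : Ds u by rewrite DsE u0 ltW.
    by rewrite (mem_set Du) scale1r; exact: hst.
  rewrite memNset ?scale0r ?subr0; last first.
    by rewrite DsE => /andP[_ us']; apply: us; apply/eqP; rewrite eq_le us' su.
  apply: ht; first by rewrite lt_neqAle su andbT eq_sym; apply/eqP.
  by rewrite lt_neqAle ut' andbT; apply/eqP.
have hasP f v : has_integral Dt f v -> has_integral Dt (fun u => P (f u)) (P v).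
  exact: (has_integral_map mDt lP Pc).
have hasQ f v : has_integral Ds f v -> has_integral Dt (fun u => \1_Ds u *: Q (f u)) (Q v).
  by move=> h; apply: has_integral_extend => //; exact: (has_integral_map mDs lQ Qc h).
have int1 := has_integralB mDt (hasP _ _ (bochner_has_integral mDt i1t))
  (hasQ _ _ (bochner_has_integral mDs i1s)).
have int2 := has_integralB mDt (hasP _ _ (bochner_has_integral mDt i2t))
  (hasQ _ _ (bochner_has_integral mDs i2s)).
have := has_integralD mDt int1 int2.
have -> : P (bochner Dt (dly t)) - Q (bochner Ds (dly s)) +
    (P (bochner Dt (W t)) - Q (bochner Ds (W s))) =
    P (G t x - T t x) - Q (G s x - T s x).
  have VE b c d : b + c + d - b = c + d :> X by rewrite -[b + c + d]addrA [b + _]addrC addrK.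
  rewrite Gt Gs; move: (bochner _ _) (bochner _ _) (bochner _ _) (bochner _ _) => d1 d2 d3 d4.
  by rewrite (VE (T t x)) (VE (T s x)) PD QD opprD addrACA.
move=> int; apply: (has_integral_norm_le mDt int).
- apply/measurable_EFinP; apply: measurable_funTS; apply: measurable_funM => //.
  apply: measurable_funD => //; apply: measurable_funM => //; exact: measurable_kern.
- by move=> u _; rewrite lee_fin mulr_ge0// addr_ge0// !mulr_ge0// kern_ge0.
pose G2 := g2 \_ Dt.
have g2t u : Dt u -> (`|A2 (G u x)|%:E <= g2 u)%E.
  by rewrite DtE => /andP[u0 ut]; apply: A2g2 => //; exact: le_trans ttau.
have G20 u : (0 <= G2 u)%E.
  rewrite /G2 patchE; case: ifPn => // /[!inE] Du.
  by apply: le_trans (g2t u Du); rewrite lee_fin.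
have Dttau : Dt `<=` `[0, tau]%classic.
  by move=> u; rewrite DtE /= in_itv/= => /andP[-> ut]; exact: le_trans ttau.
have mG2 : measurable_fun [set: R] G2.
  by apply/(measurable_restrictT g2 mDt); apply: measurable_funS mg2.
have mG2u u : measurable_fun [set: R] (fun th => G2 (th + u)).
  by apply: (measurableT_comp mG2); exact: measurable_funD.
have iG2 u : (\int[mu]_th G2 (th + u)%R <= K%:E)%E.
  rewrite integral_shift// /G2 -integral_mkcond; apply: le_trans g2K.
  apply: ge0_integral_subset => // w; rewrite /= in_itv/= => /andP[w0 wt].
  by apply: le_trans (A2g2 w w0 wt); rewrite lee_fin.
have small2 u : Dt u -> (forall y, `|L u y| <= k u * `|y|) ->
    bochner_integrable I (dst t u) -> (u \in `[0, s] -> bochner_integrable I (dst s u)) ->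
    `|P (W t u) - \1_Ds u *: Q (W s u)| <= k u * (M * K).
  move=> Du Lu it is_.
  have hasL : has_integral I (fun th => a th *: L u (A2 (G (u + th) x)))
      (P (W t u) - \1_Ds u *: Q (W s u)).
    have hP := has_integral_map mI lP Pc (bochner_has_integral mI it).
    have [uDs|uDs] := boolP (u \in Ds).
      have us : u \in `[0, s] by move: uDs; rewrite inE DsE in_itv.
      have hQ := has_integral_map mI lQ Qc (bochner_has_integral mI (is_ us)).
      have := has_integralB mI hP (has_integralZ (\1_Ds u) mI hQ).
      apply: eq_has_integral => // th _.
      by rewrite /L /dst PZ QZ scalerBr !scalerA [_ * a th]mulrC.
    rewrite indicE (negbTE uDs) scale0r subr0; move: hP.
    apply: eq_has_integral => // th _.
    by rewrite /L /dst PZ indicE (negbTE uDs) scale0r subr0.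
  rewrite -lee_fin; apply: (@le_trans _ _
      (\int[mu]_(th in I) ((M * k u)%:E * G2 (th + u)%R))%E); last first.
    apply: (@le_trans _ _ (\int[mu]_th ((M * k u)%:E * G2 (th + u)%R))%E).
      apply: ge0_integral_subset => // th _.
      by rewrite mule_ge0// lee_fin mulr_ge0.
    have Mk0 : 0 <= M * k u by rewrite mulr_ge0.
    rewrite (ge0_integralZl_EFin mu measurableT (fun th _ => G20 (th + u)) (mG2u u) Mk0).
    apply: le_trans (lee_wpmul2l _ (iG2 u)) _.
      by rewrite lee_fin mulr_ge0.
    by rewrite -EFinM lee_fin [k u * _]mulrA [k u * M]mulrC.
  apply: (has_integral_norm_le mI hasL (g := fun th => ((M * k u)%:E * G2 (th + u)%R)%E)).
  - by apply: measurable_funTS; exact: measurable_funeM.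
  - by move=> th _; rewrite mule_ge0// lee_fin mulr_ge0.
  - apply: filterS aM => th ath; rewrite /I /= in_itv/= => /andP[th1 th2].
    have {}ath := ath th1 th2.
    have [w0|w0] := ltP (u + th) 0.
      rewrite G_neg// (linear_operator0 linA2); have := Lu 0; rewrite normr0 mulr0 normr_le0 => /eqP ->.
      by rewrite scaler0 normr0 mule_ge0// lee_fin mulr_ge0.
    have Dw : Dt (u + th).
      move: Du; rewrite !DtE w0 => /andP[_ ut] /=.
      by apply: le_trans ut; rewrite gerDl.
    rewrite [th + u]addrC /G2 patchE (mem_set Dw).
    apply: (@le_trans _ _ ((M * k u)%:E * `|A2 (G (u + th) x)|%:E)%E).
      rewrite -EFinM lee_fin normrZ -mulrA; apply: ler_pM => //; exact: Lu.
    by apply: lee_wpmul2l; [rewrite lee_fin mulr_ge0|exact: g2t].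
have ae1 : {ae mu, forall u, (Dt u -> forall y, `|L u y| <= k u * `|y|) /\ u <> 0}.
  by apply: filterS2 Lbound (ae_neq 0).
have ae2 : {ae mu, forall u, u \in `[0, t] -> bochner_integrable I (dst t u) /\
    (u \in `[0, s] -> bochner_integrable I (dst s u))}.
  by apply: filterS2 aet aes => u iu ju ut; split => //; exact: iu.
apply: filterS3 ae1 ae2 A1h1 => u [Lu un0] itu A1u Du.
have := Du; rewrite DtE => /andP[u0 ut].
have up : 0 < u by rewrite lt_neqAle u0 andbT eq_sym; apply/eqP.
rewrite (kernE _ up) oppr0 powRr0 mulr1 lee_fin mulrDr.
apply: le_trans (ler_normD _ _) _; apply: lerD.
  apply: le_trans (Lu Du _) _; apply: ler_wpM2l => //.
  by apply: A1u => //; exact: le_trans ttau.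
have [iu ju] : bochner_integrable I (dst t u) /\
    (u \in `[0, s] -> bochner_integrable I (dst s u)).
  by apply: itu; rewrite in_itv/= u0.
by apply: small2 => //; exact: Lu.
Qed.

End VariationOfConstants.

(** * Fractional regularity under forcing *)

Section FractionalRegularity.
Context {R : realType} {X : completeNormedModType R}.
Local Notation mu := (@lebesgue_measure R).
Variables (A : operator X) (T : R -> X -> X) (M omega : R).
Hypotheses (C0T : C0_semigroup T) (genT : is_generator A T).
Hypotheses (M1 : 1 <= M) (omega0 : 0 < omega).
Hypothesis stableT : forall t, 0 < t ->
  (opnorm (T t) <= (M * expR (- omega * t))%:E)%E /\ comp_norm_le A (T t) (M / t).
Variables (g Mg : R).
Hypotheses (g01 : 0 < g < 1) (Mg0 : 0 < Mg).
Hypothesis fracT : forall t, 0 < t -> comp_norm_le (frac_power T g) (T t) (Mg / t `^ g).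

Local Notation S := (smooth_power T g).
Local Notation P := (frac_power T g).
Let g0 : 0 < g. Proof. by case/andP: g01. Qed.
Let Sbound := smooth_power_bound C0T M1 omega0 stableT g01 fracT.
Let SD := smooth_powerD C0T M1 omega0 stableT g01 fracT.
Let SB := smooth_powerB C0T M1 omega0 stableT g01 fracT.

Let bounded_S e : 0 < e -> bounded_linear (S e).
Proof.
move=> e0; apply: (@bounded_linear_intro _ _ _ (Mg * kern g e)) => [|y]; last exact: Sbound.
exact (smooth_power_linear C0T M1 omega0 stableT g01 fracT e0).
Qed.

Let bounded0 : bounded_linear (fun=> 0 : X).
Proof.
apply: (@bounded_linear_intro _ _ _ 0) => [b y z|y]; first by rewrite scaler0 addr0.
by rewrite normr0 mul0r.
Qed.

Let bounded_SB e e' : 0 < e -> 0 < e' -> bounded_linear (fun y => S e y - S e' y).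
Proof.
move=> e0 e'0; apply: (@bounded_linear_intro _ _ _ (Mg * kern g e + Mg * kern g e')).
  move=> b y z /=.
  rewrite !(smooth_power_linear C0T M1 omega0 stableT g01 fracT)//.
  by rewrite scalerBr opprD addrACA.
by move=> y; rewrite mulrDl; apply: le_trans (ler_normB _ _) _; apply: lerD; exact: Sbound.
Qed.

(** The regularization criterion turns the bounds on [S e (G t x - T t x)],
    uniform in [e], into membership in the domain of the closed operator. *)
Lemma frac_power_regularity (G : R -> X -> X) (x : X) (tau : R) (H : R -> R) t b K :
  forcing_bound T G x tau H ->
  measurable_fun [set: R] H -> (forall u, 0 <= H u) ->
  0 < t -> t <= tau -> 0 < b <= 1 ->
  (\int[mu]_(u in `[0%R, t]) (kern (g + b) (t - u) * H u)%:E < +oo)%E ->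
  (\int[mu]_(u in `[0%R, t]) (kern g (t - u) * H u)%:E <= K%:E)%E ->
  opdom P (G t x) /\ `|P (G t x)| <= Mg * (kern g t * `|x| + K).
Proof.
move=> forced mH H0 t0 ttau /andP[b0 b1] fin hK.
have kH0 a u : (0 <= (kern a (t - u) * H u)%:E)%E by rewrite lee_fin mulr_ge0 ?kern_ge0.
have mkH a : measurable_fun `[0, t] (fun u => (kern a (t - u) * H u)%:E).
  apply/measurable_EFinP; apply: measurable_funTS; apply: measurable_funM => //.
  exact: measurable_kern_reflect.
have mI : measurable `[0, t]%classic by exact: measurable_itv.
have int_le (L : X -> X) c a K' : 0 <= c -> 0 <= a -> bounded_linear L ->
    (forall w z, 0 < w -> `|L (T w z)| <= c * kern a w * `|z|) ->
    (\int[mu]_(u in `[0%R, t]) (kern a (t - u) * H u)%:E <= K'%:E)%E ->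
    `|L (G t x - T t x)| <= c * K'.
  move=> c0 a0 bL hL hK'; rewrite -lee_fin.
  have := @forced 0 t L (fun=> 0) (fun u => c * kern a (t - u)) (lexx 0) (ltW t0) ttau
    bL bounded0.
  rewrite subr0 => h; apply: le_trans (h _ _ _ _) _.
  - by apply: measurable_funM => //; exact: measurable_kern_reflect.
  - by move=> u; rewrite mulr_ge0 ?kern_ge0.
  - by move=> u y u0 /(le_lt_trans u0); rewrite ltxx.
  - by move=> u y u0 ut; apply: hL; rewrite subr_gt0.
  rewrite (_ : (\int[mu]_(u in _) _ = c%:E *
      \int[mu]_(u in `[0%R, t]) (kern a (t - u) * H u)%:E)%E); last first.
    rewrite -(ge0_integralZl_EFin mu mI (fun u _ => kH0 a u) (mkH a) c0).
    by apply: eq_integral => u _; rewrite -EFinM mulrA.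
  by rewrite EFinM; apply: lee_wpmul2l.
have ST e z w : 0 < e -> 0 <= w -> S e (T w z) = S (e + w) z by move=> e0 w0; rewrite SD.
apply: (frac_power_regularized C0T M1 omega0 stableT g01 fracT).
  move=> e e0; have -> : S e (G t x) = S e (T t x) + S e (G t x - T t x).
    by rewrite SB// addrC subrK.
  rewrite mulrDr mulrA; apply: le_trans (ler_normD _ _) _; apply: lerD.
    rewrite ST ?(ltW t0)//; apply: le_trans (Sbound _ _) _; first by rewrite addr_gt0.
    apply: ler_wpM2r => //; rewrite ler_pM2l//.
    by apply: kern_le; rewrite ?(ltW g0)// lerDr ltW.
  apply: (int_le _ _ g) => //; [exact: ltW|exact: ltW|exact: bounded_S|].
  move=> w z w0; rewrite ST ?(ltW w0)//.
  apply: le_trans (Sbound _ _) _; first by rewrite addr_gt0.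
  apply: ler_wpM2r => //; rewrite ler_pM2l//.
  by apply: kern_le; rewrite ?(ltW g0)// lerDr ltW.
move=> eta eta0.
have b01 : 0 <= b <= 1 by rewrite (ltW b0).
have gb0 : 0 <= g + b by rewrite addr_ge0// ltW.
have [C C0 hC] := smooth_power_holder C0T genT M1 omega0 stableT g01 Mg0 fracT b01.
pose J := fine (\int[mu]_(u in `[0%R, t]) (kern (g + b) (t - u) * H u)%:E)%E.
have Jint0 : (0 <= \int[mu]_(u in `[0%R, t]) (kern (g + b) (t - u) * H u)%:E)%E.
  by apply: integral_ge0.
have JE : (\int[mu]_(u in `[0%R, t]) (kern (g + b) (t - u) * H u)%:E <= J%:E)%E.
  by rewrite fineK// ge0_fin_numE.
have J0 : 0 <= J by exact: fine_ge0.
pose K' := C * (kern (g + b) t * `|x| + J).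
have K'0 : 0 <= K' by rewrite mulr_ge0// addr_ge0// mulr_ge0// kern_ge0.
have q0 : 0 < eta / (K' + 1) by rewrite divr_gt0// ltr_wpDl.
pose d := (eta / (K' + 1)) `^ b^-1.
have d0 : 0 < d by exact: powR_gt0.
have db : d `^ b = eta / (K' + 1).
  by rewrite /d -powRrM mulVf ?gt_eqF// powRr1// ltW.
exists d => //.
have main e e' : 0 < e -> e < d -> 0 < e' -> e' <= e ->
    `|S e (G t x) - S e' (G t x)| <= eta.
  move=> e0 ed e'0 e'e.
  have diffT w z : 0 < w -> `|S e (T w z) - S e' (T w z)| <= C * d `^ b * kern (g + b) w * `|z|.
    move=> w0; rewrite !ST ?(ltW w0)//.
    apply: le_trans (hC (e' + w) (e + w) z _ _) _; [by rewrite addr_gt0|by rewrite lerD2r|].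
    apply: ler_wpM2r => //; rewrite -mulrA; apply: ler_wpM2l => //.
    apply: ler_pM; rewrite ?powR_ge0 ?kern_ge0//.
      have -> : e + w - (e' + w) = e - e' by ring.
      apply: ge0_ler_powR; rewrite ?nnegrE ?subr_ge0 ?(ltW b0) ?(ltW d0)//.
      by apply: le_trans (ltW ed); rewrite gerBl ltW.
    by apply: kern_le => //; rewrite lerDr ltW.
  have Cd0 : 0 <= C * d `^ b by rewrite mulr_ge0 ?powR_ge0.
  have h1 := int_le _ _ _ _ Cd0 gb0 (bounded_SB e0 e'0) diffT JE.
  have h2 := diffT t x t0.
  rewrite !SB// in h1.
  have -> : S e (G t x) - S e' (G t x) = (S e (T t x) - S e' (T t x)) +
      (S e (G t x) - S e (T t x) - (S e' (G t x) - S e' (T t x))).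
    have swap (a1 a2 a3 a4 : X) : a1 - a3 - (a2 - a4) = a1 - a2 - (a3 - a4).
      by rewrite opprD addrACA -opprD.
    by rewrite swap [RHS]addrC subrK.
  apply: le_trans (ler_normD _ _) _; apply: le_trans (lerD h2 h1) _.
  have -> : C * d `^ b * kern (g + b) t * `|x| + C * d `^ b * J = d `^ b * K'.
    by rewrite /K'; ring.
  rewrite db mulrAC ler_pdivrMr ?ltr_wpDl//.
  by rewrite ler_pM2l// lerDl.
move=> e e' e0 ed e'0 e'd; have [ee|ee] := leP e' e; first exact: main.
by rewrite distrC; apply: main => //; exact: ltW.
Qed.

(** The forcing before [s] is met by the difference of two regularized powers,
    and the forcing between [s] and [t] by a power of the length of that interval,
    gained from a stronger singularity. *)
Lemma frac_power_holder b : 0 <= b <= 1 -> exists2 C, 0 <= C &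
  forall (G : R -> X -> X) (x : X) (tau : R) (H : R -> R),
    forcing_bound T G x tau H ->
    measurable_fun [set: R] H -> (forall u, 0 <= H u) ->
    forall s t K, 0 < s -> s <= t -> t <= tau ->
    opdom P (G s x) -> opdom P (G t x) ->
    (\int[mu]_(u in `[0%R, t])
       ((kern (g + b) (s - u) + kern (g + b) (t - u)) * H u)%:E <= K%:E)%E ->
    `|P (G t x - G s x)| <= C * (t - s) `^ b * (kern (g + b) s * `|x| + K).
Proof.
move=> b01; have /andP[b0 _] := b01.
have gb0 : 0 <= g + b by rewrite addr_ge0// ltW.
have [C C0 hC] := smooth_power_holder C0T genT M1 omega0 stableT g01 Mg0 fracT b01.
exists (C + Mg); first by rewrite addr_ge0// ltW.
move=> G x tau H forced mH H0 s t K s0 st ttau Ps Pt hK.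
have t0 : 0 < t by exact: lt_le_trans st.
have [Pts PE] := frac_powerB C0T M1 omega0 stableT g01 fracT Pt Ps.
apply: (frac_power_norm_le C0T M1 omega0 stableT g01 fracT) => // e e0.
have ST z w : 0 <= w -> S e (T w z) = S (e + w) z by move=> w0; rewrite SD.
have D0 : 0 <= (t - s) `^ b by exact: powR_ge0.
have CM0 : 0 <= C + Mg by rewrite addr_ge0// ltW.
have CD0 : 0 <= (C + Mg) * (t - s) `^ b by rewrite mulr_ge0.
have diffT u z : u < s ->
    `|S e (T (t - u) z) - S e (T (s - u) z)| <= C * (t - s) `^ b * kern (g + b) (s - u) * `|z|.
  move=> us; have su : 0 < s - u by rewrite subr_gt0.
  have tu : 0 < t - u by rewrite subr_gt0 (lt_le_trans us).
  rewrite !ST ?(ltW su) ?(ltW tu)//.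
  apply: le_trans (hC (e + (s - u)) (e + (t - u)) z _ _) _.
  - by rewrite addr_gt0.
  - by rewrite lerD2l lerD2r.
  have -> : e + (t - u) - (e + (s - u)) = t - s by ring.
  apply: ler_wpM2r => //; rewrite -mulrA; apply: ler_wpM2l => //.
  by apply: ler_wpM2l => //; apply: kern_le => //; rewrite lerDr ltW.
pose k u := (C + Mg) * (t - s) `^ b * (kern (g + b) (s - u) + kern (g + b) (t - u)).
have h1 : `|S e (G t x - T t x) - S e (G s x - T s x)| <= (C + Mg) * (t - s) `^ b * K.
  rewrite -lee_fin.
  have := @forced s t (S e) (S e) k (ltW s0) st ttau (bounded_S e0) (bounded_S e0).
  move=> h; apply: le_trans (h _ _ _ _) _.
  - apply: measurable_funM => //; apply: measurable_funD; exact: measurable_kern_reflect.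
  - by move=> u; rewrite mulr_ge0// addr_ge0// kern_ge0.
  - move=> u y _ us; apply: le_trans (diffT u y us) _; apply: ler_wpM2r => //.
    rewrite /k -!mulrA; apply: ler_pM => //; first by rewrite mulr_ge0 ?kern_ge0.
      by rewrite lerDl ltW.
    by apply: ler_wpM2l => //; rewrite lerDl kern_ge0.
  - move=> u y su ut; have tu : 0 < t - u by rewrite subr_gt0.
    rewrite ST ?(ltW tu)//; apply: le_trans (Sbound _ _) _; first by rewrite addr_gt0.
    apply: ler_wpM2r => //; rewrite /k -mulrA.
    apply: ler_pM; rewrite ?kern_ge0 ?(ltW Mg0)//; first by rewrite lerDr.
    apply: (@le_trans _ _ (kern g (t - u))); first by apply: kern_le; rewrite ?(ltW g0)// lerDr ltW.
    apply: (@le_trans _ _ ((t - s) `^ b * kern (g + b) (t - u))).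
      by apply: kern_exp_le => //; rewrite lerD2l lerN2 ltW.
    by apply: ler_wpM2l => //; rewrite lerDr kern_ge0.
  have mI : measurable `[0, t]%classic by exact: measurable_itv.
  rewrite (_ : (\int[mu]_(u in _) _ = ((C + Mg) * (t - s) `^ b)%:E * \int[mu]_(u in `[0%R, t])
       ((kern (g + b) (s - u) + kern (g + b) (t - u)) * H u)%:E)%E); last first.
    rewrite -(ge0_integralZl_EFin mu mI _ _ CD0).
    - by apply: eq_integral => u _; rewrite -EFinM mulrA.
    - by move=> u _; rewrite lee_fin mulr_ge0// addr_ge0// kern_ge0.
    - apply/measurable_EFinP; apply: measurable_funTS; apply: measurable_funM => //.
      apply: measurable_funD; exact: measurable_kern_reflect.
  by rewrite [leRHS]EFinM; apply: lee_wpmul2l.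
have h2 := diffT 0 x s0; rewrite !subr0 in h2.
have -> : S e (G t x - G s x) = (S e (T t x) - S e (T s x)) +
    (S e (G t x - T t x) - S e (G s x - T s x)).
  have swap (a1 a2 a3 a4 : X) : a1 - a3 - (a2 - a4) = a1 - a2 - (a3 - a4).
    by rewrite opprD addrACA -opprD.
  by rewrite !SB// swap [RHS]addrC subrK.
apply: le_trans (ler_normD _ _) _; rewrite mulrDr; apply: lerD h1.
apply: le_trans h2 _; rewrite -!mulrA; apply: ler_wpM2r; last by rewrite lerDl ltW.
by rewrite !mulr_ge0 ?kern_ge0.
Qed.

End FractionalRegularity.

(** * Induction over the delay stages *)

Section ForcingWeights.
Context {R : realType} {X : completeNormedModType R}.
Local Notation mu := (@lebesgue_measure R).
Implicit Types (T G : R -> X -> X) (x : X) (H : R -> R).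

Lemma forcing_bound_le T G x tau H H' : (forall u, 0 <= H u <= H' u) ->
  forcing_bound T G x tau H -> forcing_bound T G x tau H'.
Proof.
move=> HH h s t P Q k s0 st tt bP bQ mk k0 hst ht.
apply: le_trans (h s t P Q k s0 st tt bP bQ mk k0 hst ht) _.
apply: ge0_integral_le_gen => // u _; have /andP[H0 HH'] := HH u.
  by rewrite !lee_fin mulr_ge0//= ler_wpM2l.
by rewrite lee_fin mulr_ge0// (le_trans H0).
Qed.

Lemma kern_le_sum (r a : R) n t : kern a t <= kern_sum r a n.+1 t.
Proof.
rewrite /kern_sum big_ord_recl mul0r subr0 lerDl sumr_ge0// => k _; exact: kern_ge0.
Qed.

Lemma kern_weight_integral_le (r a m : R) n : 0 < r -> 0 <= a < 1 -> 0 <= m < 1 ->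
  exists2 C, 0 <= C & forall H c t, 0 <= c -> (forall u, 0 <= H u <= c * weight r m n u) ->
    t <= n.+1%:R * r -> forall E : set R,
    (\int[mu]_(u in E) (kern a (t - u) * H u)%:E <= (c * C * kern_sum r a n.+1 t)%:E)%E.
Proof.
move=> r0 a01 m01; have [C C0 hC] := kern_weight_conv n r0 a01 m01.
exists C => // H c t c0 Hc tn E.
apply: (@le_trans _ _ (\int[mu]_u (c%:E * (kern a (t - u) * weight r m n u)%:E))%E).
  apply: ge0_integral_le_gen => // u _; have /andP[H0 HH'] := Hc u.
    rewrite -EFinM !lee_fin mulr_ge0 ?kern_ge0//= mulrCA.
    by apply: ler_wpM2l => //; exact: kern_ge0.
  by rewrite -EFinM lee_fin !mulr_ge0 ?kern_ge0 ?weight_ge0.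
have w0 u : setT u -> (0 <= (kern a (t - u) * weight r m n u)%:E)%E.
  by rewrite lee_fin mulr_ge0 ?kern_ge0 ?weight_ge0.
have mw : measurable_fun [set: R] (fun u => (kern a (t - u) * weight r m n u)%:E).
  apply/measurable_EFinP; apply: measurable_funM; first exact: measurable_kern_reflect.
  exact: measurable_weight.
rewrite (ge0_integralZl_EFin mu measurableT w0 mw c0) -mulrA EFinM.
by apply: lee_wpmul2l => //; exact: hC.
Qed.

End ForcingWeights.

Section Stages.
Context {R : realType} {X : completeNormedModType R}.
Local Notation mu := (@lebesgue_measure R).
Variables (A A1 A2 : operator X) (T G : R -> X -> X) (r : R) (a : R -> R).
Variables (M omega Ma m1 m2 : R).
Hypotheses (r0 : 0 < r) (C0T : C0_semigroup T) (genT : is_generator A T).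
Hypotheses (M1 : 1 <= M) (omega0 : 0 < omega).
Hypothesis stableT : forall t, 0 < t ->
  (opnorm (T t) <= (M * expR (- omega * t))%:E)%E /\ comp_norm_le A (T t) (M / t).
Hypothesis fracT : forall g, 0 < g < 1 -> exists2 Mg, 0 < Mg &
  forall t, 0 < t -> comp_norm_le (frac_power T g) (T t) (Mg / t `^ g).
Hypotheses (linA1 : linear_operator A1) (closedA1 : closed_operator A1).
Hypotheses (linA2 : linear_operator A2) (closedA2 : closed_operator A2).
Hypotheses (Ma0 : 0 <= Ma)
  (aM : {ae mu, forall th, - r <= th -> th <= 0 -> `|a th| <= Ma}).
Hypothesis fsG : fundamental_solution T r A1 A2 a G.
Hypotheses (m101 : 0 < m1 < 1) (m201 : 0 < m2 < 1).
Hypotheses (domA1 : opdom (frac_power T m1) `<=` opdom A1).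
Hypotheses (domA2 : opdom (frac_power T m2) `<=` opdom A2).

Let tau n : R := n.+1%:R * r.
Let tau0 n : 0 < tau n. Proof. by rewrite mulr_gt0// ltr0n. Qed.
Let le01 (g : R) : 0 < g < 1 -> 0 <= g < 1.
Proof. by move=> /andP[/ltW -> ->]. Qed.

(** Up to time [(n + 1) r] the forcing is as singular as [A1 G] was one delay
    earlier, uniformly in the initial value. *)
Definition forcing_weighted n := exists2 D, 0 <= D &
  forall x, forcing_bound T G x (tau n) (fun u => D * `|x| * weight r m1 n u).

Lemma weighted_regularity n g : 0 < g < 1 -> forcing_weighted n ->
  exists2 C, 0 <= C & forall x t, 0 < t -> t <= tau n ->
    opdom (frac_power T g) (G t x) /\
    `|frac_power T g (G t x)| <= C * kern_sum r g n.+1 t * `|x|.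
Proof.
move=> g01 [D D0 hD]; have [Mg Mg0 fracg] := fracT g01.
have [g0 g1] := andP g01.
have [C C0 hC] := kern_weight_integral_le n r0 (le01 g01) (le01 m101).
pose b := (1 - g) / 2.
have gb01 : 0 <= g + b < 1 by apply/andP; split; rewrite /b; lra.
have b01 : 0 < b <= 1 by apply/andP; split; rewrite /b; lra.
have [C' C'0 hC'] := kern_weight_integral_le n r0 gb01 (le01 m101).
exists (Mg * (1 + D * C)); first by rewrite mulr_ge0 ?addr_ge0 ?mulr_ge0// ltW.
move=> x t t0 tt.
have Dx0 : 0 <= D * `|x| by rewrite mulr_ge0.
have H0 u : 0 <= D * `|x| * weight r m1 n u by rewrite mulr_ge0// weight_ge0.
have HH u : 0 <= D * `|x| * weight r m1 n u <= D * `|x| * weight r m1 n u.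
  by rewrite H0 lexx.
have mH : measurable_fun [set: R] (fun u => D * `|x| * weight r m1 n u).
  by apply: measurable_funM => //; exact: measurable_weight.
have [dom bnd] := frac_power_regularity C0T genT M1 omega0 stableT g01 Mg0 fracg
  (hD x) mH H0 t0 tt b01 (le_lt_trans (hC' _ _ t Dx0 HH tt _) (ltry _))
  (hC _ _ t Dx0 HH tt _).
split => //; apply: le_trans bnd _; rewrite -!mulrA ler_pM2l//.
rewrite mulrDl mul1r; apply: lerD.
  by apply: ler_wpM2r => //; exact: kern_le_sum.
rewrite le_eqVlt; apply/orP; left; apply/eqP; ring.
Qed.

Lemma weighted_A1 n : forcing_weighted n ->
  exists2 C, 0 <= C & forall x w, 0 < w -> w <= tau n ->
    `|A1 (G w x)| <= C * kern_sum r m1 n.+1 w * `|x|.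
Proof.
move=> hn; have [C C0 hC] := weighted_regularity m101 hn.
have [Mg Mg0 fracg] := fracT m101.
have [c c0 hc] := relative_bound C0T M1 omega0 stableT m101 fracg linA1 closedA1 domA1.
exists (c * C); first exact: mulr_ge0.
move=> x w w0 ww; have [dom bnd] := hC x w w0 ww.
by apply: le_trans (hc _ dom) _; rewrite -!mulrA ler_wpM2l// mulrA.
Qed.

(** The bound on [A1 G] one delay earlier and Gronwall's inequality for
    [t |-> |A2 G t x|] give the forcing bound. *)
Lemma forcing_weighted_step n C1 : 0 <= C1 ->
  (forall x w, 0 < w -> w <= n%:R * r -> `|A1 (G w x)| <= C1 * kern_sum r m1 n w * `|x|) ->
  forcing_weighted n.
Proof.
move=> C10 hC1.
have [Mg Mg0 fracg] := fracT m201.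
have [c2 c20 hc2] := relative_bound C0T M1 omega0 stableT m201 fracg linA2 closedA2 domA2.
have /andP[m20 m21] := m201.
have [Cw Cw0 hCw] := kern_weight_integral_le n r0 (le01 m201) (le01 m101).
pose b := (1 - m2) / 2.
have gb01 : 0 <= m2 + b < 1 by apply/andP; split; rewrite /b; lra.
have b01 : 0 < b <= 1 by apply/andP; split; rewrite /b; lra.
have [C' C'0 hC'] := kern_weight_integral_le n r0 gb01 (le01 m101).
pose B := beta_kernel m2 0 * tau n `^ (1 - m2).
have B0 : 0 <= B by rewrite mulr_ge0 ?beta_kernel_ge0 ?powR_ge0.
have o01 : 0 <= (0 : R) < 1 by rewrite lexx ltr01.
have conv0 t : t <= tau n -> (\int[mu]_u (kern m2 (t - u) * kern 0 u)%:E <= B%:E)%E.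
  move=> tt.
  have -> : (\int[mu]_u (kern m2 (t - u) * kern 0 u)%:E =
             \int[mu]_u (kern m2 (t - u) * kern 0 (u - 0))%:E)%E.
    by apply: eq_integral => u _; rewrite subr0.
  rewrite (kern_conv t 0 (le01 m201) o01) lee_fin; apply: ler_wpM2l; first exact: beta_kernel_ge0.
  rewrite subr0 addr0; have [tn|t0] := leP t 0; first by rewrite kern_le0// powR_ge0.
  rewrite kernE// opprB; apply: ge0_ler_powR => //; rewrite ?nnegrE ?subr_ge0 ?(ltW m21)//.
  - exact: ltW.
  - exact: ltW.
(* chosen so that the norm of [A2 (G t x)] is at most [alpha t] times that of
   [x] plus [beta] times the integral of its past *)
pose alpha t := c2 * Mg * (1 + C1 * Cw) * kern_sum r m2 n.+1 t.
pose beta := c2 * Mg * Ma * B.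
have cM0 : 0 <= c2 * Mg by rewrite mulr_ge0// ltW.
have acst0 : 0 <= c2 * Mg * (1 + C1 * Cw) by rewrite mulr_ge0// addr_ge0// mulr_ge0.
have beta0 : 0 <= beta by rewrite /beta -mulrA mulr_ge0// mulr_ge0.
have malpha : measurable_fun [set: R] alpha.
  by apply: measurable_funM => //; exact: measurable_kern_sum.
have alpha0 t : 0 <= alpha t by rewrite mulr_ge0// kern_sum_ge0.
have mI t : measurable (`[0, t]%classic : set R) by exact: measurable_itv.
have alphafin : (\int[mu]_(t in `[0%R, tau n]) (alpha t)%:E < +oo)%E.
  have -> : (\int[mu]_(t in `[0%R, tau n]) (alpha t)%:E = (c2 * Mg * (1 + C1 * Cw))%:E *
      \int[mu]_(t in `[0%R, tau n]) (kern_sum r m2 n.+1 t)%:E)%E.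
    rewrite -(ge0_integralZl_EFin mu (mI _) _ _ acst0)//.
    - by move=> u _; rewrite lee_fin kern_sum_ge0.
    - by apply/measurable_EFinP; apply: measurable_funTS; exact: measurable_kern_sum.
  apply: lte_mul_pinfty => //; exact: kern_sum_integral_lty r0 (le01 m201).
have [CG CG0 gronwall] := gronwall_integral (tau0 n) beta0 malpha alpha0 alphafin.
exists (C1 + Ma * CG) => [|x]; first by rewrite addr_ge0 ?mulr_ge0.
pose h1 u := C1 * `|x| * kern_sum r m1 n (u - r).
have h10 u : 0 <= h1 u by rewrite !mulr_ge0 ?kern_sum_ge0.
have mh1 : measurable_fun [set: R] h1.
  apply: measurable_funM => //; apply: (measurableT_comp (measurable_kern_sum r m1 n)).
  exact: measurable_funB.
have A1h1 : {ae mu, forall u, 0 <= u -> u <= tau n -> `|A1 (G (u - r) x)| <= h1 u}.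
  apply: filterS (ae_neq r) => u ur _ ut.
  have [lt_ur|le_ru] := ltP u r.
    by rewrite (fs_neg fsG) ?subr_lt0//= (linear_operator0 linA1) normr0.
  rewrite /h1 mulrAC; apply: hC1.
    by rewrite subr_gt0 lt_neqAle le_ru andbT eq_sym; apply/eqP.
  by move: ut; rewrite /tau -natr1 mulrDl mul1r lerBlDr.
have [g2 [mg2 A2g2 g2E g2fin]] :=
  bochner_norm_majorant (mI (tau n)) (fs_integrable fsG x (ltW (tau0 n))).2.
have A2g2' u : 0 <= u -> u <= tau n -> (`|A2 (G u x)|%:E <= g2 u)%E.
  by move=> u0 ut; apply: A2g2; rewrite /= in_itv/= u0.
have g20 u : `[0, tau n]%classic u -> (0 <= g2 u)%E.
  by move=> /A2g2; apply: le_trans; rewrite lee_fin.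
have sub t : t <= tau n -> `[0, t]%classic `<=` `[0, tau n]%classic.
  by move=> tt u /=; rewrite !in_itv/= => /andP[-> us]; exact: le_trans tt.
have split_bound t K : t <= tau n -> (\int[mu]_(u in `[0%R, t]) g2 u <= K%:E)%E -> 0 <= K ->
    forcing_bound T G x t (fun u => h1 u + Ma * K * kern 0 u).
  move=> tt hK K0; apply: (forcing_bound_split fsG linA2 mh1 h10 _ _ _ hK K0 Ma0 aM).
  - by apply: filterS A1h1 => u h u0 ut; apply: h => //; exact: le_trans tt.
  - by apply: measurable_funS mg2 => //; exact: sub.
  - by move=> u u0 ut; apply: A2g2' => //; exact: le_trans tt.
have weight_le K c u : 0 <= K -> C1 * `|x| <= c -> Ma * K <= c ->
    0 <= h1 u + Ma * K * kern 0 u <= c * weight r m1 n u.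
  move=> K0 hc hc'; rewrite addr_ge0 ?mulr_ge0 ?kern_sum_ge0 ?kern_ge0//=.
  rewrite /weight mulrDr; apply: lerD; apply: ler_wpM2r => //.
  - exact: kern_sum_ge0.
  - exact: kern_ge0.
have g2le : {ae mu, forall t, `[0, tau n]%classic t ->
    (g2 t <= (alpha t * `|x|)%:E + beta%:E * \int[mu]_(u in `[0%R, t]) g2 u)%E}.
  apply: filterS2 g2E (ae_neq 0) => t g2t tn0 It; have := It.
  rewrite /= in_itv/= => /andP[t0 tt].
  have {tn0}tp : 0 < t by rewrite lt_neqAle t0 andbT eq_sym; apply/eqP.
  have I0 : (0 <= \int[mu]_(u in `[0%R, t]) g2 u)%E.
    by apply: integral_ge0 => v Iv; apply: g20; exact: (sub _ tt).
  have Ifin : (\int[mu]_(u in `[0%R, t]) g2 u < +oo)%E.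
    by apply: le_lt_trans g2fin; apply: ge0_integral_subset; [exact: (sub _ tt)|exact: g20].
  pose K := fine (\int[mu]_(u in `[0%R, t]) g2 u)%E.
  have KE : (\int[mu]_(u in `[0%R, t]) g2 u = K%:E)%E by rewrite fineK// ge0_fin_numE.
  have K0 : 0 <= K by exact: fine_ge0.
  rewrite (g2t It) KE -EFinM -EFinD lee_fin.
  have forced := split_bound t K tt (eq_ind_r (fun z => (z <= K%:E)%E) (lexx _) KE) K0.
  pose H u := h1 u + Ma * K * kern 0 u.
  have mH : measurable_fun [set: R] H.
    by apply: measurable_funD => //; apply: measurable_funM => //; exact: measurable_kern.
  have H0 u : 0 <= H u by rewrite addr_ge0 ?mulr_ge0 ?kern_sum_ge0 ?kern_ge0.
  have c0 : 0 <= C1 * `|x| + Ma * K by rewrite addr_ge0 ?mulr_ge0.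
  have Hc u : 0 <= H u <= (C1 * `|x| + Ma * K) * weight r m1 n u.
    by apply: weight_le => //; rewrite ?lerDl ?lerDr ?mulr_ge0.
  have fin := le_lt_trans (hC' _ _ t c0 Hc tt `[0, t]%classic) (ltry _).
  have bound : (\int[mu]_(u in `[0%R, t]) (kern m2 (t - u) * H u)%:E <=
      (C1 * `|x| * Cw * kern_sum r m2 n.+1 t + Ma * K * B)%:E)%E.
    have c10 : 0 <= C1 * `|x| by rewrite mulr_ge0.
    have h1c u : 0 <= h1 u <= C1 * `|x| * weight r m1 n u.
      rewrite h10 /=; have := @weight_le 0 (C1 * `|x|) u (lexx 0) (lexx _).
      by rewrite mulr0 mul0r addr0 => /(_ c10) /andP[].
    have MK0 : 0 <= Ma * K by rewrite mulr_ge0.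
    have k00 u : (0 <= (kern m2 (t - u) * kern 0 u)%:E)%E.
      by rewrite lee_fin mulr_ge0 ?kern_ge0.
    have mk0 : measurable_fun `[0, t] (fun u => (kern m2 (t - u) * kern 0 u)%:E).
      by apply: measurable_funTS; exact: measurable_kern_conv0.
    have -> : (\int[mu]_(u in `[0%R, t]) (kern m2 (t - u) * H u)%:E =
        \int[mu]_(u in `[0%R, t]) (kern m2 (t - u) * h1 u)%:E +
        (Ma * K)%:E * \int[mu]_(u in `[0%R, t]) (kern m2 (t - u) * kern 0 u)%:E)%E.
      rewrite -(ge0_integralZl_EFin mu (mI t) (fun u _ => k00 u) mk0 MK0).
      rewrite -ge0_integralD//.
      - by apply: eq_integral => u _; rewrite -EFinM -EFinD; congr EFin; rewrite /H; ring.
      - by move=> u _; rewrite lee_fin mulr_ge0 ?kern_ge0.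
      - apply/measurable_EFinP; apply: measurable_funTS; apply: measurable_funM => //.
        exact: measurable_kern_reflect.
      - by move=> u _; rewrite mule_ge0// lee_fin.
      - exact: measurable_funeM.
    rewrite EFinD; apply: leeD; first exact: (hCw _ _ t c10 h1c tt).
    rewrite [leRHS]EFinM; apply: lee_wpmul2l; first by rewrite lee_fin.
    by apply: le_trans (conv0 t tt); apply: ge0_integral_subset.
  have [dom bnd] := frac_power_regularity C0T genT M1 omega0 stableT m201 Mg0 fracg
    forced mH H0 tp (lexx t) b01 fin bound.
  apply: le_trans (hc2 _ dom) _; apply: le_trans (ler_wpM2l c20 bnd) _.
  have ks := kern_le_sum r m2 n t.
  apply: (@le_trans _ _ (c2 * (Mg * (kern_sum r m2 n.+1 t * `|x| +
      (C1 * `|x| * Cw * kern_sum r m2 n.+1 t + Ma * K * B))))).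
    by apply: ler_wpM2l => //; rewrite ler_pM2l// lerD2r; apply: ler_wpM2r.
  by rewrite le_eqVlt; apply/orP; left; apply/eqP; rewrite /alpha /beta; ring.
have hK := gronwall g2 `|x| (normr_ge0 x) mg2 g20 g2fin g2le.
have K0 : 0 <= CG * `|x| by rewrite mulr_ge0.
apply: forcing_bound_le (split_bound _ _ (lexx _) hK K0) => u.
apply: weight_le => //; rewrite mulrDl; first by rewrite lerDl !mulr_ge0.
by rewrite mulrA lerDr !mulr_ge0.
Qed.

Lemma forcing_weightedP n : forcing_weighted n.
Proof.
elim: n => [|n /weighted_A1[C C0 hC]]; last exact: forcing_weighted_step C0 hC.
apply: (@forcing_weighted_step _ 0) => // x w w0; rewrite mul0r => w1.
by have := lt_le_trans w0 w1; rewrite ltxx.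
Qed.

End Stages.

(** * Estimates on a single stage *)

Section StageEstimates.
Context {R : realType} {X : completeNormedModType R}.
Local Notation mu := (@lebesgue_measure R).
Variables (A : operator X) (T G : R -> X -> X) (r M omega m : R).
Hypotheses (r0 : 0 < r) (C0T : C0_semigroup T) (genT : is_generator A T).
Hypotheses (M1 : 1 <= M) (omega0 : 0 < omega).
Hypothesis stableT : forall t, 0 < t ->
  (opnorm (T t) <= (M * expR (- omega * t))%:E)%E /\ comp_norm_le A (T t) (M / t).
Hypothesis fracT : forall g, 0 < g < 1 -> exists2 Mg, 0 < Mg &
  forall t, 0 < t -> comp_norm_le (frac_power T g) (T t) (Mg / t `^ g).
Hypothesis m01 : 0 < m < 1.
Variables (n : nat) (g : R).
Hypothesis weightedG : forcing_weighted T G r m n.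
Hypothesis g01 : 0 < g < 1.

Local Notation P := (frac_power T g).
Let sigma : R := n%:R * r.
Let tau : R := n.+1%:R * r.
Let g0 : 0 <= g. Proof. by case/andP: g01 => /ltW. Qed.
Let sigma0 : 0 <= sigma. Proof. by rewrite mulr_ge0// ltW. Qed.
Let m01' : 0 <= m < 1. Proof. by case/andP: m01 => /ltW -> ->. Qed.
Let g01' : 0 <= g < 1. Proof. by case/andP: g01 => /ltW -> ->. Qed.

Lemma frac_power_stage_bound : exists2 C, 0 <= C & forall x t, sigma < t -> t <= tau ->
  opdom P (G t x) /\ `|P (G t x)| <= C * kern g (t - sigma) * `|x|.
Proof.
have [C C0 hC] := weighted_regularity r0 C0T genT M1 omega0 stableT fracT m01 g01 weightedG.
exists (C * n.+1%:R); first by rewrite mulr_ge0.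
move=> x t st tt; have [dom bnd] := hC x t (le_lt_trans sigma0 st) tt.
split => //; apply: le_trans bnd _; apply: ler_wpM2r => //; rewrite -mulrA.
by apply: ler_wpM2l => //; exact: kern_sum_le.
Qed.

Lemma frac_power_stage_holder b : 0 < b < 1 - g -> exists2 C, 0 <= C &
  forall x s t, sigma < s -> s <= t -> t <= tau ->
    `|P (G t x - G s x)| <= C * ((t - s) `^ b * kern (g + b) (s - sigma)) * `|x|.
Proof.
move=> /andP[b0 bg].
have [D D0 forced] := weightedG.
have [Mg Mg0 fracg] := fracT g01.
have gb01 : 0 <= g + b < 1 by apply/andP; split; [rewrite addr_ge0// ltW|lra].
have gb0 : 0 <= g + b by case/andP: gb01.
have /andP[g_0 _] := g01.
have b01 : 0 <= b <= 1 by apply/andP; split; [exact: ltW|lra].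
have [Cw Cw0 hCw] := kern_weight_integral_le n r0 gb01 m01'.
have [C C0 hC] := frac_power_holder C0T genT M1 omega0 stableT g01 Mg0 fracg b01.
have [Cb _ hCb] := frac_power_stage_bound.
exists (C * (1 + 2 * (D * Cw * n.+1%:R))).
  by rewrite mulr_ge0// addr_ge0// !mulr_ge0.
move=> x s t ss st tt.
have s0 : 0 < s by exact: le_lt_trans ss.
pose H u := D * `|x| * weight r m n u.
have Dx0 : 0 <= D * `|x| by rewrite mulr_ge0.
have H0 u : 0 <= H u by rewrite mulr_ge0// weight_ge0.
have HH u : 0 <= H u <= D * `|x| * weight r m n u by rewrite H0 lexx.
have mH : measurable_fun [set: R] H by apply: measurable_funM => //; exact: measurable_weight.
have [doms _] := hCb x s ss (le_trans st tt).
have [domt _] := hCb x t (lt_le_trans ss st) tt.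
pose k := kern (g + b) (s - sigma).
have ssig : 0 < s - sigma by rewrite subr_gt0.
have ksum w : s <= w -> kern_sum r (g + b) n.+1 w <= n.+1%:R * k.
  move=> sw; apply: le_trans (kern_sum_le r0 gb0 (lt_le_trans ss sw)) _.
  apply: ler_wpM2l => //; apply: kern_le => //.
  by rewrite lerD2r.
have conv w : s <= w -> w <= tau -> (\int[mu]_(u in `[0%R, t]) (kern (g + b) (w - u) * H u)%:E <=
    (D * `|x| * Cw * (n.+1%:R * k))%:E)%E.
  move=> sw wt; apply: le_trans (hCw _ _ w Dx0 HH wt _) _.
  by rewrite lee_fin; apply: ler_wpM2l; rewrite ?mulr_ge0//; exact: ksum.
have hK : (\int[mu]_(u in `[0%R, t]) ((kern (g + b) (s - u) + kern (g + b) (t - u)) * H u)%:E <=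
    (D * `|x| * Cw * (n.+1%:R * k) + D * `|x| * Cw * (n.+1%:R * k))%:E)%E.
  have -> : (\int[mu]_(u in `[0%R, t]) ((kern (g + b) (s - u) + kern (g + b) (t - u)) * H u)%:E =
      \int[mu]_(u in `[0%R, t]) ((kern (g + b) (s - u) * H u)%:E +
        (kern (g + b) (t - u) * H u)%:E))%E.
    by apply: eq_integral => u _; rewrite -EFinD mulrDl.
  have mk w : measurable_fun `[0, t] (fun u => (kern (g + b) (w - u) * H u)%:E).
    apply/measurable_EFinP; apply: measurable_funTS; apply: measurable_funM => //.
    exact: measurable_kern_reflect.
  have k0 w u : (0 <= (kern (g + b) (w - u) * H u)%:E)%E.
    by rewrite lee_fin mulr_ge0 ?kern_ge0.
  have mI : measurable (`[0, t]%classic : set R) by exact: measurable_itv.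
  rewrite (ge0_integralD mu mI (fun u _ => k0 s u) (mk s) (fun u _ => k0 t u) (mk t)).
  rewrite EFinD; apply: leeD; apply: conv => //; exact: le_trans tt.
apply: le_trans (hC G x tau H (forced x) mH H0 s t _ s0 st tt doms domt hK) _.
have ks : kern (g + b) s <= k by apply: kern_le => //; rewrite gerBl.
apply: (@le_trans _ _ (C * (t - s) `^ b *
    (k * `|x| + (D * `|x| * Cw * (n.+1%:R * k) + D * `|x| * Cw * (n.+1%:R * k))))).
  apply: ler_wpM2l; first by rewrite mulr_ge0 ?powR_ge0.
  by rewrite lerD2r; apply: ler_wpM2r.
by rewrite le_eqVlt; apply/orP; left; apply/eqP; rewrite -/k; ring.
Qed.

(** The integral up to [tau] is part of a convolution with [kern 0] at a later
    time. *)
Lemma kern_stage_integral : exists2 I, 0 <= I & forall E : set R,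
  E `<=` [set u | u <= tau] -> (\int[mu]_(u in E) (kern g (u - sigma))%:E <= I%:E)%E.
Proof.
have o01 : 0 <= (0 : R) < 1 by rewrite lexx ltr01.
exists (beta_kernel 0 g * kern (0 + g - 1) (tau + 1 - sigma)).
  by rewrite mulr_ge0 ?beta_kernel_ge0 ?kern_ge0.
move=> E Et; rewrite -(kern_conv (tau + 1) sigma o01 g01').
apply: ge0_integral_le_gen => // u; last by rewrite lee_fin mulr_ge0 ?kern_ge0.
move=> /Et /= ut; rewrite !lee_fin kern_ge0 /= [kern 0 _]kernE.
  by rewrite oppr0 powRr0 mul1r.
by rewrite subr_gt0 (le_lt_trans ut)// ltrDl.
Qed.

(** The Hoelder estimate, with any admissible exponent, gives left continuity
    inside the stage, and the pointwise bound gives the majorant. *)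
Lemma frac_power_stage_integrable s t x : sigma <= s -> t <= tau ->
  bochner_integrable `[s, t] (fun u => P (G u x)).
Proof.
move=> ss tt; have [C C0 hC] := frac_power_stage_bound.
have [g_0 g_1] := andP g01.
have [Mg Mg0 fracg] := fracT g01.
have [I _ hI] := kern_stage_integral.
pose b := (1 - g) / 2.
have b01 : 0 < b < 1 - g by apply/andP; split; rewrite /b; lra.
have b0 : 0 < b by case/andP: b01.
have gb0 : 0 <= g + b by rewrite addr_ge0// ltW.
have [Ch Ch0 holder] := frac_power_stage_holder b01.
have mI : measurable `[s, t]%classic by exact: measurable_itv.
apply: (@grid_bochner_integrable _ _ `[s, t] _ (fun w => C * `|x| * 2 * kern g (w - sigma)) sigma).
- exact: mI.
- apply: filterS (ae_neq sigma) => w wn; rewrite /= in_itv/= => /andP[sw wt].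
  have ws : sigma < w.
    by rewrite lt_neqAle (le_trans ss sw) andbT eq_sym; apply/eqP.
  split => // e e0; have wt' : w <= tau by exact: le_trans tt.
  have h20 : 0 < (w - sigma) / 2 by rewrite divr_gt0// subr_gt0.
  pose K := Ch * kern (g + b) ((w - sigma) / 2) * `|x|.
  have K0 : 0 <= K by rewrite !mulr_ge0 ?kern_ge0.
  have q0 : 0 < e / (K + 1) by rewrite divr_gt0// ltr_wpDl.
  pose d := Num.min ((w - sigma) / 2) ((e / (K + 1)) `^ b^-1).
  exists d; first by rewrite lt_min h20 powR_gt0.
  move=> u su wu uw; have uw0 : 0 <= w - u by rewrite subr_ge0.
  have [domw _] := hC x w ws wt'.
  have [domu _] := hC x u su (le_trans uw wt').
  have [_ <-] := frac_powerB C0T M1 omega0 stableT g01 fracg domw domu.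
  apply: le_trans (holder x u w su uw wt') _.
  have : w - u < d by rewrite ltrBlDr addrC -ltrBlDr.
  rewrite lt_min => /andP[wu1 wu2].
  have pw : (w - u) `^ b <= e / (K + 1).
    have -> : e / (K + 1) = ((e / (K + 1)) `^ b^-1) `^ b.
      by rewrite -powRrM mulVf ?gt_eqF// powRr1// ltW.
    by apply: ge0_ler_powR; rewrite ?nnegrE ?powR_ge0 ?(ltW b0) ?(ltW wu2).
  have kk : kern (g + b) (u - sigma) <= kern (g + b) ((w - sigma) / 2).
    by apply: kern_le => //; lra.
  apply: (@le_trans _ _ (K * (w - u) `^ b)).
    rewrite (_ : Ch * _ * _ = Ch * `|x| * (w - u) `^ b * kern (g + b) (u - sigma)); last by ring.
    rewrite (_ : K * _ = Ch * `|x| * (w - u) `^ b * kern (g + b) ((w - sigma) / 2)).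
      by apply: ler_wpM2l => //; rewrite !mulr_ge0 ?powR_ge0.
    by rewrite /K; ring.
  apply: (@le_trans _ _ (K * (e / (K + 1)))); first exact: ler_wpM2l.
  by rewrite mulrCA ler_piMr ?(ltW e0)// ler_pdivrMr ?ltr_wpDl// mul1r lerDl.
- move=> w u; rewrite /= in_itv/= => /andP[_ wt] su uh uw.
  have wt' : w <= tau by exact: le_trans tt.
  have [_ bnd] := hC x u su (le_trans uw wt'); apply: le_trans bnd _.
  have sw : 0 < (w - sigma) / 2 by rewrite divr_gt0// subr_gt0 (lt_le_trans su).
  rewrite (_ : C * `|x| * 2 * _ = C * `|x| * (2 * kern g (w - sigma))); last by ring.
  rewrite mulrAC; apply: ler_wpM2l; first by rewrite mulr_ge0.
  apply: le_trans (kern_half _ _); last by rewrite g0 ltW.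
  by apply: kern_le => //; lra.
- apply: measurable_funTS; apply: measurable_funM => //; exact: measurable_kern_shift.
- by move=> w _; rewrite !mulr_ge0 ?kern_ge0.
- have c0 : 0 <= C * `|x| * 2 by rewrite !mulr_ge0.
  have -> : (\int[mu]_(w in `[s, t]) (C * `|x| * 2 * kern g (w - sigma))%:E =
      (C * `|x| * 2)%:E * \int[mu]_(w in `[s, t]) (kern g (w - sigma))%:E)%E.
    rewrite -(ge0_integralZl_EFin mu mI _ _ c0)//.
    - by move=> u _; rewrite lee_fin kern_ge0.
    - by apply/measurable_EFinP; apply: measurable_funTS; exact: measurable_kern_shift.
  apply: lte_mul_pinfty => //; apply: le_lt_trans (hI _ _) (ltry _).
  by move=> u /=; rewrite in_itv/= => /andP[_ ut]; exact: le_trans tt.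
Qed.

Lemma frac_power_stage_integral_bound : exists2 C, 0 <= C &
  forall s t x, sigma <= s -> t <= tau ->
    `|bochner `[s, t] (fun u => P (G u x))| <= C * `|x|.
Proof.
have [C C0 hC] := frac_power_stage_bound; have [I I0 hI] := kern_stage_integral.
exists (C * I) => [|s t x ss tt]; first exact: mulr_ge0.
have mI : measurable `[s, t]%classic by exact: measurable_itv.
have int := bochner_has_integral mI (frac_power_stage_integrable x ss tt).
have c0 : 0 <= C * `|x| by rewrite mulr_ge0.
have k0 u : `[s, t]%classic u -> (0 <= (kern g (u - sigma))%:E)%E by rewrite lee_fin kern_ge0.
have mk : measurable_fun `[s, t] (fun u => (kern g (u - sigma))%:E).
  by apply/measurable_EFinP; apply: measurable_funTS; exact: measurable_kern_shift.
rewrite -lee_fin; apply: (@le_trans _ _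
    (\int[mu]_(u in `[s, t]) ((C * `|x|)%:E * (kern g (u - sigma))%:E))%E).
  apply: (has_integral_norm_le mI int (g := fun u => ((C * `|x|)%:E * (kern g (u - sigma))%:E)%E)).
  - exact: measurable_funeM.
  - by move=> u Iu; rewrite mule_ge0// ?k0// lee_fin.
  - apply: filterS (ae_neq sigma) => u un; rewrite /= in_itv/= => /andP[su ut].
    have us : sigma < u by rewrite lt_neqAle (le_trans ss su) andbT eq_sym; apply/eqP.
    have [_ bnd] := hC x u us (le_trans ut tt).
    by rewrite -EFinM lee_fin mulrAC.
rewrite (ge0_integralZl_EFin mu mI k0 mk c0) [C * I * _]mulrAC [leRHS]EFinM.
apply: lee_wpmul2l => //; apply: hI => u /=; rewrite in_itv/= => /andP[_ ut]; exact: le_trans tt.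
Qed.

End StageEstimates.

Lemma Lfun_infty_bound {R : realType} (r : R) (a : R -> R) :
  a \_ `[- r, 0] \in Lfun (@lebesgue_measure R) +oo%E ->
  exists2 M, 0 <= M & {ae (@lebesgue_measure R), forall th, - r <= th -> th <= 0 -> `|a th| <= M}.
Proof.
move=> /sub_Lfun_finLfun; rewrite inE /= /finite_norm unlock /=.
case: ifPn => [_ fin|/negP []]; last first.
  apply: (@lt_le_trans _ _ (lebesgue_measure (`[0%R, 1%R]%classic : set R))).
    by rewrite lebesgue_measure_itv/= lte_fin ltr01 oppr0 adde0 lte_fin ltr01.
  by apply: le_measure; rewrite ?inE//; exact: measurable_itv.
have [M hM] : exists M, {ae (@lebesgue_measure R), forall th, `|(a \_ `[- r, 0]) th| <= M}.
  by have [M hM] := ess_supr_bounded fin; exists M.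
exists `|M|; rewrite //; apply: filterS hM => th h th1 th2.
have Ith : `[- r, 0]%classic th by rewrite /= in_itv/= th1.
by move: h; rewrite patchE (mem_set Ith) => h; apply: le_trans h (ler_norm _).
Qed.

(** * Regularity of the fundamental solution *)

Theorem theorem2p1 (R : realType) (X : completeNormedModType R) (r : R)
    (A A1 A2 : operator X) (T : R -> X -> X) (a : R -> R) (G : R -> X -> X)
    (mu nu : R) :
  0 < r ->
  C0_semigroup T -> is_generator A T -> analytic_semigroup T ->
  negative_type A T ->
  linear_operator A1 -> closed_operator A1 -> opdom A `<=` opdom A1 ->
  linear_operator A2 -> closed_operator A2 -> opdom A `<=` opdom A2 ->
  a \_ `[- r, 0] \in Lfun (@lebesgue_measure R) +oo%E ->
  fundamental_solution T r A1 A2 a G ->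
  0 < mu < 1 -> 0 < nu < 1 ->
  opdom (frac_power T mu) `<=` opdom A1 ->
  opdom (frac_power T nu) `<=` opdom A2 ->
  (forall g : R, nu <= g < 1 ->
    exists C : nat -> R, forall n : nat,
      [/\ 0 < C n,
          forall t, n%:R * r < t <= n.+1%:R * r ->
            comp_norm_le (frac_power T g) (G t) (C n / (t - n%:R * r) `^ g)
        & forall s t, n%:R * r <= s -> s < t -> t <= n.+1%:R * r ->
            (forall x, bochner_integrable `[s, t]
                         (fun u => frac_power T g (G u x))) /\
            (opnorm (fun x => bochner `[s, t]
                         (fun u => frac_power T g (G u x))) <= (C n)%:E)%E])
  /\
  (forall g b : R, nu <= g < 1 -> 0 < b < 1 - g ->
    exists C : nat -> R, forall n : nat,
      0 < C n /\
      forall s t, n%:R * r < s -> s < t -> t < n.+1%:R * r ->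
        comp_norm_le (frac_power T g) (fun x => G t x - G s x)
          (C n * ((t - s) `^ b / (s - n%:R * r) `^ (b + g)))).
Proof.
move=> r0 C0T genT _ [[M [omega [M1 omega0 stableT]]] fracT].
move=> linA1 closedA1 _ linA2 closedA2 _ /Lfun_infty_bound[Ma Ma0 aM] fsG mu01 nu01 domA1 domA2.
have weighted n : forcing_weighted T G r mu n.
  exact: (forcing_weightedP r0 C0T genT M1 omega0 stableT fracT linA1 closedA1 linA2 closedA2
    Ma0 aM fsG mu01 nu01 domA1 domA2).
have /andP[nu0 _] := nu01.
have norm_le g S c : 0 <= c -> (forall x, opdom (frac_power T g) (S x) /\
    `|frac_power T g (S x)| <= c * `|x|) -> comp_norm_le (frac_power T g) S c.
  move=> c0 h; split; first by move=> x; case: (h x).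
  by apply: opnorm_le => // x; case: (h x).
split => [g /andP[nug g1]|g b /andP[nug g1] b01].
  have g01 : 0 < g < 1 by rewrite (lt_le_trans nu0 nug).
  pose bound n := cid2 (frac_power_stage_bound r0 C0T genT M1 omega0 stableT fracT mu01
    (weighted n) g01).
  pose ibound n := cid2 (frac_power_stage_integral_bound r0 C0T genT M1 omega0 stableT fracT
    mu01 (weighted n) g01).
  exists (fun n => s2val (bound n) + s2val (ibound n) + 1) => n.
  case: (bound n) => C C0 hC; case: (ibound n) => I I0 hI /=.
  split; first by rewrite ltr_wpDl// addr_ge0.
    move=> t /andP[nt tn]; have t0 : 0 < t - n%:R * r by rewrite subr_gt0.
    apply: norm_le => [|x]; first by rewrite divr_ge0 ?powR_ge0// !addr_ge0.
    have [dom bnd] := hC x t nt tn; split => //; apply: le_trans bnd _.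
    rewrite kernE// powRN; apply: ler_wpM2r => //; apply: ler_wpM2r.
      by rewrite invr_ge0 powR_ge0.
    by rewrite -addrA lerDl addr_ge0.
  move=> s t ns st tn; split.
    by move=> x; exact: (frac_power_stage_integrable r0 C0T genT M1 omega0 stableT fracT
      mu01 (weighted n) g01).
  apply: opnorm_le => [|x]; first by rewrite !addr_ge0.
  apply: le_trans (hI s t x ns tn) _; apply: ler_wpM2r => //.
  by rewrite [C + I]addrC -addrA lerDl addr_ge0.
have g01 : 0 < g < 1 by rewrite (lt_le_trans nu0 nug).
have [Mg Mg0 fracg] := fracT g g01.
pose bound n := cid2 (frac_power_stage_holder r0 C0T genT M1 omega0 stableT fracT mu01
  (weighted n) g01 b01).
exists (fun n => s2val (bound n) + 1) => n.
case: (bound n) => D D0 hD /=; split; first by rewrite ltr_wpDl.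
have [C C0 hC] := frac_power_stage_bound r0 C0T genT M1 omega0 stableT fracT mu01
  (weighted n) g01.
move=> s t ns st tn; have s0 : 0 < s - n%:R * r by rewrite subr_gt0.
have k0 : 0 <= (t - s) `^ b / (s - n%:R * r) `^ (b + g) by rewrite divr_ge0 ?powR_ge0.
apply: norm_le => [|x]; first by rewrite mulr_ge0// addr_ge0.
have [doms _] := hC x s ns (ltW (lt_trans st tn)).
have [domt _] := hC x t (lt_trans ns st) (ltW tn).
have [dom _] := frac_powerB C0T M1 omega0 stableT g01 fracg domt doms.
split => //; apply: le_trans (hD x s t ns (ltW st) (ltW tn)) _.
rewrite kernE// powRN [g + b]addrC; apply: ler_wpM2r => //; apply: ler_wpM2r => //.
by rewrite lerDl.
Qed.
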